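(* Let $(X,d)$ be a Riemannian space with an isolated conical or cuspidal singularity $p$, with a punctured neighbourhood of $p$ identified with $((0,R)\times Y,\ g=dr^2+f(r)^2h_r)$, and assume that $R$ is small enough so that $Rc<1$, where $c\ge0$ is a constant with $-2c\,h_r\le\partial_r h_r\le 2c\,h_r$ for all $r\in(0,R)$. (a) Let $\gamma_\delta=(r_\delta,y_\delta):I_\delta\to(0,R)\times Y$, $\delta\in(0,R)$, be any family of unit speed geodesics with $\min_t r_\delta(t)=r_\delta(0)=\delta>0$, with maximal interval of existence $I_\delta$. Then as $\delta\to0$ we have $I_\delta\to(-R,R)$ (i.e. the endpoints of $I_\delta$ converge to $\pm R$), and $$r_\delta(t)\to|t|\quad\text{for all }t\in(-R,R).$$ (b) In the case of a warped product ($h_r=h$ independent of $r$) with convex warping function $f$, the following comparison principle holds. If $\gamma=(r,y)$ and $\overline{\gamma}=(\overline r,\overline y)$ are two unit speed geodesics in $(0,R)\times Y$ which both reach their lowest point (minimum of the $r$-coordinate) at $t=0$, and if $r(0)<\overline r(0)$, then $r(t)<\overline r(t)$ for all times $t$ (at which both are defined).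
   Context: Let $Y$ be a closed manifold and $R>0$. A generalized warped product metric on $(0,R)\times Y$ is a smooth Riemannian metric $g=dr^2+f(r)^2h_r$, where $r$ is the coordinate on $(0,R)$, $f:(0,R)\to(0,\infty)$ is continuously differentiable (the warping function), and for each $r\in[0,R)$, $h_r$ is a Riemannian metric on $Y$ depending continuously differentiably on $r$. Standing regularity assumption: the $h_r$ are uniformly positive definite and depend uniformly $C^1$ on $r$, i.e. there is a constant $c\ge0$ with $-2c\,h_r\le\partial_rh_r\le2c\,h_r$ for all $r\in(0,R)$. A metric space $(X,d)$ is a Riemannian space with an isolated conical or cuspidal singularity at $p\in X$ if $X\setminus\{p\}$ is a smooth manifold, $d$ is induced by a Riemannian metric $g_X$ on $X\setminus\{p\}$, and there are a neighbourhood $U$ of $p$, a number $R>0$, a closed manifold $Y$ and a continuous map $\beta:[0,R)\times Y\to U$ sending $\{0\}\times Y$ to $p$ and restricting to an isometry $((0,R)\times Y,g)\to(U\setminus\{p\},g_X)$, where $g$ is a generalized warped product metric whose warping function extends to a continuously differentiable $f:[0,R)\to[0,\infty)$ with $f(0)=0$ and $f$ convex. The singularity is conical if $f'(0)>0$ and cuspidal if $f'(0)=0$. Geodesics are maximal geodesics in $(0,R)\times Y$. *)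

(* Defs.v *)
From HB Require Import structures.
From mathcomp Require Import all_boot all_order all_algebra.
From mathcomp Require Import all_classical all_reals all_analysis.
Set Implicit Arguments.
Unset Strict Implicit.
Unset Printing Implicit Defensive.
Import Order.TTheory GRing.Theory Num.Theory.
Import numFieldNormedType.Exports.
Local Open Scope classical_set_scope.
Local Open Scope ring_scope.

(* C^k by iterated partial derivatives; only used on open sets A. *)
Fixpoint Ck_on (R : realType) (m : nat) (W : normedModType R) (k : nat)
    (A : set 'rV[R]_m) (f : 'rV[R]_m -> W) : Prop :=
  {in A, continuous f} /\
  if k is k'.+1 then
    forall i : 'I_m, (forall u, A u -> derivable f u (delta_mx 0 i)) /\
                     Ck_on k' A (fun u => 'D_(delta_mx 0 i) f u)
  else True.

Definition smooth_on (R : realType) (m : nat) (W : normedModType R)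
    (A : set 'rV[R]_m) (f : 'rV[R]_m -> W) : Prop :=
  forall k, Ck_on k A f.

(* The derivative is taken within A, hence is one-sided at an endpoint of an
   interval A which belongs to A. *)
Definition C1_with_derivative (R : realType) (W : normedModType R)
    (A : set R) (F dF : R -> W) : Prop :=
  {within A, continuous dF} /\
  forall r, A r ->
    (s - r)^-1 *: (F s - F r) @[s --> within (A `\ r) (nbhs r)] --> dF r.

Definition C1_on (R : realType) (W : normedModType R) (A : set R)
    (F : R -> W) : Prop :=
  exists dF, C1_with_derivative A F dF.

Definition qform (R : realType) (n : nat) (G : 'M[R]_n) (v : 'rV[R]_n) : R :=
  (v *m G *m v^T) 0 0.

(* A manifold is an open subset D of a topological space M with an atlas, i.e.
   an indexed family of charts.  A Riemannian metric is given by its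
   coefficient matrix in each chart, as a function of the point of M. *)

Record chart (R : realType) (n : nat) (M : topologicalType) := Chart {
  cdom : set M ;
  cimg : set 'rV[R]_n ;
  cmap : M -> 'rV[R]_n ;
  cinv : 'rV[R]_n -> M }.

Definition is_chart (R : realType) (n : nat) (M : topologicalType) (D : set M)
    (a : chart R n M) : Prop :=
  [/\ open (cdom a) /\ cdom a `<=` D, open (cimg a),
      forall x, cdom a x -> cimg a (cmap a x) /\ cinv a (cmap a x) = x,
      forall u, cimg a u -> cdom a (cinv a u) /\ cmap a (cinv a u) = u
    & {in cdom a, continuous (cmap a)} /\ {in cimg a, continuous (cinv a)}].

(* When M is metrizable and D is the complement of a point, the separation and
   countability conditions on M are equivalent to those on D. *)
Definition smooth_manifold (R : realType) (n : nat) (M : topologicalType)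
    (D : set M) (I : Type) (at_ : I -> chart R n M) : Prop :=
  [/\ hausdorff_space M /\ @second_countable M, open D,
      forall a, is_chart D (at_ a),
      forall x, D x -> exists a, cdom (at_ a) x
    & forall a b,
        smooth_on [set u | cimg (at_ a) u /\ cdom (at_ b) (cinv (at_ a) u)]
                  (cmap (at_ b) \o cinv (at_ a))].

Definition closed_manifold (R : realType) (n : nat) (Y : topologicalType)
    (I : Type) (at_ : I -> chart R n Y) : Prop :=
  compact [set: Y] /\ smooth_manifold [set: Y] at_.

(* Differential, in the charts a and b, acting on row vectors on the right. *)
Definition chart_jacobian (R : realType) (m n : nat) (M N : topologicalType)
    (a : chart R m M) (b : chart R n N) (F : M -> N) (x : M) : 'M[R]_(m, n) :=
  jacobian (cmap b \o F \o cinv a) (cmap a x).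

Definition riemannian_metric (R : realType) (n : nat) (M : topologicalType)
    (I : Type) (at_ : I -> chart R n M) (g : I -> M -> 'M[R]_n) : Prop :=
  [/\ forall a x, cdom (at_ a) x ->
        (g a x)^T = g a x /\ (forall v, v != 0 -> 0 < qform (g a x) v),
      forall a, smooth_on (cimg (at_ a)) (fun u => g a (cinv (at_ a) u))
    & forall a b x, cdom (at_ a) x -> cdom (at_ b) x ->
        let J := chart_jacobian (at_ a) (at_ b) id x in
        g a x = J *m g b x *m J^T].

Definition smooth_map (R : realType) (m n : nat) (M N : topologicalType)
    (D : set M) (E : set N) (I K : Type)
    (atM : I -> chart R m M) (atN : K -> chart R n N) (F : M -> N) : Prop :=
  [/\ forall x, D x -> E (F x), {in D, continuous F}
    & forall a b,
        smooth_on [set u | [/\ cimg (atM a) u, D (cinv (atM a) u)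
                             & cdom (atN b) (F (cinv (atM a) u))]]
                  (cmap (atN b) \o F \o cinv (atM a))].

Definition riemannian_isometry (R : realType) (m n : nat)
    (M N : topologicalType) (D : set M) (E : set N) (I K : Type)
    (atM : I -> chart R m M) (gM : I -> M -> 'M[R]_m)
    (atN : K -> chart R n N) (gN : K -> N -> 'M[R]_n) (F : M -> N) : Prop :=
  exists F' : N -> M,
  [/\ smooth_map D E atM atN F /\ smooth_map E D atN atM F',
      forall x, D x -> F' (F x) = x,
      forall y, E y -> F (F' y) = y
    & forall a b x, D x -> cdom (atM a) x -> cdom (atN b) (F x) ->
        let J := chart_jacobian (atM a) (atN b) F x in
        gM a x = J *m gN b (F x) *m J^T].

(* Independent of the choice of chart; junk value 0 outside all charts. *)
Definition speed (R : realType) (n : nat) (M : topologicalType) (I : Type)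
    (at_ : I -> chart R n M) (g : I -> M -> 'M[R]_n) (c : R -> M) (t : R) : R :=
  xget 0 [set s | exists a, cdom (at_ a) (c t) /\
    s = Num.sqrt (qform (g a (c t)) (derive1 (cmap (at_ a) \o c) t))].

Definition curve_length (R : realType) (n : nat) (M : topologicalType)
    (I : Type) (at_ : I -> chart R n M) (g : I -> M -> 'M[R]_n) (c : R -> M)
    : \bar R :=
  (\int[lebesgue_measure]_(t in `[0%R, 1%R]) (speed at_ g c t)%:E)%E.

(* Off a finite set of times, c is C^1 and stays in D; at these times it may
   leave D.  This lets curves in X start at, end at or pass through p. *)
Definition piecewise_C1 (R : realType) (n : nat) (M : topologicalType)
    (D : set M) (I : Type) (at_ : I -> chart R n M) (c : R -> M) : Prop :=
  {within `[0, 1], continuous c} /\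
  exists S : set R, finite_set S /\
    forall t, 0 < t < 1 -> ~ S t ->
      D (c t) /\
      forall a, cdom (at_ a) (c t) ->
        derivable (cmap (at_ a) \o c) t 1 /\
        {for t, continuous (derive1 (cmap (at_ a) \o c))}.

Definition distance_induced_by (R : realType) (n : nat) (X : metricType R)
    (D : set X) (I : Type) (at_ : I -> chart R n X) (g : I -> X -> 'M[R]_n)
    : Prop :=
  forall x y : X,
    (mdist x y)%:E = ereal_inf [set curve_length at_ g c | c in
      [set c : R -> X | [/\ piecewise_C1 D at_ c, c 0 = x & c 1 = y]]].

(* Gamma^k_ij, k being the upper index *)
Definition christoffel (R : realType) (n : nat) (G : 'rV[R]_n -> 'M[R]_n)
    (u : 'rV[R]_n) (k i j : 'I_n) : R :=
  2^-1 * \sum_(l < n) invmx (G u) k l *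
    ('D_(delta_mx 0 i) G u j l + 'D_(delta_mx 0 j) G u i l
     - 'D_(delta_mx 0 l) G u i j).

Definition time_interval (R : realType) (a b : \bar R) : set R :=
  [set t | (a < t%:E < b)%E].

Definition geodesic_on (R : realType) (n : nat) (M : topologicalType)
    (D : set M) (I : Type) (at_ : I -> chart R n M) (g : I -> M -> 'M[R]_n)
    (a b : \bar R) (c : R -> M) : Prop :=
  forall t, time_interval a b t ->
  [/\ D (c t), {for t, continuous c}
    & forall e, cdom (at_ e) (c t) ->
        let u := cmap (at_ e) \o c in
        [/\ derivable u t 1, derivable (derive1 u) t 1
          & forall k, derive1 (derive1 u) t 0 k
              + \sum_(i < n) \sum_(j < n)
                  christoffel (fun v => g e (cinv (at_ e) v)) (u t) k i j
                  * derive1 u t 0 i * derive1 u t 0 j = 0]].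

Definition unit_speed_on (R : realType) (n : nat) (M : topologicalType)
    (I : Type) (at_ : I -> chart R n M) (g : I -> M -> 'M[R]_n)
    (a b : \bar R) (c : R -> M) : Prop :=
  forall t, time_interval a b t -> forall e, cdom (at_ e) (c t) ->
    qform (g e (c t)) (derive1 (cmap (at_ e) \o c) t) = 1.

(* The domain of a maximal geodesic is always open, so open intervals suffice. *)
Definition maximal_geodesic (R : realType) (n : nat) (M : topologicalType)
    (D : set M) (I : Type) (at_ : I -> chart R n M) (g : I -> M -> 'M[R]_n)
    (a b : \bar R) (c : R -> M) : Prop :=
  geodesic_on D at_ g a b c /\
  forall (a' b' : \bar R) (c' : R -> M),
    (a' <= a)%E -> (b <= b')%E -> geodesic_on D at_ g a' b' c' ->
    (forall t, time_interval a b t -> c' t = c t) ->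
    a' = a /\ b' = b.

Definition cylinder (R : realType) (Y : topologicalType) (r0 : R)
    : set (R * Y) :=
  `]0, r0[ `*` [set: Y].

Definition cylinder_atlas (R : realType) (n : nat) (Y : topologicalType)
    (I : Type) (atY : I -> chart R n Y) (r0 : R) (a : I)
    : chart R (1 + n) (R * Y)%type :=
  {| cdom := `]0, r0[ `*` cdom (atY a) ;
     cimg := [set v : 'rV[R]_(1 + n) |
                0 < lsubmx v 0 0 < r0 /\ cimg (atY a) (rsubmx v)] ;
     cmap := fun z => row_mx (z.1)%:M (cmap (atY a) z.2) ;
     cinv := fun v : 'rV[R]_(1 + n) =>
                (lsubmx v 0 0, cinv (atY a) (rsubmx v)) |}.

(* dr^2 + f(r)^2 h_r *)
Definition warped_metric (R : realType) (n : nat) (Y : topologicalType)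
    (I : Type) (f : R -> R) (h : R -> I -> Y -> 'M[R]_n)
    (a : I) (z : R * Y) : 'M[R]_(1 + n) :=
  block_mx 1%:M 0 0 (f z.1 ^+ 2 *: h z.1 a z.2).

(* - 2 c h_r <= d/dr h_r <= 2 c h_r, as quadratic forms *)
Definition derivative_bound (R : realType) (n : nat) (Y : topologicalType)
    (I : Type) (atY : I -> chart R n Y) (r0 : R)
    (h : R -> I -> Y -> 'M[R]_n) (c : R) : Prop :=
  forall r a y v, 0 < r < r0 -> cdom (atY a) y ->
    - (2 * c) * qform (h r a y) v <= qform (derive1 (fun s => h s a y) r) v
      <= 2 * c * qform (h r a y) v.

Definition generalized_warped_product (R : realType) (n : nat)
    (Y : topologicalType) (I : Type) (atY : I -> chart R n Y)
    (r0 : R) (f : R -> R) (h : R -> I -> Y -> 'M[R]_n) : Prop :=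
  [/\ closed_manifold atY /\ 0 < r0,
      (forall r, 0 < r < r0 -> 0 < f r) /\ C1_on `]0, r0[ f,
      (forall r, 0 <= r < r0 -> riemannian_metric atY (h r)) /\
      (forall a y, cdom (atY a) y -> C1_on `[0, r0[ (fun r => h r a y)),
      riemannian_metric (cylinder_atlas atY r0) (warped_metric f h)
    & exists2 c, 0 <= c & derivative_bound atY r0 h c].

Definition conical (R : realType) (r0 : R) (f : R -> R) : Prop :=
  exists2 df, C1_with_derivative `[0, r0[ f df & 0 < df 0.

Definition cuspidal (R : realType) (r0 : R) (f : R -> R) : Prop :=
  exists2 df, C1_with_derivative `[0, r0[ f df & df 0 = 0.

Definition isolated_singularity (R : realType) (n : nat)
    (X : metricType R) (p : X) (K : Type)
    (atX : K -> chart R (1 + n) X) (gX : K -> X -> 'M[R]_(1 + n))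
    (Y : topologicalType) (I : Type) (atY : I -> chart R n Y)
    (r0 : R) (f : R -> R) (h : R -> I -> Y -> 'M[R]_n)
    (U : set X) (beta : R * Y -> X) : Prop :=
  [/\ [/\ smooth_manifold (~` [set p]) atX, riemannian_metric atX gX
        & distance_induced_by (~` [set p]) atX gX],
      generalized_warped_product atY r0 f h,
      [/\ f 0 = 0, convex_function (`[0, r0[%classic : set R^o) f
        & conical r0 f \/ cuspidal r0 f],
      [/\ open U, U p,
          {within (`[0, r0[ `*` [set: Y]), continuous beta}
        & forall y, beta (0, y) = p]
    & riemannian_isometry (@cylinder R Y r0) (U `\ p)
        (cylinder_atlas atY r0) (warped_metric f h) atX gX beta].

(* Main.v *)
Require Import Defs.
From HB Require Import structures.
From mathcomp Require Import all_boot all_order all_algebra.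
From mathcomp Require Import all_classical all_reals all_analysis.
From mathcomp Require Import ring lra.
Set Implicit Arguments.
Unset Strict Implicit.
Unset Printing Implicit Defensive.
Import Order.TTheory GRing.Theory Num.Theory.
Import numFieldNormedType.Exports.
Local Open Scope classical_set_scope.
Local Open Scope ring_scope.

(** Along a unit speed geodesic with radial part [r], the radial component of
    the geodesic equation, unit speed and the bound on the derivative of [h_r]
    give [r'' >= (f'/f - c)(1 - r'^2)], and convexity of [f] with [f(0) = 0]
    gives [f'/f >= 1/r].  Hence, with [k = 1 - R c], [(r^2/2)'' >= k], so that
    [r^2 >= k t^2], while [(r (1 - c r))^2 (1 - r'^2)] is nonincreasing for
    [t >= 0].  Together these bound [1 - r'^2] by [d^2 / (k^3 t^2)] when the
    lowest point is at height [d], so [r'] is close to 1 once [t >= sqrt d] and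
    [r(t)] is squeezed to [|t|].  The geodesic exists until [r] reaches [R]
    because a geodesic that stays in a compact set extends.

    For a warped product one has [f(r)^2 (1 - r'^2) = f(r(0))^2] (Clairaut) and
    [(f(r) r')' = f'(r)].  Up to a first meeting time the second identity gives
    [f(r) r' <= f(rbar) rbar'] because [f'] is nondecreasing, whereas at the
    meeting time the first one gives [r' > rbar']. *)

(** * Differential calculus in several variables *)

(** Extending geodesics takes most of the length. Prolonging a curve past the end of its domain
    needs an existence time that depends only on a region of positions and a bound on the coordinate
    velocity. The geodesic field is quadratic in the velocity and defined only over a chart, so it
    is cut off to a bounded Lipschitz field on a whole vector space, where Picard iteration needs no
    bookkeeping of domains. The prolongation is built in one chart but has to satisfy the equation
    in every chart; this calls for the transformation of the geodesic equation, and with it for the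
    symmetry of the second derivatives of transition maps.

    The radial estimates are proved for [t >= 0], and negative times follow by reversing the
    geodesic. *)

Lemma ler_entry_norm (R : realType) m n (M : 'M[R]_(m, n)) i j :
  `|M i j| <= `|M|.
Proof.
rewrite [leRHS]/Num.Def.normr/= mx_normrE.
exact: (le_bigmax _ (fun k : 'I_m * 'I_n => `|M k.1 k.2|) (i, j)).
Qed.

Lemma mx_norm_leP (R : realType) m n (M : 'M[R]_(m, n)) e :
  0 <= e -> (forall i j, `|M i j| <= e) -> `|M| <= e.
Proof.
move=> e0 Me; rewrite [leLHS]/Num.Def.normr/= mx_normrE.
by apply: bigmax_le => // -[i j] _.
Qed.

Lemma mx_norm_ltP (R : realType) m n (M : 'M[R]_(m, n)) e :
  0 < e -> (forall i j, `|M i j| < e) -> `|M| < e.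
Proof.
move=> e0 Me; rewrite [ltLHS]/Num.Def.normr/= mx_normrE.
by apply: bigmax_lt => // -[i j] _.
Qed.

Lemma mean_value_le (R : realType) (f df : R -> R) (C a b : R) :
  (forall x, Num.min a b <= x <= Num.max a b -> is_derive x 1 f (df x)) ->
  (forall x, Num.min a b <= x <= Num.max a b -> `|df x| <= C) ->
  `|f b - f a| <= C * `|b - a|.
Proof.
wlog ab : a b / a <= b.
  move=> H; case/orP: (le_total a b) => [ab|ba]; first exact: H.
  move=> fd dC; rewrite distrC [`|b - a|]distrC.
  by apply: H => // x; rewrite minC maxC => xab; [exact: fd|exact: dC].
rewrite (min_idPl ab) (max_idPr ab) => fd dC.
have [||c cab ->] := @MVT_segment R f df a b ab.
- by move=> x xab; apply: fd; move: xab; rewrite in_itv/= => /andP[/ltW -> /ltW ->].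
- apply: derivable_within_continuous => x xab.
  by have [] := fd x _; move: xab; rewrite in_itv.
- rewrite normrM ler_wpM2r// dC//; by move: cab; rewrite in_itv.
Qed.

Lemma derivable_affine_line (R : realType) (V W : normedModType R) (f : V -> W)
    (z v : V) (s : R) :
  derivable f (z + s *: v) v ->
  is_derive s 1 (fun s => f (z + s *: v)) ('D_v f (z + s *: v)).
Proof.
move=> df.
have E : (fun h : R => h^-1 *: (f (z + (h *: 1 + s) *: v) - f (z + s *: v))) =
         (fun h => h^-1 *: (f (h *: v + (z + s *: v)) - f (z + s *: v))).
  apply/funext => h; congr (_ *: (f _ - _)).
  by rewrite [h *: 1]mulr1 scalerDl addrCA.
apply: DeriveDef; first by rewrite /derivable /= E.
by rewrite /derive /= E.
Qed.

Lemma is_derive_mull (R : realType) (c t : R) : is_derive t 1 (fun s => c * s) c.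
Proof.
have -> : (fun s : R => c * s) = c \*: (id : R -> R^o) by [].
apply: is_derive_eq (is_deriveZ _ _) _; exact: mulr1.
Qed.

Section box_estimate.
Variables (R : realType) (m : nat) (f : 'rV[R]_m -> R) (u0 : 'rV[R]_m).
Variables (rho e : R) (c : 'I_m -> R).
Hypothesis fd : forall (i : 'I_m) z, `|z - u0| < rho ->
  derivable f z (delta_mx 0 i) /\ `|'D_(delta_mx 0 i) f z - c i| <= e.

(** The path from [x] to [y] changes one coordinate at a time, [mix k] having the first [k]
    coordinates of [y]. Since the norm is the maximum of the entries, the path stays in the box, and
    each leg is a mean value estimate in one variable. *)
Lemma box_estimate x y : `|x - u0| < rho -> `|y - u0| < rho ->
  `|f y - f x - \sum_(i < m) c i * (y 0 i - x 0 i)| <= m%:R * e * `|y - x|.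
Proof.
move=> xB yB.
have rho0 : 0 < rho by apply: le_lt_trans xB.
pose mix k : 'rV[R]_m := \row_j (if (j < k)%N then y 0 j else x 0 j).
have mix0 : mix 0%N = x by apply/rowP => j; rewrite mxE.
have mixm : mix m = y by apply/rowP => j; rewrite mxE ltn_ord.
have mixS (k : 'I_m) : mix k.+1 = mix k + (y 0 k - x 0 k) *: delta_mx 0 k.
  apply/rowP => j; rewrite !mxE ltnS leq_eqVlt eqxx /=.
  have [->|jk] := eqVneq j k; first by rewrite eqxx ltnn /= mulr1 subrKC.
  have -> : (j == k :> nat) = false by apply: negbTE.
  by rewrite /= mulr0 addr0.
have mixB (k : 'I_m) s : Num.min 0 (y 0 k - x 0 k) <= s <= Num.max 0 (y 0 k - x 0 k) ->
    `|mix k + s *: delta_mx 0 k - u0| < rho.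
  move=> sB; apply: mx_norm_ltP => // i j; rewrite ord1 {i} !mxE eqxx /=.
  have xj : `|x 0 j - u0 0 j| < rho.
    by apply: le_lt_trans xB; have := ler_entry_norm (x - u0) 0 j; rewrite !mxE.
  have yj : `|y 0 j - u0 0 j| < rho.
    by apply: le_lt_trans yB; have := ler_entry_norm (y - u0) 0 j; rewrite !mxE.
  have [jk|jk] := eqVneq j k; last first.
    by rewrite mulr0 addr0; case: ifP.
  rewrite jk ltnn mulr1; rewrite jk in xj yj.
  move: xj yj sB; rewrite !ltr_norml.
  by case: (leP 0 (y 0 k - x 0 k)) => _ /andP[? ?] /andP[? ?] /andP[? ?]; apply/andP; split; lra.
have -> : f y - f x = \sum_(k < m) (f (mix k.+1) - f (mix k)).
  rewrite -(big_mkord xpredT (fun k => f (mix k.+1) - f (mix k))).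
  by rewrite telescope_sumr// mix0 mixm.
rewrite -sumrB (le_trans (ler_norm_sum _ _ _))//.
have -> : m%:R * e * `|y - x| = \sum_(i < m) e * `|y - x|.
  by rewrite sumr_const card_ord -mulrA mulr_natl.
apply: ler_sum => k _.
have e0 : 0 <= e by have [_] := fd k xB; apply: le_trans.
(* Without the linear part, the increment along the k-th leg has derivative at most [e] in absolute
   value. *)
pose g s := f (mix k + s *: delta_mx 0 k) - c k * s.
have -> : f (mix k.+1) - f (mix k) - c k * (y 0 k - x 0 k) =
          g (y 0 k - x 0 k) - g 0.
  by rewrite /g mixS scale0r addr0 mulr0 subr0 addrAC.
apply: (@le_trans _ _ (e * `|y 0 k - x 0 k - 0|)).
  apply: (@mean_value_le _ _
    (fun s => 'D_(delta_mx 0 k) f (mix k + s *: delta_mx 0 k) - c k)) => s sB.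
    have [d1 _] := fd k (mixB k s sB).
    apply: is_deriveB; first exact: derivable_affine_line.
    exact: is_derive_mull.
  by have [] := fd k (mixB k s sB).
rewrite subr0 ler_wpM2l//.
by have := ler_entry_norm (y - x) 0 k; rewrite !mxE.
Qed.

End box_estimate.

Lemma box_lipschitz (R : realType) m (f : 'rV[R]_m -> R) (u0 : 'rV[R]_m) rho
    (c : 'I_m -> R) e :
  (forall (i : 'I_m) z, `|z - u0| < rho ->
    derivable f z (delta_mx 0 i) /\ `|'D_(delta_mx 0 i) f z - c i| <= e) ->
  forall x y, `|x - u0| < rho -> `|y - u0| < rho ->
  `|f y - f x| <= (\sum_i `|c i| + m%:R * e) * `|y - x|.
Proof.
move=> fd x y xB yB; have := box_estimate fd xB yB.
rewrite mulrDl -lerBlDl; apply: le_trans; rewrite lerBlDr.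
rewrite -[X in X <= _](_ : `|f y - f x - \sum_i c i * (y 0 i - x 0 i)
  + \sum_i c i * (y 0 i - x 0 i)| = _); last first.
  by rewrite subrK.
apply: le_trans (ler_normD _ _) _; rewrite lerD2l.
rewrite mulr_suml (le_trans (ler_norm_sum _ _ _))//; apply: ler_sum => i _.
rewrite normrM ler_wpM2l//.
by have := ler_entry_norm (y - x) 0 i; rewrite !mxE.
Qed.

Lemma cvg_sum (R : numFieldType) (V : normedModType R) (T : Type)
    (F : set_system T) {FF : Filter F} (I : Type) (r : seq I) (f : I -> T -> V)
    (l : I -> V) : (forall i, f i x @[x --> F] --> l i) ->
  \sum_(i <- r) f i x @[x --> F] --> \sum_(i <- r) l i.
Proof.
move=> fl; elim: r => [|i r IH].
  by rewrite big_nil; under eq_fun do rewrite big_nil; exact: cvg_cst.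
rewrite big_cons; under eq_fun do rewrite big_cons.
exact: cvgD.
Qed.

(** The candidate for the differential; it is named so that it can carry the linear structure that
    [diff_unique] asks for. *)
Definition dlin (R : realType) m (c : 'I_m -> R) (v : 'rV[R]_m) : R :=
  \sum_i c i * v 0 i.

Section C1_differentiable.
Variables (R : realType) (m : nat) (f : 'rV[R]_m -> R) (u0 : 'rV[R]_m).
Hypothesis fd : \forall z \near u0, forall i : 'I_m,
  derivable f z (delta_mx 0 i).
Hypothesis fc : forall i : 'I_m,
  {for u0, continuous (fun z => 'D_(delta_mx 0 i) f z)}.
Let c i := 'D_(delta_mx 0 i) f u0.

Fact dlin_is_linear : linear (dlin c).
Proof.
move=> a u v; rewrite /dlin scaler_sumr -big_split/=; apply: eq_bigr => i _.
by rewrite !mxE mulrDr; congr (_ + _); rewrite mulrCA.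
Qed.
HB.instance Definition _ := GRing.isLinear.Build R _ _ _ (dlin c) dlin_is_linear.

Lemma C1_near_box e : 0 < e -> exists2 rho, 0 < rho &
  forall (i : 'I_m) z, `|z - u0| < rho ->
    derivable f z (delta_mx 0 i) /\ `|'D_(delta_mx 0 i) f z - c i| <= e.
Proof.
move=> e0.
have : \forall z \near u0, forall i : 'I_m,
    derivable f z (delta_mx 0 i) /\ `|'D_(delta_mx 0 i) f z - c i| <= e.
  have H : \forall z \near u0, forall i : 'I_m, `|'D_(delta_mx 0 i) f z - c i| <= e.
    apply: (@filter_forall _ _ (fun i z =>
      is_true (`|'D_(delta_mx 0 i) f z - c i| <= e)) _ (nbhs_filter u0)) => i.
    have /cvgrPdist_le/(_ _ e0) := fc (i := i).
    by apply: filterS => z; rewrite distrC.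
  by apply: filterS2 fd H => z H1 H2 i; split.
move=> /nbhs_ballP[rho /= rho0 B]; exists rho => // i z zB.
by apply: B; rewrite -ball_normE/= distrC.
Qed.

Lemma dlin_continuous : continuous (dlin c).
Proof.
move=> x; apply: (@cvg_sum _ _ _ (nbhs x)) => i; apply: cvgM; first exact: cvg_cst.
exact: coord_continuous.
Qed.

Lemma C1_differentiable : differentiable f u0.
Proof.
have df : f \o shift u0 = cst (f u0) + dlin c +o_ (0 : 'rV[R]_m) id.
  apply/eqaddoP => _/posnumP[e].
  (* The box estimate costs a factor [m]; dividing by [m.+1] also covers [m = 0]. *)
  pose e' := e%:num / (m.+1)%:R.
  have e'0 : 0 < e' by rewrite divr_gt0.
  have [rho rho0 H] := C1_near_box e'0.
  near=> h.
  have hB : `|(h + u0) - u0| < rho.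
    by rewrite addrK -[h]subr0 distrC; near: h; exact: (@cvgr_dist_lt _ _ _ _ _ id).
  have u0B : `|u0 - u0| < rho by rewrite subrr normr0.
  rewrite /= (_ : (_ - _ : 'rV_m -> R) h = f (h + u0) - f u0
    - \sum_(i < m) c i * ((h + u0) 0 i - u0 0 i)); last first.
    rewrite /= !fctE opprD addrA /dlin; congr (_ - _).
    by apply: eq_bigr => i _; rewrite !mxE addrK.
  apply: le_trans (box_estimate H u0B hB) _.
  rewrite addrK ler_wpM2r// /e' mulrCA ger_pMr// ler_pdivrMr ?ltr0n// mul1r.
  by rewrite ler_nat.
apply/diff_locallyP; rewrite (@diff_unique R _ R f (dlin c) u0 dlin_continuous df); split => //.
exact: dlin_continuous.
Unshelve. all: by end_near. Qed.

End C1_differentiable.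

Lemma differentiable_mx (R : realType) (V : normedModType R) p q
    (M : V -> 'M[R]_(p, q)) x :
  (forall i j, differentiable (fun y => M y i j) x) -> differentiable M x.
Proof.
move=> dM.
have -> : M = \sum_(i < p) \sum_(j < q) (fun y => M y i j *: delta_mx i j).
  apply/funext => y; rewrite [LHS]matrix_sum_delta fct_sumE.
  by apply: eq_bigr => i _; rewrite fct_sumE.
apply: differentiable_sum => i; apply: differentiable_sum => j.
exact: differentiableZl.
Qed.

Lemma is_derive_mxP (R : realType) (V : normedModType R) p q
    (M : V -> 'M[R]_(p, q)) x v dM :
  is_derive x v M dM <->
  forall i j, is_derive x v (fun y => M y i j) (dM i j).
Proof.
split=> [[d <-] i j|H].
  apply: DeriveDef; first by move/derivable_mxP : d; apply.
  by rewrite derive_mx// mxE.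
have d : derivable M x v by apply/derivable_mxP => i j; have [] := H i j.
apply: DeriveDef => //; rewrite derive_mx//; apply/matrixP => i j.
by rewrite mxE; have [] := H i j.
Qed.

Lemma is_derive_mulmx (R : realType) (V : normedModType R) p q r
    (M : V -> 'M[R]_(p, q)) (N : V -> 'M[R]_(q, r)) x v dM dN :
  is_derive x v M dM -> is_derive x v N dN ->
  is_derive x v (fun y => M y *m N y) (dM *m N x + M x *m dN).
Proof.
move=> /is_derive_mxP HM /is_derive_mxP HN; apply/is_derive_mxP => i j.
have -> : (fun y => (M y *m N y) i j) =
    \sum_(k < q) (fun y => M y i k * N y k j).
  by apply/funext => y; rewrite fct_sumE mxE.
have -> : (dM *m N x + M x *m dN) i j =
    \sum_(k < q) (M x i k * dN k j + N x k j * dM i k).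
  rewrite !mxE -big_split/=; apply: eq_bigr => k _.
  by rewrite addrC [dM _ _ * _]mulrC.
apply: is_derive_sum => k.
exact: (@is_deriveM _ _ (fun y => M y i k) (fun y => N y k j)).
Qed.

Lemma is_derive_trmx (R : realType) (V : normedModType R) p q
    (M : V -> 'M[R]_(p, q)) x v dM :
  is_derive x v M dM -> is_derive x v (fun y => (M y)^T) dM^T.
Proof.
move=> /is_derive_mxP H; apply/is_derive_mxP => i j; rewrite mxE.
by have -> : (fun y => (M y)^T i j) = (fun y => M y j i) by apply/funext => y; rewrite mxE.
Qed.

Lemma diff_rVE (R : realType) m (W : normedModType R) (f : 'rV[R]_m -> W) x v :
  differentiable f x -> 'd f x v = \sum_i v 0 i *: 'D_(delta_mx 0 i) f x.
Proof.
move=> df; rewrite {1}(row_sum_delta v) linear_sum/=; apply: eq_bigr => i _.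
by rewrite linearZ/= deriveE.
Qed.

Lemma is_derive_comp_rV (R : realType) m (W : normedModType R) (V : normedModType R)
    (f : 'rV[R]_m -> W) (u : V -> 'rV[R]_m) x v du :
  is_derive x v u du -> differentiable u x -> differentiable f (u x) ->
  is_derive x v (f \o u) (\sum_i du 0 i *: 'D_(delta_mx 0 i) f (u x)).
Proof.
move=> [_ <-] udiff df.
have dfu : differentiable (f \o u) x by exact: differentiable_comp.
apply: DeriveDef; first exact: diff_derivable.
by rewrite deriveE// diff_comp//= diff_rVE// -deriveE.
Qed.

Lemma is_derive_curve (R : realType) m (W : normedModType R)
    (f : 'rV[R]_m -> W) (u : R -> 'rV[R]_m) (t : R) du :
  is_derive t 1 u du -> differentiable f (u t) ->
  is_derive t 1 (f \o u) (\sum_i du 0 i *: 'D_(delta_mx 0 i) f (u t)).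
Proof.
move=> d df; apply: is_derive_comp_rV => //.
by apply/derivable1_diffP; case: d.
Qed.

Lemma Ck_on_le (R : realType) m (W : normedModType R) k l (A : set 'rV[R]_m)
    (f : 'rV[R]_m -> W) : (l <= k)%N -> Ck_on k A f -> Ck_on l A f.
Proof.
elim: k l f => [|k IH] [|l] f //=; first by move=> _ [].
move=> lk [fc fd]; split=> // i; have [? ?] := fd i; split=> //.
exact: IH.
Qed.

(** Openness turns equality on [A] into equality near each point, which derivatives respect. *)
Lemma Ck_on_eq (R : realType) m (W : normedModType R) k (A : set 'rV[R]_m)
    (f g : 'rV[R]_m -> W) : open A -> {in A, f =1 g} ->
  Ck_on k A f -> Ck_on k A g.
Proof.
move=> oA; elim: k f g => [|k IH] f g fg.
  move=> [fc _]; split=> // x xA.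
  have nfg : \forall y \near x, f y = g y.
    near=> y; apply: fg; rewrite inE; near: y; apply: open_nbhs_nbhs; split => //.
    by rewrite inE in xA.
  rewrite /continuous_at -(fg x xA).
  exact: (cvg_trans (near_eq_cvg nfg) (fc x xA)).
move=> [fc fd].
have nfg x : A x -> \forall y \near x, f y = g y.
  move=> xA; near=> y; apply: fg; rewrite inE; near: y.
  exact: open_nbhs_nbhs.
split.
  move=> x xA; rewrite inE in xA.
  rewrite /continuous_at -(fg x) ?inE//.
  by apply: (cvg_trans (near_eq_cvg (nfg _ xA)) (fc x _)); rewrite inE.
move=> i; have [fd1 fd2] := fd i; split.
  by move=> u Au; apply: near_eq_derivable (fd1 u Au); exact: nfg.
apply: IH fd2 => u; rewrite inE => Au.
by apply: near_eq_derive; exact: nfg.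
Unshelve. all: by end_near. Qed.

Lemma C1_on_differentiable (R : realType) m p q (A : set 'rV[R]_m)
    (M : 'rV[R]_m -> 'M[R]_(p, q)) u :
  open A -> Ck_on 1 A M -> A u -> differentiable M u.
Proof.
move=> oA [Mc Md] Au; apply: differentiable_mx => i j.
have nA : \forall z \near u, A z by apply: open_nbhs_nbhs.
apply: C1_differentiable.
  apply: filterS nA => z Az k; have [/(_ _ Az)/derivable_mxP + _] := Md k.
  exact.
move=> k.
have [d [dc _]] := Md k.
have E : \forall z \near u, ('D_(delta_mx 0 k) M z) i j =
   'D_(delta_mx 0 k) (fun y => M y i j) z.
  by apply: filterS nA => z Az; rewrite derive_mx ?mxE//; exact: d.
have Au' : u \in A by rewrite inE.
have H : (fun z => ('D_(delta_mx 0 k) M z) i j) @ u -->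
    'D_(delta_mx 0 k) (fun y => M y i j) u.
  rewrite -(nbhs_singleton E).
  exact: (@continuous_comp _ _ _ ('D_(delta_mx 0 k) M)
    (fun N : 'M[R]_(p, q) => N i j) u (dc u Au')
    (@coord_continuous R p q i j _)).
exact: (cvg_trans (near_eq_cvg E) H).
Qed.

Lemma C2_on_derive_differentiable (R : realType) m p q (A : set 'rV[R]_m)
    (M : 'rV[R]_m -> 'M[R]_(p, q)) u i :
  open A -> Ck_on 2 A M -> A u -> differentiable ('D_(delta_mx 0 i) M) u.
Proof.
by move=> oA [_ /(_ i)[_ +]] Au => /C1_on_differentiable; apply.
Qed.

(** * Symmetry of second derivatives *)

Section schwarz.
Variables (R : realType) (m : nat) (f : 'rV[R]_m -> R) (u : 'rV[R]_m).
Hypothesis fd : \forall z \near u, forall i : 'I_m,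
  derivable f z (delta_mx 0 i).

(** The second difference is the increment in direction [j] of a first difference in direction [i].
    The derivative of the latter along [j] is a difference of two values of the partial derivative
    [j], which differentiability of this partial at [u] makes equal to [t] times the mixed
    derivative, up to [o(t)]. *)
Lemma derive2_second_difference (i j : 'I_m) e :
  differentiable ('D_(delta_mx 0 j) f) u -> 0 < e ->
  \forall t \near 0^'+,
    `|f (u + t *: delta_mx 0 i + t *: delta_mx 0 j) - f (u + t *: delta_mx 0 i)
      - f (u + t *: delta_mx 0 j) + f u
      - t ^+ 2 * 'D_(delta_mx 0 i) ('D_(delta_mx 0 j) f) u| <= e * t ^+ 2.
Proof.
set ei : 'rV[R]_m := delta_mx 0 i; set ej : 'rV[R]_m := delta_mx 0 j.
set phi := 'D_ej f; set a := 'D_ei phi u => dphi e0.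
(* The two displacements used below have norms at most [2 t] and [t], so the errors add up to [3 t]
   times [e / 3]. *)
have e'0 : 0 < e / 3 by rewrite divr_gt0.
have : \forall h \near (0 : 'rV[R]_m), `|phi (h + u) - (phi u + 'd phi u h)| <= e / 3 * `|h|.
  by have /eqaddoP/(_ _ e'0) := diff_locally dphi.
move=> /nbhs_ballP[r1 /= r10 B1].
have /nbhs_ballP[r2 /= r20 B2] := fd.
have nei (k : 'I_m) s : `|s *: (delta_mx 0 k : 'rV[R]_m)| <= `|s|.
  apply: mx_norm_leP => // i' j'; rewrite !mxE normrM ler_piMr//.
  by case: (_ && _); rewrite ?normr1 ?normr0.
near=> t.
have t0 : 0 < t by near: t; exact: nbhs_right_gt.
have tr1 : t + t < r1.
  rewrite -mulr2n -mulr_natr -ltr_pdivlMr//; near: t; apply: nbhs_right_lt.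
  by rewrite divr_gt0.
have tr2 : t + t < r2.
  rewrite -mulr2n -mulr_natr -ltr_pdivlMr//; near: t; apply: nbhs_right_lt.
  by rewrite divr_gt0.
(* The term linear in [s] is subtracted so that the claim becomes a bound on [g t - g 0]. *)
pose g s := f (u + t *: ei + s *: ej) - f (u + s *: ej) - t * a * s.
have -> : f (u + t *: ei + t *: ej) - f (u + t *: ei) - f (u + t *: ej) + f u - t ^+ 2 * a
    = g t - g 0.
  rewrite /g !scale0r !addr0 mulr0 subr0 expr2.
  move: (f _) (f _) (f _) (f _) => f1 f2 f3 f4; clear g; move: a => b; ring.
apply: (@le_trans _ _ (e * t * `|t - 0|)); last first.
  by rewrite subr0 gtr0_norm// expr2 mulrA.
apply: (@mean_value_le _ g
  (fun s => phi (u + t *: ei + s *: ej) - phi (u + s *: ej) - t * a)) => s.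
  rewrite (min_idPl (ltW t0)) (max_idPr (ltW t0)) => /andP[s0 st].
  apply: is_deriveB; last exact: is_derive_mull.
  have ns : `|s *: ej| <= t by rewrite (le_trans (nei j s))// ger0_norm.
  apply: is_deriveB; apply: derivable_affine_line; apply: B2;
     rewrite -ball_normE/=.
    rewrite -addrA opprD addrA subrr add0r normrN.
    apply: le_lt_trans tr2; rewrite (le_trans (ler_normD _ _))// lerD//.
    by rewrite (le_trans (nei i t))// ger0_norm// ltW.
  by rewrite opprD addrA subrr add0r normrN (le_lt_trans ns)// (lt_trans _ tr2)// ltrDl.
rewrite (min_idPl (ltW t0)) (max_idPr (ltW t0)) => /andP[s0 st].
have ns : `|s *: ej| <= t by rewrite (le_trans (nei j s))// ger0_norm.
have nt : `|t *: ei| <= t by rewrite (le_trans (nei i t))// ger0_norm// ltW.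
have nts : `|t *: ei + s *: ej| <= t + t.
  by rewrite (le_trans (ler_normD _ _))// lerD.
have E1 := B1 (t *: ei + s *: ej) _.
have E2 := B1 (s *: ej) _.
have {}E1 : `|phi (t *: ei + s *: ej + u) - (phi u + 'd phi u (t *: ei + s *: ej))| <= e / 3 * (t + t).
  apply: le_trans (E1 _) _; last by rewrite ler_wpM2l// ltW.
  by rewrite -ball_normE/= sub0r normrN (le_lt_trans nts).
have {}E2 : `|phi (s *: ej + u) - (phi u + 'd phi u (s *: ej))| <= e / 3 * t.
  apply: le_trans (E2 _) _; last by rewrite ler_wpM2l// ltW.
  by rewrite -ball_normE/= sub0r normrN (le_lt_trans ns)// (lt_trans _ tr1)// ltrDl.
have da : 'd phi u (t *: ei + s *: ej) = t * a + 'd phi u (s *: ej).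
  by rewrite linearD/= linearZ/= -deriveE.
rewrite da in E1.
rewrite -[u + _ + _]addrA [u + (_ + _)]addrC [u + s *: ej]addrC.
have -> : e * t = e / 3 * (t + t) + e / 3 * t by field.
apply: le_trans (lerD E1 E2).
apply: le_trans (ler_normB _ _); rewrite le_eqVlt; apply/orP; left; apply/eqP.
congr (`| _ |).
move: (phi _) (phi _) (phi _) ('d phi u _) => p1 p2 p3 p4.
ring.
Unshelve. all: by end_near. Qed.

(** The second difference is symmetric in [i] and [j], so both mixed derivatives are limits of the
    same quotient. *)
Lemma derive_schwarz (i j : 'I_m) :
  differentiable ('D_(delta_mx 0 i) f) u ->
  differentiable ('D_(delta_mx 0 j) f) u ->
  'D_(delta_mx 0 i) ('D_(delta_mx 0 j) f) u =
  'D_(delta_mx 0 j) ('D_(delta_mx 0 i) f) u.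
Proof.
move=> di dj.
have F1 := fun e => derive2_second_difference (e := e) i dj.
have F2 := fun e => derive2_second_difference (e := e) j di.
move: F1 F2; move: ('D__ _ u) ('D__ _ u) => a b F1 F2.
apply/eqP; rewrite -subr_eq0 -normr_le0; apply/ler_addgt0Pr => e e0; rewrite add0r.
have e20 : 0 < e / 2 by rewrite divr_gt0.
have [t [[E1 E2] t0]] :=
  filter_ex (filterI (filterI (F1 _ e20) (F2 _ e20)) (nbhs_right_gt 0)).
have t20 : 0 < t ^+ 2 by rewrite exprn_gt0.
rewrite -(ler_pM2r t20) -[X in _ * X <= _](gtr0_norm t20) -normrM.
have -> : e * t ^+ 2 = e / 2 * t ^+ 2 + e / 2 * t ^+ 2 by field.
apply: le_trans (lerD E1 E2); rewrite [leRHS]addrC.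
apply: le_trans (ler_normB _ _); rewrite le_eqVlt; apply/orP; left; apply/eqP.
congr (`| _ |).
rewrite (addrAC u (t *: delta_mx 0 j)).
move: a b E1 E2 F1 F2 (f _) (f _) (f _) (f _) => a b _ _ _ _ f1 f2 f3 f4; ring.
Qed.

End schwarz.

(** * The geodesic equation in Euler-Lagrange form *)

(* The Euler-Lagrange covector of the energy [qform G v / 2] at velocity [v] and
   acceleration [a], where [dG l] is the l-th partial derivative of [G].  It
   changes by the transposed Jacobian under a change of charts, which avoids
   the transformation law of Christoffel symbols. *)
Definition EL_form (R : realType) m (G : 'M[R]_m) (dG : 'I_m -> 'M[R]_m)
    (v a : 'rV[R]_m) : 'rV[R]_m :=
  a *m G + \sum_i v 0 i *: (v *m dG i) - 2^-1 *: \row_l qform (dG l) v.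

Lemma qformE (R : realType) m (G : 'M[R]_m) (v : 'rV[R]_m) :
  qform G v = \sum_i \sum_j G i j * v 0 i * v 0 j.
Proof.
rewrite /qform mxE exchange_big/=; apply: eq_bigr => j _.
rewrite !mxE mulr_suml; apply: eq_bigr => i _.
by rewrite [v 0 i * _]mulrC.
Qed.

(** The Euler-Lagrange covector is the left-hand side of the geodesic equation with its index
    lowered by [G], and [G] is invertible. *)
Lemma christoffel_EL (R : realType) m (G : 'rV[R]_m -> 'M[R]_m)
    (u v a : 'rV[R]_m) : G u \in unitmx -> (G u)^T = G u ->
  (forall k, a 0 k + \sum_i \sum_j christoffel G u k i j * v 0 i * v 0 j = 0)
  <-> EL_form (G u) (fun l => 'D_(delta_mx 0 l) G u) v a = 0.
Proof.
move=> Gu Gsym; rewrite /EL_form -addrA.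
set c : 'rV[R]_m := \sum_i _ - _.
have E k : \sum_i \sum_j christoffel G u k i j * v 0 i * v 0 j =
    (c *m invmx (G u)) 0 k.
  have invsym l : invmx (G u) l k = invmx (G u) k l.
    by rewrite -[in LHS]Gsym -trmx_inv mxE.
  rewrite mxE.
  have -> : \sum_i \sum_j christoffel G u k i j * v 0 i * v 0 j =
     \sum_l invmx (G u) k l * (2^-1 * \sum_i \sum_j
       ('D_(delta_mx 0 i) G u j l + 'D_(delta_mx 0 j) G u i l
        - 'D_(delta_mx 0 l) G u i j) * v 0 i * v 0 j).
    rewrite /christoffel.
    under eq_bigr => i _ do under eq_bigr => j _ do rewrite mulr_sumr !mulr_suml.
    under [RHS]eq_bigr => l _ do rewrite mulrCA mulr_sumr mulr_sumr.
    rewrite [RHS]exchange_big/=; apply: eq_bigr => i _.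
    under [RHS]eq_bigr => l _ do rewrite mulr_sumr mulr_sumr.
    rewrite [RHS]exchange_big/=; apply: eq_bigr => j _.
    by apply: eq_bigr => l _; rewrite !mulrA.
  apply: eq_bigr => l _; rewrite invsym mulrC; congr (_ * _).
  rewrite /c !mxE qformE summxE.
  under [X in _ = X - _]eq_bigr => i _ do rewrite !mxE mulr_sumr.
  (* Summed against the symmetric product [v_i v_j], the first two terms of the Christoffel symbol
     agree; this gives the factor 2. *)
  have -> : \sum_i \sum_j ('D_(delta_mx 0 i) G u j l + 'D_(delta_mx 0 j) G u i l
        - 'D_(delta_mx 0 l) G u i j) * v 0 i * v 0 j =
     2 * (\sum_i \sum_j v 0 i * (v 0 j * 'D_(delta_mx 0 i) G u j l)) -
     \sum_i \sum_j 'D_(delta_mx 0 l) G u i j * v 0 i * v 0 j.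
    rewrite mulr_natl mulr2n [X in _ = _ + X - _]exchange_big/=.
    rewrite -big_split -sumrB/=; apply: eq_bigr => i _.
    rewrite -big_split -sumrB/=; apply: eq_bigr => j _.
    ring.
  by rewrite mulrBr mulKf.
split=> [H|/eqP].
  have -> : a = - (c *m invmx (G u)).
    by apply/rowP => k; rewrite mxE -E; apply/eqP; rewrite -addr_eq0 H.
  by rewrite mulNmx -mulmxA mulVmx// mulmx1 addNr.
rewrite addr_eq0 => /eqP aG k; rewrite E.
have -> : a = - (c *m invmx (G u)) by rewrite -mulNmx -aG mulmxK.
by rewrite mxE addNr.
Qed.

(* [H l] is the l-th partial derivative of the Jacobian [J]. *)
Lemma EL_form_transition (R : realType) m (G G' J : 'M[R]_m)
    (dG dG' H : 'I_m -> 'M[R]_m) (v a : 'rV[R]_m) :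
  G = J *m G' *m J^T -> G'^T = G' ->
  (forall l, dG l = (H l *m G' + J *m (\sum_k J l k *: dG' k)) *m J^T
                    + J *m G' *m (H l)^T) ->
  (forall l i k, H l i k = H i l k) ->
  EL_form G dG v a =
  EL_form G' dG' (v *m J) (a *m J + v *m \sum_i v 0 i *: H i) *m J^T.
Proof.
move=> GE G'sym dGE Hsym; set w := v *m J.
set K := \sum_i v 0 i *: H i.
pose S := \sum_k w 0 k *: dG' k.
pose Q : 'rV[R]_m := \row_l qform (dG' l) w.
have sumS : \sum_i v 0 i *: (\sum_k J i k *: dG' k) = S.
  under eq_bigr => i _ do rewrite scaler_sumr.
  rewrite exchange_big/=; apply: eq_bigr => k _.
  by rewrite mxE scaler_suml; apply: eq_bigr => i _; rewrite scalerA.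
have sumdG : \sum_i v 0 i *: (v *m dG i) =
    v *m K *m G' *m J^T + w *m S *m J^T + w *m G' *m K^T.
  transitivity (v *m \sum_i v 0 i *: dG i).
    by rewrite mulmx_sumr; apply: eq_bigr => i _; rewrite scalemxAr.
  have -> : \sum_i v 0 i *: dG i = K *m G' *m J^T + J *m S *m J^T + J *m G' *m K^T.
    have -> : K^T = \sum_i v 0 i *: (H i)^T.
      by rewrite /K raddf_sum; apply: eq_bigr => i _; apply/matrixP => j k; rewrite !mxE.
    rewrite -sumS /K !mulmx_sumr !mulmx_suml -!big_split/=.
    apply: eq_bigr => i _.
    rewrite dGE mulmxDl !scalerDr; congr (_ + _ + _).
      by rewrite -!scalemxAl.
    by rewrite -scalemxAr -scalemxAl.
    by rewrite -scalemxAr.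
  by rewrite !mulmxDr !mulmxA.
(* [K] is the derivative of the Jacobian along [v]. The symmetry [Hsym] of second derivatives enters
   here only. *)
have vH l : v *m H l = row l K.
  apply/rowP => k; rewrite !mxE summxE; apply: eq_bigr => i _.
  by rewrite !mxE Hsym.
(* The two terms containing the derivative of [J] are transposes of each other, hence equal scalars.
   Halved in [EL_form], they cancel the last term of [sumdG]. *)
have rowE : \row_l qform (dG l) v = 2 *: (w *m G' *m K^T) + Q *m J^T.
  apply/rowP => l; rewrite mxE /qform dGE.
  have -> : v *m ((H l *m G' + J *m (\sum_k J l k *: dG' k)) *m J^T + J *m G' *m (H l)^T) *m v^T
    = row l K *m G' *m w^T + w *m (\sum_k J l k *: dG' k) *m w^T + w *m G' *m (row l K)^T.
    rewrite mulmxDr mulmxDl -vH /w !trmx_mul !mulmxA; congr (_ + _).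
    by rewrite !mulmxDr !mulmxDl !mulmxA.
  have tr11 (B : 'M[R]_1) : B 0 0 = B^T 0 0 by rewrite mxE.
  have -> : (row l K *m G' *m w^T) = (w *m G' *m (row l K)^T)^T.
    by rewrite !trmx_mul trmxK G'sym mulmxA.
  have wl : (w *m G' *m (row l K)^T) 0 0 = (w *m G' *m K^T) 0 l.
    by rewrite !mxE; apply: eq_bigr => k _; rewrite !mxE.
  have wQ : (w *m (\sum_k J l k *: dG' k) *m w^T) 0 0 = (Q *m J^T) 0 l.
    rewrite mulmx_sumr mulmx_suml summxE [RHS]mxE; apply: eq_bigr => k _.
    by rewrite -scalemxAr -scalemxAl [LHS]mxE [in RHS]mxE [J^T _ _]mxE /qform mulrC.
  rewrite [LHS]mxE [X in X + _]mxE wQ [X in X + _ + _]mxE wl.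
  by rewrite [RHS]mxE [in RHS]mxE; ring.
rewrite /EL_form sumdG rowE GE.
have -> : \sum_k w 0 k *: (w *m dG' k) = w *m S.
  by rewrite mulmx_sumr; apply: eq_bigr => i _; rewrite scalemxAr.
rewrite -/Q scalerDr scalerA mulVf// scale1r.
rewrite mulmxBl !mulmxDl -scalemxAl !mulmxA.
set A1 := a *m J *m G' *m J^T; set A2 := v *m K *m G' *m J^T.
set A3 := w *m S *m J^T; set A4 := w *m G' *m K^T; set A5 := _ *: _.
by rewrite opprD !addrA addrK.
Qed.

Lemma Ck_on_entry (R : realType) m p q k (A : set 'rV[R]_m)
    (M : 'rV[R]_m -> 'M[R]_(p, q)) i j :
  open A -> Ck_on k A M -> Ck_on k A (fun u => M u i j).
Proof.
move=> oA; elim: k M => [|k IH] M [Mc Md].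
  split=> // x xA; exact: (@continuous_comp _ _ _ M
    (fun N : 'M[R]_(p, q) => N i j) x (Mc x xA) (@coord_continuous R p q i j _)).
split.
  move=> x xA; exact: (@continuous_comp _ _ _ M
    (fun N : 'M[R]_(p, q) => N i j) x (Mc x xA) (@coord_continuous R p q i j _)).
move=> l; have [d1 d2] := Md l; split.
  by move=> u Au; move/derivable_mxP : (d1 u Au); apply.
apply: Ck_on_eq (IH _ d2) => // u; rewrite inE => Au.
by rewrite derive_mx ?mxE//; exact: d1.
Qed.

Lemma C1_on_differentiable_real (R : realType) m (A : set 'rV[R]_m)
    (f : 'rV[R]_m -> R) u :
  open A -> Ck_on 1 A f -> A u -> differentiable f u.
Proof.
move=> oA [fc fd] Au; apply: C1_differentiable.
  have nA : \forall z \near u, A z by apply: open_nbhs_nbhs.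
  by apply: filterS nA => z Az k; have [+ _] := fd k; apply.
by move=> i; have [_ [+ _]] := fd i; apply; rewrite inE.
Qed.

(** * Curves under a change of charts *)

Section transition.
Variables (R : realType) (m : nat) (A : set 'rV[R]_m) (phi : 'rV[R]_m -> 'rV[R]_m).
Hypotheses (oA : open A) (phiA : Ck_on 2 A phi).

Lemma differentiable_transition x : A x -> differentiable phi x.
Proof. exact: C1_on_differentiable (Ck_on_le (leqnSn 1) phiA). Qed.

(** Written with partial derivatives instead of the differential, so that its entries can be
    differentiated again; the two agree on [A] by [jacobianE]. *)
Definition jac (u : 'rV[R]_m) : 'M[R]_m :=
  \matrix_(i, j) ('D_(delta_mx 0 i) phi u) 0 j.

Lemma jacobianE u : A u -> jacobian phi u = jac u.
Proof.
move=> Au; apply/row_matrixP => i; rewrite rowE -deriveEjacobian.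
  by apply/rowP => j; rewrite !mxE.
exact: differentiable_transition.
Qed.

Lemma mulmx_jac (v : 'rV[R]_m) u :
  v *m jac u = \sum_i v 0 i *: 'D_(delta_mx 0 i) phi u.
Proof.
by apply/rowP => j; rewrite mxE summxE; apply: eq_bigr => i _; rewrite !mxE.
Qed.

Lemma differentiable_jac u : A u -> differentiable jac u.
Proof.
move=> Au; apply: differentiable_mx => i j.
have -> : (fun y => jac y i j) =
    (fun N : 'rV[R]_m => N 0 j) \o 'D_(delta_mx 0 i) phi.
  by apply/funext => y; rewrite /= mxE.
apply: differentiable_comp; last exact: differentiable_coord.
exact: C2_on_derive_differentiable phiA Au.
Qed.

(** Symmetry of second derivatives for each component of [phi]; it provides the hypothesis [Hsym] of
    [EL_form_transition]. *)
Lemma derive_jac_sym u l i k : A u ->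
  ('D_(delta_mx 0 l) jac u) i k = ('D_(delta_mx 0 i) jac u) l k.
Proof.
move=> Au.
have fA : Ck_on 2 A (fun y => phi y 0 k) by exact: Ck_on_entry.
have nA : \forall z \near u, A z by apply: open_nbhs_nbhs.
have E l' i' : ('D_(delta_mx 0 l') jac u) i' k =
   'D_(delta_mx 0 l') ('D_(delta_mx 0 i') (fun y => phi y 0 k)) u.
  rewrite derive_mx; last exact/diff_derivable/differentiable_jac.
  rewrite mxE; apply: near_eq_derive; apply: filterS nA => z Az.
  rewrite mxE derive_mx ?mxE//.
  by have [_ /(_ i')[+ _]] := phiA; apply.
apply: etrans (E l i) _; apply: etrans _ (esym (E i l)).
apply: (@derive_schwarz R m (fun y => phi y 0 k) u _ l i).
- apply: filterS nA => z Az j.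
  by have [_ /(_ j)[+ _]] := fA; apply.
- by have [_ /(_ l)[_ +]] := fA => /C1_on_differentiable_real; apply.
- by have [_ /(_ i)[_ +]] := fA => /C1_on_differentiable_real; apply.
Qed.

Variables (G G' : 'rV[R]_m -> 'M[R]_m).
Hypothesis GE : forall u, A u -> G u = jac u *m G' (phi u) *m (jac u)^T.

Lemma derive_metric_transition u l : A u -> differentiable G' (phi u) ->
  'D_(delta_mx 0 l) G u =
   ('D_(delta_mx 0 l) jac u *m G' (phi u)
    + jac u *m (\sum_k jac u l k *: 'D_(delta_mx 0 k) G' (phi u))) *m (jac u)^T
   + jac u *m G' (phi u) *m ('D_(delta_mx 0 l) jac u)^T.
Proof.
move=> Au dG'.
have nA : \forall z \near u, A z by apply: open_nbhs_nbhs.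
have -> : 'D_(delta_mx 0 l) G u =
  'D_(delta_mx 0 l) (fun y => jac y *m G' (phi y) *m (jac y)^T) u.
  by apply: near_eq_derive; apply: filterS nA => z Az; rewrite GE.
have dphi := differentiable_transition Au.
have dJ := derivableP (diff_derivable (v := delta_mx 0 l) (differentiable_jac Au)).
have dG := is_derive_comp_rV (derivableP (diff_derivable (v := delta_mx 0 l) dphi)) dphi dG'.
have := is_derive_mulmx (is_derive_mulmx dJ dG) (is_derive_trmx dJ).
move=> [_ ->]; congr (( _ + _ *m _) *m _ + _).
by apply: eq_bigr => k _; rewrite mxE.
Qed.

Variables (u : R -> 'rV[R]_m) (t : R).
Hypotheses (uA : A (u t)) (du : \forall s \near t, derivable u s 1)
  (ddu : derivable (derive1 u) t 1).

(** Needed near [t] and not only at [t], because the velocity is differentiated once more. *)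
Lemma derive1_transition : \forall s \near t,
  is_derive (s : R) 1 (phi \o u) (derive1 u s *m jac (u s)).
Proof.
have cu : {for t, continuous u}.
  exact/differentiable_continuous/derivable1_diffP/(nbhs_singleton du).
have nA : \forall s \near t, A (u s).
  by apply: cu; apply: open_nbhs_nbhs.
apply: filterS2 nA du => s As ds; rewrite mulmx_jac.
apply: is_derive_curve; first by rewrite derive1E; exact: derivableP.
exact: differentiable_transition.
Qed.

Lemma derive2_transition :
  is_derive t 1 (derive1 (phi \o u))
    (derive1 (derive1 u) t *m jac (u t) + derive1 u t *m
      \sum_i derive1 u t 0 i *: 'D_(delta_mx 0 i) jac (u t)).
Proof.
have E : \forall s \near t, derive1 u s *m jac (u s) = derive1 (phi \o u) s.
  by apply: filterS derive1_transition => s [_ e]; rewrite [RHS]derive1E e.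
apply: near_eq_is_derive E _.
apply: is_derive_mulmx; first by rewrite derive1E; exact: derivableP.
apply: is_derive_curve; last exact: differentiable_jac.
by rewrite derive1E; apply: derivableP; exact: nbhs_singleton du.
Qed.

Lemma EL_form_transition_curve :
  differentiable G' (phi (u t)) -> (G' (phi (u t)))^T = G' (phi (u t)) ->
  [/\ derivable (phi \o u) t 1, derivable (derive1 (phi \o u)) t 1
   & EL_form (G (u t)) (fun l => 'D_(delta_mx 0 l) G (u t))
       (derive1 u t) (derive1 (derive1 u) t) =
     EL_form (G' (phi (u t))) (fun l => 'D_(delta_mx 0 l) G' (phi (u t)))
       (derive1 (phi \o u) t) (derive1 (derive1 (phi \o u)) t)
     *m (jac (u t))^T].
Proof.
move=> dG' G'sym.
have [d1 e1] := nbhs_singleton derive1_transition.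
have [d2 e2] := derive2_transition.
split; [exact: d1|exact: d2|].
have E1 := esym (etrans (derive1E _ _) e1).
have E2 := esym (etrans (derive1E _ _) e2).
apply: etrans _ (congr2 (fun v a => EL_form (G' (phi (u t)))
  (fun l => 'D_(delta_mx 0 l) G' (phi (u t))) v a *m (jac (u t))^T) E1 E2).
apply: EL_form_transition => //; first exact: GE.
  by move=> l; exact: derive_metric_transition.
by move=> l i k; exact: derive_jac_sym.
Qed.

End transition.

(** * Ordinary differential equations *)

Lemma derive_ge0_le (R : realType) (f df : R -> R) (a b : R) : a <= b ->
  (forall x, a <= x <= b -> is_derive x 1 f (df x)) ->
  (forall x, a <= x <= b -> 0 <= df x) -> f a <= f b.
Proof.
move=> ab fd dC.
have [||c cab E] := @MVT_segment R f df a b ab.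
- by move=> x xab; apply: fd; move: xab; rewrite in_itv/= => /andP[/ltW -> /ltW ->].
- apply: derivable_within_continuous => x xab.
  by have [] := fd x _; move: xab; rewrite in_itv.
- by rewrite -subr_ge0 E mulr_ge0 ?subr_ge0// dC//; move: cab; rewrite in_itv.
Qed.

Lemma lipschitz_continuous (R : realType) (V W : normedModType R) (f : V -> W)
    (L : R) : (forall x y, `|f x - f y| <= L * `|x - y|) -> continuous f.
Proof.
move=> fL x; apply/cvgrPdist_lt => e e0; near=> y.
apply: le_lt_trans (fL _ _) _.
apply: (@le_lt_trans _ _ ((`|L| + 1) * `|x - y|)).
  by rewrite ler_wpM2r// (le_trans (ler_norm _))// lerDl.
rewrite mulrC -ltr_pdivlMr; last by rewrite ltr_wpDl.
near: y; apply: (@cvgr_dist_lt _ _ _ _ _ id) => //.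
by rewrite divr_gt0// ltr_wpDl.
Unshelve. all: by end_near. Qed.

Lemma continuous_primitive (R : realType) (g : R -> R) (a b : R) :
  continuous g -> a < b ->
  exists G : R -> R, forall t, a < t < b -> is_derive t 1 G (g t).
Proof.
move=> cg ab.
exists (fun x => \int[lebesgue_measure]_(t in [set` `[a, x]]) g t)%R.
move=> t /andP[at_ tb].
have [d e] : derivable (fun x : R => \int[lebesgue_measure]_(t in [set` `[a, x]]) g t) t 1
    /\ derive1 (fun x : R => \int[lebesgue_measure]_(t in [set` `[a, x]]) g t) t = g t.
  apply: (@continuous_FTC1_closed R g a t b) => //; last exact: cg.
  apply: continuous_compact_integrable; first exact: segment_compact.
  exact: continuous_subspaceT.
exact: DeriveDef d (etrans (esym (derive1E _ _)) e).
Qed.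

Lemma mean_value_rV (R : realType) k (G dG : R -> 'rV[R]_k) (C a b : R) :
  (forall x, Num.min a b <= x <= Num.max a b -> is_derive x 1 G (dG x)) ->
  (forall x, Num.min a b <= x <= Num.max a b -> `|dG x| <= C) ->
  `|G b - G a| <= C * `|b - a|.
Proof.
move=> Gd dC.
have C0 : 0 <= C.
  by apply: le_trans (dC a _); rewrite // ge_min lexx le_max lexx.
apply: mx_norm_leP => [|i j]; first by rewrite mulr_ge0.
rewrite !mxE; apply: (@mean_value_le R (fun x => G x i j) (fun x => dG x i j)).
  by move=> x xab; have /is_derive_mxP := Gd x xab; apply.
by move=> x xab; apply: le_trans (dC x xab); exact: ler_entry_norm.
Qed.

Lemma geometric_limit (R : realType) (u : R^nat) (C : R) :
  (forall n, `|u n.+1 - u n| <= C * 2^-1 ^+ n) ->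
  exists l, forall n, `|l - u n| <= C * 2 * 2^-1 ^+ n.
Proof.
move=> uC.
(* Keeping the subtracted term [2^-(n+m)] makes the induction on [m] close. *)
have uS m n : `|u (n + m)%N - u n| <= C * 2 * (2^-1 ^+ n - 2^-1 ^+ (n + m)).
  elim: m => [|m IH]; first by rewrite addn0 !subrr mulr0 normr0.
  rewrite addnS -(subrKA (u (n + m)%N)) (le_trans (ler_normD _ _))//.
  have := lerD (uC (n + m)%N) IH; move/le_trans; apply.
  rewrite exprS; move: (_ ^+ n) (_ ^+ (n + m)) => a b; lra.
have C0 : 0 <= C by have := uC 0%N; rewrite expr0 mulr1; apply: le_trans.
have uSb m n : `|u (n + m)%N - u n| <= C * 2 * 2^-1 ^+ n.
  apply: le_trans (uS m n) _; rewrite ler_wpM2l ?mulr_ge0//.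
  by rewrite gerBl exprn_ge0.
have ucvg : cvgn u.
  have -> : u = fun n => u 0%N + series (fun n => u n.+1 - u n) n.
    by apply/funext => n; rewrite /series /= telescope_sumr// subrKC.
  apply: is_cvgD; first exact: is_cvg_cst.
  apply: normed_cvg; apply: (@series_le_cvg _ _ (geometric C 2^-1)).
  - by move=> n /=.
  - by move=> n; rewrite mulr_ge0// exprn_ge0.
  - exact: uC.
  - by apply: is_cvg_geometric_series; rewrite ger0_norm// invf_lt1// ltr1n.
exists (limn u) => n.
apply/ler_addgt0Pr => e e0.
near \oo => N.
have nN : (n <= N)%N by near: N; exact: nbhs_infty_ge.
have -> : limn u - u n = (limn u - u N) + (u N - u n) by rewrite subrKA.
rewrite (le_trans (ler_normD _ _))// addrC lerD//.
  by rewrite -(subnKC nN) uSb.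
by near: N; exact: (@cvgr_dist_le _ _ _ _ _ u (limn u) ucvg e e0).
Unshelve. all: by end_near. Qed.

Lemma geometric_limit_rV (R : realType) k (u : nat -> 'rV[R]_k) (C : R) :
  0 <= C -> (forall n, `|u n.+1 - u n| <= C * 2^-1 ^+ n) ->
  exists l, forall n, `|l - u n| <= C * 2 * 2^-1 ^+ n.
Proof.
move=> C0 uC.
have /choice[l Hl] : forall i : 'I_k, exists l : R, forall n,
    `|l - u n 0 i| <= C * 2 * 2^-1 ^+ n.
  move=> i; apply: geometric_limit => n; apply: le_trans (uC n).
  by have := ler_entry_norm (u n.+1 - u n) 0 i; rewrite !mxE.
exists (\row_i l i) => n; apply: mx_norm_leP => [|i j].
  by rewrite !mulr_ge0// exprn_ge0.
by rewrite ord1 !mxE.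
Qed.

(** For [r >= 0], the retraction of the line onto [[c - r, c + r]]. Precomposing with this
    1-Lipschitz map extends a function from a box to the whole space with the same bounds. *)
Definition clamp (R : realType) (c r t : R) := Num.max (c - r) (Num.min t (c + r)).

Lemma clamp_le (R : realType) (c r t : R) : 0 <= r -> `|clamp c r t - c| <= r.
Proof.
move=> r0; rewrite ler_norml /clamp.
case: (leP t (c + r)) => ?; case: (leP (c - r)) => ?; apply/andP; split; lra.
Qed.

Lemma clamp_id (R : realType) (c r t : R) : `|t - c| <= r -> clamp c r t = t.
Proof.
rewrite ler_norml /clamp => /andP[? ?].
case: (leP t (c + r)) => ?; case: (leP (c - r)) => ?; lra.
Qed.

Lemma clamp_lip (R : realType) (c r s t : R) : 0 <= r ->
  `|clamp c r s - clamp c r t| <= `|s - t|.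
Proof.
move=> r0; have H1 := ler_norm (s - t); have H2 := ler_norm (t - s).
rewrite distrC in H2; rewrite ler_norml /clamp.
by case: (leP s (c + r)) => ?; case: (leP t (c + r)) => ?;
  do ?[case: (leP (c - r)) => ?]; apply/andP; split; lra.
Qed.

(** * Existence by Picard iteration *)

Section picard.
Variables (R : realType) (k : nat) (F : 'rV[R]_k -> 'rV[R]_k) (L M T : R).
Hypotheses (FL : forall x y, `|F x - F y| <= L * `|x - y|)
  (FM : forall x, `|F x| <= M) (L0 : 0 <= L) (T0 : 0 < T) (LT : L * T <= 2^-1).
Variable x0 : 'rV[R]_k.

Let clampT := clamp 0 T.

Let clampT_le t : `|clampT t| <= T.
Proof. by rewrite -[clampT t]subr0 clamp_le// ltW. Qed.

Let clampT_id t : `|t| <= T -> clampT t = t.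
Proof. by move=> tT; rewrite /clampT clamp_id ?subr0. Qed.

Let clampT_lip s t : `|clampT s - clampT t| <= `|s - t|.
Proof. exact/clamp_lip/ltW. Qed.

(* Times are clamped to [[-T, T]], so that the iterates are defined, bounded and
   Lipschitz on the whole line although [F o x] is only integrated there. *)
Definition picard_step (x y : R -> 'rV[R]_k) := exists G : R -> 'rV[R]_k,
  (forall t : R, `|t| <= T -> is_derive t 1 G (F (x t))) /\
  forall t, y t = x0 + (G (clampT t) - G 0).

Lemma picard_step_exists x : continuous x -> exists y, picard_step x y.
Proof.
move=> cx.
have cFx : continuous (F \o x).
  by move=> t; apply: continuous_comp; [exact: cx|exact: (lipschitz_continuous FL)].
(* The primitive is taken on a larger open interval, to be differentiable at [T] and [- T] as
   well. *)
have Hi (i : 'I_k) : exists G : R -> R,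
    forall t, - (T + 1) < t < T + 1 -> is_derive t 1 G (F (x t) 0 i).
  apply: (@continuous_primitive R (fun t => F (x t) 0 i)); last first.
    have T1 : 0 < T + 1 by rewrite addr_gt0.
    by rewrite (@lt_trans _ _ 0)// oppr_lt0.
  move=> t; exact: (@continuous_comp _ _ _ (F \o x) (fun N : 'rV[R]_k => N 0 i) t
    (cFx t) (@coord_continuous R 1 k 0 i _)).
have [G HG] := choice Hi.
pose G' t : 'rV[R]_k := \row_i G i t.
exists (fun t => x0 + (G' (clampT t) - G' 0)), G'; split => // t tT.
apply/is_derive_mxP => i j; rewrite ord1.
have -> : (fun y => G' y 0 j) = G j by apply/funext => s; rewrite mxE.
apply: HG; rewrite -ltr_norml; by rewrite (le_lt_trans tT)// ltrDl.
Qed.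

Let between0 s t : `|t| <= T -> Num.min 0 t <= s <= Num.max 0 t -> `|s| <= T.
Proof.
rewrite !ler_norml; case: (leP 0 t) => ? /andP[? ?] /andP[? ?];
  apply/andP; split; lra.
Qed.

Let between s t r : `|t| <= T -> `|s| <= T -> Num.min s t <= r <= Num.max s t -> `|r| <= T.
Proof.
rewrite !ler_norml; case: (leP s t) => ? /andP[? ?] /andP[? ?] /andP[? ?];
  apply/andP; split; lra.
Qed.

Lemma picard_step_lip x y s t : picard_step x y ->
  `|y t - y s| <= M * `|t - s|.
Proof.
move=> [G [dG yE]]; rewrite !yE [x0 + _]addrC addrKA.
have -> : G (clampT t) - G 0 - (G (clampT s) - G 0) = G (clampT t) - G (clampT s).
  by rewrite opprB addrA subrK.
have M0 : 0 <= M by apply: le_trans (FM x0).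
apply: (@le_trans _ _ (M * `|clampT t - clampT s|)); last by rewrite ler_wpM2l.
apply: (@mean_value_rV _ _ _ (fun t => F (x t))) => // r rst.
by apply: dG; apply: between rst.
Qed.

(** The derivatives of the two primitives differ by at most [L * d] over a time at most [T], and
    [L * T <= 1/2]. *)
Lemma picard_step_contract x x' y y' d : picard_step x y -> picard_step x' y' ->
  (forall t, `|x t - x' t| <= d) -> forall t, `|y t - y' t| <= d / 2.
Proof.
move=> [G [dG yE]] [G' [dG' yE']] xd t; rewrite yE yE' [x0 + _]addrC addrKA.
have d0 : 0 <= d by apply: le_trans (xd 0).
have -> : G (clampT t) - G 0 - (G' (clampT t) - G' 0) =
    (G (clampT t) - G' (clampT t)) - (G 0 - G' 0).
  by rewrite !opprB [G' 0 - _]addrC addrACA [- G 0 + _]addrC.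
apply: (@le_trans _ _ (L * d * `|clampT t - 0|)).
  apply: (@mean_value_rV _ _ (fun t => G t - G' t) (fun t => F (x t) - F (x' t))) => r r0t.
    by apply: is_deriveB; [apply: dG|apply: dG']; apply: between0 r0t.
  by apply: le_trans (FL _ _) _; rewrite ler_wpM2l.
rewrite subr0 [L * d]mulrC -mulrA ler_wpM2l//.
by apply: le_trans LT; rewrite ler_wpM2l.
Qed.

Lemma picard_solution : exists x : R -> 'rV[R]_k,
  x 0 = x0 /\ forall t : R, `|t| < T -> is_derive t 1 x (F (x t)).
Proof.
(* A step exists only for continuous [x]; at other arguments [S] takes a dummy value. *)
have /choice[S HS] : forall x : R -> 'rV[R]_k, exists y : R -> 'rV[R]_k,
    continuous x -> picard_step x y.
  move=> x.
  have [cx|ncx] := pselect (continuous x); last by exists x.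
  by have [y xy] := picard_step_exists cx; exists y.
pose u n := iter n S (fun=> x0).
have M0 : 0 <= M by apply: le_trans (FM x0).
have cu n : continuous (u n).
  elim: n => [|n IH]; first by move=> t; exact: cvg_cst.
  by apply: (@lipschitz_continuous _ _ _ _ M) => s t; exact: picard_step_lip (HS _ IH).
have uS n : picard_step (u n) (u n.+1) by exact: HS.
have u1 t : `|u 1%N t - u 0%N t| <= M * T.
  have [G [dG ->]] := uS 0%N; rewrite /u /= addrAC subrr add0r.
  apply: (@le_trans _ _ (M * `|clampT t - 0|)); last by rewrite subr0 ler_wpM2l.
  apply: (@mean_value_rV _ _ G (fun t => F (u 0%N t))) => // r rt.
  by apply: dG; apply: between0 rt.
have uC n t : `|u n.+1 t - u n t| <= M * T * 2^-1 ^+ n.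
  elim: n t => [|n IH] t; first by rewrite expr0 mulr1.
  rewrite exprSr mulrA; exact: (picard_step_contract (uS n.+1) (uS n)).
have /choice[x xu'] : forall t : R, exists l : 'rV[R]_k,
    forall n, `|l - u n t| <= M * T * 2 * 2^-1 ^+ n.
  move=> t; apply: (@geometric_limit_rV _ _ (fun n => u n t)) => //.
  by rewrite mulr_ge0// ltW.
have xu n t := xu' t n.
have small e : 0 < e -> exists n, M * T * 2 * 2^-1 ^+ n <= e.
  move=> e0.
  have : geometric (M * T * 2) 2^-1 n @[n --> \oo] --> (0 : R).
    by apply: cvg_geometric; rewrite ger0_norm// invf_lt1// ltr1n.
  move=> /cvgrPdist_le/(_ _ e0)[n _ Hn]; exists n.
  have := Hn n (leqnn n); rewrite /= sub0r normrN ger0_norm//.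
  by rewrite !mulr_ge0// ?exprn_ge0// ltW.
(* All iterates from the first step on are [M]-Lipschitz, and this passes to the limit. *)
have cx : continuous x.
  apply: (@lipschitz_continuous _ _ _ _ M) => s t.
  apply/ler_addgt0Pr => e e0.
  have [n Hn] := small (e / 2) (divr_gt0 e0 (ltr0Sn _ 1)).
  have ul : `|u n.+1 s - u n.+1 t| <= M * `|s - t| by exact: picard_step_lip (uS n).
  have un r : `|x r - u n.+1 r| <= e / 2.
    rewrite (le_trans (xu _ _))// (le_trans _ Hn)// ler_wpM2l//.
      by rewrite !mulr_ge0// ltW.
    by rewrite exprS ler_piMl// ?exprn_ge0//; lra.
  have -> : x s - x t =
      (x s - u n.+1 s) + ((u n.+1 s - u n.+1 t) - (x t - u n.+1 t)).
    by rewrite opprB !subrKA.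
  rewrite (le_trans (ler_normD _ _))//.
  have -> : M * `|s - t| + e = e / 2 + (M * `|s - t| + e / 2).
    by move: (M * _) => a; lra.
  by rewrite lerD// (le_trans (ler_normB _ _))// lerD.
have xS := HS _ cx.
(* Late iterates are arbitrarily close to [x], and by contraction also to [S x]. *)
have xE t : S x t = x t.
  apply/eqP; rewrite -subr_eq0 -normr_le0; apply/ler_addgt0Pr => e e0; rewrite add0r.
  have [n Hn] := small (e / 2) (divr_gt0 e0 (ltr0Sn _ 1)).
  have := picard_step_contract xS (uS n) (xu n) t => H.
  rewrite -(subrKA (u n.+1 t)) (le_trans (ler_normD _ _))//.
  rewrite [leRHS]splitr lerD//.
    apply: le_trans H _; apply: le_trans Hn.
    by rewrite ler_piMr// ?mulr_ge0 ?exprn_ge0 ?(ltW T0)//; lra.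
  rewrite distrC (le_trans (xu _ _))// (le_trans _ Hn)// ler_wpM2l//.
    by rewrite !mulr_ge0// ltW.
  by rewrite exprS ler_piMl// ?exprn_ge0//; lra.
have [G [dG GE]] := xS.
exists x; split.
  by rewrite -xE GE clampT_id ?normr0 ?(ltW T0)// subrr addr0.
move=> t tT.
(* Strictly inside [[-T, T]] the clamp is the identity on a neighbourhood, so it disappears from the
   derivative. *)
have nT : \forall s \near t, x0 + (G s - G 0) = x s.
  have : \forall s \near t, `|s| < T.
    have := @cvgr_norm_lt _ _ _ _ _ (fun s : R => s) t (@cvg_id _ _) T tT.
    exact.
  by apply: filterS => s sT; rewrite -xE GE clampT_id// ltW.
have d0 := dG t (ltW tT).
have d1 : is_derive t 1 (cst x0 + (G - cst (G 0))) (0 + (F (x t) - 0)).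
  by apply: is_deriveD; apply: is_deriveB.
rewrite add0r subr0 in d1.
exact: (near_eq_is_derive nT d1).
Qed.

End picard.

(** * Uniqueness by a Gronwall argument *)

Section uniqueness.
Variables (R : realType) (k : nat) (F : 'rV[R]_k -> 'rV[R]_k) (L : R).
Hypothesis FL : forall x y, `|F x - F y| <= L * `|x - y|.
Variables (x y : R -> 'rV[R]_k) (lo hi t0 : R).
Hypotheses (dx : forall t : R, lo < t < hi -> is_derive t 1 x (F (x t)))
  (dy : forall t : R, lo < t < hi -> is_derive t 1 y (F (y t)))
  (t0lh : lo < t0 < hi) (xy0 : x t0 = y t0).

(** The squared Euclidean distance is used because, unlike the maximum norm, it is
    differentiable. *)
Let E t := \sum_i (x t 0 i - y t 0 i) ^+ 2.
Let dE t := \sum_i 2 * (x t 0 i - y t 0 i) * (F (x t) 0 i - F (y t) 0 i).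
Let K := 2 * k%:R * `|L|.

Let E_derive (t : R) : lo < t < hi -> is_derive t 1 E (dE t).
Proof.
move=> th.
have -> : E = \sum_(i < k) (fun t => (x t 0 i - y t 0 i) ^+ 2).
  by apply/funext => s; rewrite fct_sumE.
rewrite /dE; apply: is_derive_sum => i.
have d1 : is_derive t 1 (fun t => x t 0 i - y t 0 i) (F (x t) 0 i - F (y t) 0 i).
  apply: is_deriveB; [have /is_derive_mxP := dx th|have /is_derive_mxP := dy th]; exact.
have -> : (fun t => (x t 0 i - y t 0 i) ^+ 2) =
    (fun t => (x t 0 i - y t 0 i) * (x t 0 i - y t 0 i)).
  by apply/funext => s; rewrite expr2.
apply: (is_derive_eq (@is_deriveM R _ (fun t => x t 0 i - y t 0 i)
  (fun t => x t 0 i - y t 0 i) t 1 _ _ d1 d1)).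
by rewrite /GRing.scale/=; ring.
Qed.

Let E_ge0 t : 0 <= E t.
Proof. by apply: sumr_ge0 => i _; rewrite sqr_ge0. Qed.

Let dE_le t : `|dE t| <= K * E t.
Proof.
have nE : `|x t - y t| ^+ 2 <= E t.
  rewrite -(sqr_sqrtr (E_ge0 t)) ler_sqr ?nnegrE ?sqrtr_ge0//.
  apply: mx_norm_leP => [|i j]; first exact: sqrtr_ge0.
  rewrite ord1 !mxE -sqrtr_sqr ler_wsqrtr// /E (bigD1 j)//= lerDl.
  by apply: sumr_ge0 => ? _; rewrite sqr_ge0.
apply: (@le_trans _ _ (\sum_(i < k) 2 * `|x t - y t| * (`|L| * `|x t - y t|))).
  rewrite (le_trans (ler_norm_sum _ _ _))//; apply: ler_sum => i _.
  rewrite !normrM ger0_norm// ler_pM ?mulr_ge0//.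
    by rewrite ler_wpM2l//; have := ler_entry_norm (x t - y t) 0 i; rewrite !mxE.
  apply: (@le_trans _ _ `|F (x t) - F (y t)|).
    by have := ler_entry_norm (F (x t) - F (y t)) 0 i; rewrite !mxE.
  by apply: le_trans (FL _ _) _; rewrite ler_wpM2r// ler_norm.
rewrite sumr_const card_ord -[leLHS]mulr_natl.
have -> : k%:R * (2 * `|x t - y t| * (`|L| * `|x t - y t|)) =
    K * `|x t - y t| ^+ 2 by rewrite /K; move: `|x t - y t| => z; ring.
by rewrite ler_wpM2l// !mulr_ge0.
Qed.

Let expE_derive (c t : R) : lo < t < hi ->
  is_derive t 1 (fun t => expR (c * t) * E t)
    (expR (c * t) * (dE t + c * E t)).
Proof.
move=> th.
have d1 : is_derive t 1 (fun t => expR (c * t)) (expR (c * t) * c).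
  have := is_derive_mull c t => dc.
  exact: (@is_derive1_comp _ expR (fun t => c * t) t _ _ (is_derive_expR _) dc).
apply: (is_derive_eq (@is_deriveM R _ (fun t => expR (c * t)) E t 1 _ _ d1
  (E_derive th))).
rewrite /GRing.scale/=; ring.
Qed.

(** Since [E'] is at most [K E] in absolute value, [exp(- K t) E] is nonincreasing and [exp(K t) E]
    is nondecreasing. As [E] vanishes at [t0] and is nonnegative, it vanishes after [t0] by the
    first fact and before [t0] by the second. *)
Lemma ode_unique t : lo < t < hi -> x t = y t.
Proof.
move=> th; suff Et : E t <= 0.
  have E0 : E t = 0 by apply/le_anti; rewrite Et E_ge0.
  move/eqP: E0; rewrite psumr_eq0; last by move=> i _; rewrite sqr_ge0.
  move=> /allP H; apply/rowP => i; apply/eqP; rewrite -subr_eq0 -sqrf_eq0.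
  by have := H i (mem_index_enum _).
have E00 : E t0 = 0 by rewrite /E xy0 big1// => i _; rewrite subrr expr0n.
case/orP: (le_total t0 t) => tt.
  have inI s : t0 <= s <= t -> lo < s < hi.
    move=> /andP[a b]; case/andP: t0lh => ? _; case/andP: th => _ ?.
    by rewrite (lt_le_trans _ a)// (le_lt_trans b).
  have := @derive_ge0_le R (fun s => - (expR (- K * s) * E s))
    (fun s => - (expR (- K * s) * (dE s + - K * E s))) t0 t tt.
  rewrite E00 mulr0 oppr0 oppr_ge0 pmulr_rle0 ?expR_gt0//; apply.
    by move=> s sI; apply: is_deriveN; apply: expE_derive; exact: inI.
  move=> s sI; rewrite oppr_ge0 pmulr_rle0 ?expR_gt0// mulNr subr_le0.
  exact: le_trans (ler_norm _) (dE_le _).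
have inI s : t <= s <= t0 -> lo < s < hi.
  move=> /andP[a b]; case/andP: t0lh => _ ?; case/andP: th => ? _.
  by rewrite (lt_le_trans _ a)// (le_lt_trans b).
have := @derive_ge0_le R (fun s => expR (K * s) * E s)
  (fun s => expR (K * s) * (dE s + K * E s)) t t0 tt.
rewrite E00 mulr0 pmulr_rle0 ?expR_gt0//; apply.
  by move=> s sI; apply: expE_derive; exact: inI.
move=> s sI; rewrite mulr_ge0 ?expR_ge0// -lerBlDr sub0r.
by have := dE_le s; rewrite ler_norml => /andP[].
Qed.

End uniqueness.

(** * Bounded Lipschitz functions *)

(** Boundedness is included because it makes the class closed under products, which Lipschitz
    functions alone are not. *)
Definition blip (R : realType) (V : normedModType R) (S : set V) (f : V -> R) :=
  exists C, [/\ 0 <= C, forall x, S x -> `|f x| <= C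
    & forall x y, S x -> S y -> `|f x - f y| <= C * `|x - y|].

Section blip.
Variables (R : realType) (V : normedModType R).
Implicit Types (S : set V) (f g : V -> R).

Lemma blip_sub S S' f : S' `<=` S -> blip S f -> blip S' f.
Proof.
move=> SS [C [C0 fC fL]]; exists C; split => // [x /SS|x y /SS Sx /SS Sy].
  exact: fC.
exact: fL.
Qed.

Lemma blip_ext S f g : (forall x, S x -> f x = g x) -> blip S f -> blip S g.
Proof.
move=> fg [C [C0 fC fL]]; exists C; split => // [x Sx|x y Sx Sy].
  by rewrite -fg//; exact: fC.
by rewrite -!fg//; exact: fL.
Qed.

Lemma blip_cst S a : blip S (fun=> a).
Proof.
exists `|a|; split => // x y _ _.
by rewrite subrr normr0 mulr_ge0.
Qed.

Lemma blipD S f g : blip S f -> blip S g -> blip S (fun x => f x + g x).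
Proof.
move=> [C [C0 fC fL]] [D [D0 gD gL]]; exists (C + D); split.
- by rewrite addr_ge0.
- by move=> x Sx; rewrite (le_trans (ler_normD _ _))// lerD ?fC ?gD.
- move=> x y Sx Sy; rewrite opprD addrACA mulrDl (le_trans (ler_normD _ _))//.
  by rewrite lerD ?fL ?gL.
Qed.

Lemma blipM S f g : blip S f -> blip S g -> blip S (fun x => f x * g x).
Proof.
move=> [C [C0 fC fL]] [D [D0 gD gL]]; exists (C * D + C * D); split.
- by rewrite addr_ge0// mulr_ge0.
- move=> x Sx; rewrite normrM (@le_trans _ _ (C * D))//.
    by rewrite ler_pM// ?fC ?gD.
  by rewrite lerDl mulr_ge0.
- move=> x y Sx Sy.
  have -> : f x * g x - f y * g y = (f x - f y) * g x + f y * (g x - g y) by ring.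
  rewrite (le_trans (ler_normD _ _))// [leRHS]mulrDl lerD// normrM.
    by rewrite mulrAC ler_pM// ?fL ?gD.
  by rewrite -mulrA ler_pM// ?fC ?gL.
Qed.

Lemma blip_sum S (I : Type) (r : seq I) (f : I -> V -> R) :
  (forall i, blip S (f i)) -> blip S (fun x => \sum_(i <- r) f i x).
Proof.
move=> Sf; elim: r => [|i r IH].
  by apply: blip_ext (blip_cst S 0) => x _; rewrite big_nil.
by apply: blip_ext (blipD (Sf i) IH) => x _; rewrite big_cons.
Qed.

Lemma blip_prod S (I : Type) (r : seq I) (f : I -> V -> R) :
  (forall i, blip S (f i)) -> blip S (fun x => \prod_(i <- r) f i x).
Proof.
move=> Sf; elim: r => [|i r IH].
  by apply: blip_ext (blip_cst S 1) => x _; rewrite big_nil.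
by apply: blip_ext (blipM (Sf i) IH) => x _; rewrite big_cons.
Qed.

Lemma blipV S f c : 0 < c -> (forall x, S x -> c <= `|f x|) -> blip S f ->
  blip S (fun x => (f x)^-1).
Proof.
move=> c0 cf [C [C0 fC fL]].
have fn0 x : S x -> f x != 0 by move=> Sx; rewrite -normr_gt0 (lt_le_trans c0)// cf.
have cfV x : S x -> `|(f x)^-1| <= c^-1.
  by move=> Sx; rewrite normfV lef_pV2 ?posrE ?cf// (lt_le_trans c0)// cf.
exists (c^-1 + c^-1 * c^-1 * C); split.
- by rewrite addr_ge0// ?mulr_ge0// invr_ge0 ltW.
- move=> x Sx; rewrite (le_trans (cfV x Sx))// lerDl !mulr_ge0//; rewrite invr_ge0 ltW//.
- move=> x y Sx Sy.
  have -> : (f x)^-1 - (f y)^-1 = - ((f x)^-1 * (f y)^-1 * (f x - f y)).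
    by field; rewrite !fn0.
  rewrite normrN !normrM mulrDl (@le_trans _ _ (c^-1 * c^-1 * C * `|x - y|))//.
    rewrite -[leRHS]mulrA; apply: ler_pM; rewrite ?mulr_ge0//; last exact: fL.
    by apply: ler_pM => //; exact: cfV.
  by rewrite lerDr mulr_ge0// invr_ge0 ltW.
Qed.

Lemma blip_comp S (W : normedModType R) (S' : set W) (p : W -> V) f :
  (forall x, S' x -> S (p x)) ->
  (forall x y, S' x -> S' y -> `|p x - p y| <= `|x - y|) ->
  blip S f -> blip S' (fun x => f (p x)).
Proof.
move=> SS' pL [C [C0 fC fL]]; exists C; split => // [x Sx|x y Sx Sy].
  by apply: fC; exact: SS'.
by apply: le_trans (fL _ _ _ _) _; rewrite ?ler_wpM2l ?pL//; exact: SS'.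
Qed.

Lemma blip_det S k (M : V -> 'M[R]_k) :
  (forall i j, blip S (fun x => M x i j)) -> blip S (fun x => \det (M x)).
Proof.
move=> MS; rewrite /determinant; apply: blip_sum => s; apply: blipM.
  exact: blip_cst.
by apply: blip_prod => i; exact: MS.
Qed.

Lemma blip_adj S k (M : V -> 'M[R]_k) i j :
  (forall i j, blip S (fun x => M x i j)) -> blip S (fun x => (\adj (M x)) i j).
Proof.
move=> MS; apply: (@blip_ext _ (fun x => cofactor (M x) j i)).
  by move=> x _; rewrite mxE.
rewrite /cofactor; apply: blipM; first exact: blip_cst.
apply: blip_det => i' j'; apply: blip_ext (MS (lift j i') (lift i j')) => x _.
by rewrite !mxE.
Qed.

Lemma blip_mx S p q (M : V -> 'M[R]_(p, q)) :
  (forall i j, blip S (fun x => M x i j)) ->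
  exists C, [/\ 0 <= C, forall x, S x -> `|M x| <= C
    & forall x y, S x -> S y -> `|M x - M y| <= C * `|x - y|].
Proof.
move=> MS.
have /choice[C HC] : forall ij : 'I_p * 'I_q, exists C, [/\ 0 <= C,
    forall x, S x -> `|M x ij.1 ij.2| <= C
    & forall x y, S x -> S y -> `|M x ij.1 ij.2 - M y ij.1 ij.2| <= C * `|x - y|].
  by move=> [i j]; exact: MS.
have C0 : 0 <= \sum_ij C ij by apply: sumr_ge0 => ij _; case: (HC ij).
have CC i j : C (i, j) <= \sum_ij C ij.
  rewrite (bigD1 (i, j))//= lerDl; apply: sumr_ge0 => ij _; by case: (HC ij).
exists (\sum_ij C ij); split => // [x Sx|x y Sx Sy].
  apply: mx_norm_leP => // i j; have [_ + _] := HC (i, j).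
  by move=> /(_ x Sx)/le_trans; apply; exact: CC.
apply: mx_norm_leP => [|i j]; first by rewrite mulr_ge0.
have [_ _ /(_ x y Sx Sy)] := HC (i, j); rewrite !mxE => /le_trans; apply.
by rewrite ler_wpM2r// CC.
Qed.

End blip.

(** Asked for all small radii rather than for one, so that finitely many such properties can be
    intersected as filter statements. *)
Definition nblip (R : realType) (V : normedModType R) (u0 : V) (f : V -> R) :=
  \forall r \near 0^'+, blip [set z | `|z - u0| < r] f.

Section nblip.
Variables (R : realType).

Lemma nblipI (V : normedModType R) (u0 : V) f r :
  0 < r -> blip [set z | `|z - u0| < r] f -> nblip u0 f.
Proof.
move=> r0 fb; near=> s; apply: blip_sub fb => z /= /lt_le_trans; apply.
by near: s; exact: nbhs_right_le.
Unshelve. all: by end_near. Qed.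

Lemma nblip_ext (V : normedModType R) (u0 : V) f g :
  (\forall x \near u0, f x = g x) -> nblip u0 f -> nblip u0 g.
Proof.
move=> /nbhs_ballP[e /= e0 fg] fb; near=> r.
have rb : blip [set z | `|z - u0| < r] f by near: r; exact: fb.
apply: blip_ext rb => x /= xr; apply: fg; rewrite -ball_normE/= distrC.
by apply: lt_le_trans xr _; near: r; exact: nbhs_right_le.
Unshelve. all: by end_near. Qed.

Lemma nblip_forall (V : normedModType R) (u0 : V) (I : finType) (f : I -> V -> R) :
  (forall i, nblip u0 (f i)) ->
  \forall r \near 0^'+, forall i, blip [set z | `|z - u0| < r] (f i).
Proof. by move=> fb; apply: filter_forall. Qed.

Lemma nblipM (V : normedModType R) (u0 : V) f g :
  nblip u0 f -> nblip u0 g -> nblip u0 (fun x => f x * g x).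
Proof. by apply: filterS2 => r; exact: blipM. Qed.

Lemma nblipD (V : normedModType R) (u0 : V) f g :
  nblip u0 f -> nblip u0 g -> nblip u0 (fun x => f x + g x).
Proof. by apply: filterS2 => r; exact: blipD. Qed.

Lemma nblip_cst (V : normedModType R) (u0 : V) a : nblip u0 (fun=> a).
Proof. by near=> r; exact: blip_cst. Unshelve. all: by end_near. Qed.

Lemma nblip_sum (V : normedModType R) (u0 : V) (I : finType) (f : I -> V -> R) :
  (forall i, nblip u0 (f i)) -> nblip u0 (fun x => \sum_i f i x).
Proof. by move=> /nblip_forall; apply: filterS => r; exact: blip_sum. Qed.

(** On a small enough ball [f] stays at least half of its absolute value at [u0], hence away from
    zero. *)
Lemma nblipV (V : normedModType R) (u0 : V) f :
  f u0 != 0 -> nblip u0 f -> nblip u0 (fun x => (f x)^-1).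
Proof.
move=> f0 fb.
have [r [[C [C0 fC fL]] r0]] := filter_ex (filterI fb (nbhs_right_gt 0)).
pose c := `|f u0| / 2.
have c0 : 0 < c by rewrite divr_gt0// normr_gt0.
pose e := Num.min r (c / (C + 1)).
have C10 : 0 < C + 1 by rewrite ltr_wpDl.
have e0 : 0 < e by rewrite lt_min r0 divr_gt0.
apply: (nblipI e0); apply: (blipV c0); last first.
  apply: (@blip_sub _ _ [set z | `|z - u0| < r]); last by exists C; split.
  by move=> z /=; rewrite lt_min => /andP[].
move=> x /=; rewrite lt_min => /andP[xr xe].
have u0r : `|u0 - u0| < r by rewrite subrr normr0.
have := fL x u0 xr u0r => fx.
have fxc : `|f x - f u0| <= c.
  apply: le_trans fx _; apply: (@le_trans _ _ ((C + 1) * `|x - u0|)).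
    by rewrite ler_wpM2r// lerDl.
  by rewrite mulrC -ler_pdivlMr// ltW.
have : `|f u0| <= `|f x| + `|f x - f u0|.
  by rewrite -[X in X <= _](_ : `|f x - (f x - f u0)| = _) ?ler_normB// subKr.
move: fxc; rewrite /c => ? ?; lra.
Qed.

Lemma nblip_C1 m (A : set 'rV[R]_m) (f : 'rV[R]_m -> R) u0 :
  open A -> A u0 -> Ck_on 1 A f -> nblip u0 f.
Proof.
move=> oA Au [fc fd].
have H1 : \forall z \near u0, forall i : 'I_m, derivable f z (delta_mx 0 i).
  have nA : \forall z \near u0, A z by apply: open_nbhs_nbhs.
  by apply: filterS nA => z Az i; have [+ _] := fd i; apply.
have H2 (i : 'I_m) : {for u0, continuous (fun z => 'D_(delta_mx 0 i) f z)}.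
  by have [_ [+ _]] := fd i; apply; rewrite inE.
have [r r0 Hr] := C1_near_box H1 H2 (@ltr01 R).
have [K [K0 L]] : exists K, 0 <= K /\ forall x y, `|x - u0| < r ->
    `|y - u0| < r -> `|f y - f x| <= K * `|y - x|.
  exists (\sum_i `|'D_(delta_mx 0 i) f u0| + m%:R * 1).
  by split; [rewrite addr_ge0// ?sumr_ge0// mulr1|exact: box_lipschitz Hr].
apply: (nblipI r0); exists (`|f u0| + K * r + K); split.
- by rewrite addr_ge0// addr_ge0// mulr_ge0// ltW.
- move=> x xr.
  have u0r : `|u0 - u0| < r by rewrite subrr normr0.
  rewrite -(subrK (f u0) (f x)) (le_trans (ler_normD _ _))// addrC -addrA lerD//.
  by rewrite (le_trans (L _ _ u0r xr))// ler_wpDr// ler_wpM2l// ltW.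
- move=> x y xr yr; rewrite (le_trans (L _ _ yr xr))// ler_wpM2r//.
  by rewrite lerDr addr_ge0// mulr_ge0// ltW.
Qed.

Section christoffel.
Variables (m : nat) (A : set 'rV[R]_m) (G : 'rV[R]_m -> 'M[R]_m) (u0 : 'rV[R]_m).
Hypotheses (oA : open A) (Au : A u0) (GA : Ck_on 2 A G)
  (Gu : forall u, A u -> G u \in unitmx).

Lemma nblip_metric i j : nblip u0 (fun u => G u i j).
Proof.
apply: (nblip_C1 oA Au); apply: Ck_on_entry => //.
exact: Ck_on_le GA.
Qed.

(** By Cramer's formula the inverse is built from the determinant and the adjugate, which are
    polynomial in the entries. *)
Lemma nblip_inv_metric i j : nblip u0 (fun u => invmx (G u) i j).
Proof.
have nA : \forall z \near u0, A z by apply: open_nbhs_nbhs.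
apply: (@nblip_ext _ _ (fun u => (\det (G u))^-1 * (\adj (G u)) i j)).
  by apply: filterS nA => z Az; rewrite /invmx Gu// [RHS]mxE.
have H : \forall r \near 0^'+, forall ij : 'I_m * 'I_m,
    blip [set z | `|z - u0| < r] (fun u => G u ij.1 ij.2).
  by apply: nblip_forall => -[i' j']; exact: nblip_metric.
apply: nblipM.
  apply: nblipV; first by rewrite -unitfE -unitmxE Gu.
  by apply: filterS H => r H; apply: blip_det => i' j'; exact: (H (i', j')).
by apply: filterS H => r H; apply: blip_adj => i' j'; exact: (H (i', j')).
Qed.

(** As [G] is C2, its first derivatives are C1, hence Lipschitz near [u0]. *)
Lemma nblip_christoffel k i j : nblip u0 (fun u => christoffel G u k i j).
Proof.
have D l i' j' : nblip u0 (fun u => 'D_(delta_mx 0 l) G u i' j').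
  by apply: (nblip_C1 oA Au); apply: Ck_on_entry => //; have [_ /(_ l)[]] := GA.
rewrite /christoffel; apply: nblipM; first exact: nblip_cst.
apply: nblip_sum => l; apply: nblipM; first exact: nblip_inv_metric.
apply: nblipD; first by apply: nblipD; exact: D.
apply: (@nblip_ext _ _ (fun u => -1 * 'D_(delta_mx 0 l) G u i j)).
  by near=> u; rewrite mulN1r.
by apply: nblipM; [exact: nblip_cst|exact: D].
Unshelve. all: by end_near. Qed.

End christoffel.
End nblip.

(** * Geodesics in a chart *)

Definition clamp_rV (R : realType) m (c : 'rV[R]_m) (r : R) (v : 'rV[R]_m) :=
  \row_i clamp (c 0 i) r (v 0 i).

Section clamp_rV.
Variables (R : realType) (m : nat).
Implicit Types (c v w : 'rV[R]_m) (r : R).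

Lemma clamp_rV_le c r v : 0 <= r -> `|clamp_rV c r v - c| <= r.
Proof.
by move=> r0; apply: mx_norm_leP => // i j; rewrite ord1 !mxE clamp_le.
Qed.

Lemma clamp_rV_id c r v : `|v - c| <= r -> clamp_rV c r v = v.
Proof.
move=> vc; apply/rowP => i; rewrite mxE clamp_id// (le_trans _ vc)//.
by have := ler_entry_norm (v - c) 0 i; rewrite !mxE.
Qed.

Lemma clamp_rV_lip c r v w : 0 <= r ->
  `|clamp_rV c r v - clamp_rV c r w| <= `|v - w|.
Proof.
move=> r0; apply: mx_norm_leP => // i j; rewrite ord1 !mxE.
by rewrite (le_trans (clamp_lip _ _ _ _))//; have := ler_entry_norm (v - w) 0 j; rewrite !mxE.
Qed.

End clamp_rV.

Lemma norm_lsubmx_le (R : realType) m n (z : 'rV[R]_(m + n)) : `|lsubmx z| <= `|z|.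
Proof. by apply: mx_norm_leP => // i j; rewrite mxE; exact: ler_entry_norm. Qed.

Lemma norm_rsubmx_le (R : realType) m n (z : 'rV[R]_(m + n)) : `|rsubmx z| <= `|z|.
Proof. by apply: mx_norm_leP => // i j; rewrite mxE; exact: ler_entry_norm. Qed.

Lemma is_derive_lsubmx (R : realType) m n (x : R -> 'rV[R]_(m + n)) (t : R) dx :
  is_derive t 1 x dx -> is_derive t 1 (fun s => lsubmx (x s)) (lsubmx dx).
Proof.
move=> /is_derive_mxP H; apply/is_derive_mxP => i j; rewrite mxE.
by have -> : (fun s => lsubmx (x s) i j) = (fun s => x s i (lshift n j))
  by apply/funext => s; rewrite mxE.
Qed.

Lemma is_derive_rsubmx (R : realType) m n (x : R -> 'rV[R]_(m + n)) (t : R) dx :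
  is_derive t 1 x dx -> is_derive t 1 (fun s => rsubmx (x s)) (rsubmx dx).
Proof.
move=> /is_derive_mxP H; apply/is_derive_mxP => i j; rewrite mxE.
by have -> : (fun s => rsubmx (x s) i j) = (fun s => x s i (rshift m j))
  by apply/funext => s; rewrite mxE.
Qed.

Lemma is_derive_row_mx (R : realType) m n (x : R -> 'rV[R]_m) (y : R -> 'rV[R]_n)
    (t : R) dx dy : is_derive t 1 x dx -> is_derive t 1 y dy ->
  is_derive t 1 (fun s => row_mx (x s) (y s)) (row_mx dx dy).
Proof.
move=> /is_derive_mxP Hx /is_derive_mxP Hy; apply/is_derive_mxP => i j.
case: (split_ordP j) => j' ->.
  rewrite row_mxEl; have -> : (fun s => row_mx (x s) (y s) i (lshift n j')) =
    (fun s => x s i j') by apply/funext => s; rewrite row_mxEl.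
  exact: Hx.
rewrite row_mxEr; have -> : (fun s => row_mx (x s) (y s) i (rshift m j')) =
  (fun s => y s i j') by apply/funext => s; rewrite row_mxEr.
exact: Hy.
Qed.

Lemma derivable1_continuous (R : realType) (W : normedModType R) (f : R -> W)
    (t : R) : derivable f t 1 -> {for t, continuous f}.
Proof. by move=> /derivable1_diffP/differentiable_continuous. Qed.

Lemma ler_norm_distD (R : realType) (W : normedModType R) (a b : W) :
  `|b| <= `|a| + `|a - b|.
Proof. by rewrite -[X in X <= _](_ : `|a - (a - b)| = _) ?ler_normB// subKr. Qed.

Definition geodesic_acceleration (R : realType) m (G : 'rV[R]_m -> 'M[R]_m)
    (u v : 'rV[R]_m) : 'rV[R]_m :=
  \row_k - \sum_i \sum_j christoffel G u k i j * v 0 i * v 0 j.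

(** The geodesic spray in a chart: the first-order form of the equation, a state being a position
    followed by a velocity. *)
Definition geodesic_field (R : realType) m (G : 'rV[R]_m -> 'M[R]_m)
    (z : 'rV[R]_(m + m)) : 'rV[R]_(m + m) :=
  row_mx (rsubmx z) (geodesic_acceleration G (lsubmx z) (rsubmx z)).

(** The clause of [geodesic_on] for a single chart and a single time, so that it can be moved
    between charts and curves. *)
Definition chart_geodesic_at (R : realType) m (G : 'rV[R]_m -> 'M[R]_m)
    (u : R -> 'rV[R]_m) (t : R) :=
  [/\ derivable u t 1, derivable (derive1 u) t 1
    & forall k, derive1 (derive1 u) t 0 k
        + \sum_i \sum_j christoffel G (u t) k i j
            * derive1 u t 0 i * derive1 u t 0 j = 0].

Lemma chart_geodesic_field (R : realType) m (G : 'rV[R]_m -> 'M[R]_m)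
    (u : R -> 'rV[R]_m) (t : R) : chart_geodesic_at G u t ->
  is_derive t 1 (fun s => row_mx (u s) (derive1 u s))
    (geodesic_field G (row_mx (u t) (derive1 u t))).
Proof.
move=> [d1 d2 E]; rewrite /geodesic_field row_mxKl row_mxKr.
apply: is_derive_row_mx.
  by apply: is_derive_eq (derivableP d1) _; rewrite -derive1E.
have -> : geodesic_acceleration G (u t) (derive1 u t) = 'D_1 (derive1 u) t.
  apply: etrans _ (derive1E _ _); apply/rowP => k; rewrite mxE; apply/eqP.
  by rewrite eq_sym -addr_eq0 E.
exact: derivableP.
Qed.

Section geodesic_flow.
Variables (R : realType) (m : nat) (A : set 'rV[R]_m) (G : 'rV[R]_m -> 'M[R]_m).
Hypotheses (oA : open A) (GA : Ck_on 2 A G)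
  (Gu : forall u, A u -> G u \in unitmx).

(** Position and velocity are clamped before the field is evaluated. The position radius [rho] is
    fixed before the velocity bound [V], because the Christoffel symbols depend on the position
    only. *)
Lemma geodesic_field_truncation u0 : A u0 -> exists rho, [/\ 0 < rho,
  forall u, `|u - u0| <= rho -> A u
  & forall V, 0 <= V -> exists (F : 'rV[R]_(m + m) -> 'rV[R]_(m + m)) (C : R),
    [/\ 0 <= C, forall z, `|F z| <= C, forall z w, `|F z - F w| <= C * `|z - w|
      & forall z, `|lsubmx z - u0| <= rho -> `|rsubmx z| <= V ->
          F z = geodesic_field G z]].
Proof.
move=> Au0.
have := open_nbhs_nbhs (conj oA Au0 : open_nbhs u0 A).
move=> /nbhs_ballP[r1 /= r10 B1].
have H : \forall r \near 0^'+, forall kij : 'I_m * 'I_m * 'I_m,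
    blip [set z | `|z - u0| < r] (fun u => christoffel G u kij.1.1 kij.1.2 kij.2).
  by apply: nblip_forall => -[[k i] j]; exact: nblip_christoffel oA Au0 GA Gu k i j.
have [r [[Hr r0] rr1]] := filter_ex (filterI (filterI H (nbhs_right_gt 0)) (nbhs_right_lt r10)).
have {}Hr k i j : blip [set z | `|z - u0| < r] (fun u => christoffel G u k i j).
  exact: (Hr (k, i, j)).
(* Half the radius, so that the closed box on which positions are clamped lies in the open ball
   where the bounds hold. *)
exists (r / 2); split; first by rewrite divr_gt0.
  move=> u ur; apply: B1; rewrite -ball_normE/= distrC (le_lt_trans ur)//.
  by apply: lt_trans rr1; rewrite ltr_pdivrMr// ltr_pMr// ltr1n.
move=> V V0.
pose cu (z : 'rV[R]_(m + m)) := clamp_rV u0 (r / 2) (lsubmx z).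
pose cv (z : 'rV[R]_(m + m)) := clamp_rV 0 V (rsubmx z).
pose F z := row_mx (cv z) (geodesic_acceleration G (cu z) (cv z)).
have cvb i : blip setT (fun z => cv z 0 i).
  exists (V + 1); split; first by rewrite addr_ge0.
    move=> z _; apply: (@le_trans _ _ V); last by rewrite lerDl.
    apply: le_trans (ler_entry_norm _ _ _) _.
    by rewrite -[cv z]subr0; exact: clamp_rV_le.
  move=> z w _ _; apply: (@le_trans _ _ (1 * `|z - w|)); last first.
    by rewrite ler_wpM2r// lerDr.
  rewrite mul1r (le_trans _ (norm_rsubmx_le _))// linearB/=.
  rewrite (le_trans _ (clamp_rV_lip 0 _ _ V0))//.
  by have := ler_entry_norm (cv z - cv w) 0 i; rewrite !mxE.
have cub k i j : blip setT (fun z => christoffel G (cu z) k i j).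
  apply: (blip_comp _ _ (Hr k i j)).
    move=> z _ /=; apply: (@le_lt_trans _ _ (r / 2)).
      by apply: clamp_rV_le; rewrite divr_ge0// ltW.
    by rewrite ltr_pdivrMr// ltr_pMr// ltr1n.
  move=> z w _ _; rewrite (le_trans (clamp_rV_lip _ _ _ _))//.
    by rewrite divr_ge0// ltW.
  by rewrite -linearB norm_lsubmx_le.
have Fb i j : blip setT (fun z => F z i j).
  rewrite ord1; case: (split_ordP j) => j' ->.
    by apply: blip_ext (cvb j') => z _; rewrite /F row_mxEl.
  apply: (@blip_ext _ _ _ (fun z => -1 *
    \sum_i \sum_j christoffel G (cu z) j' i j * cv z 0 i * cv z 0 j)).
    by move=> z _; rewrite /F row_mxEr [in RHS]mxE mulN1r.
  apply: blipM; first exact: blip_cst.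
  apply: blip_sum => i1; apply: blip_sum => j1.
  by apply: blipM => //; apply: blipM.
have [C [C0 FC FL]] := blip_mx Fb.
exists F, C; split => //.
- by move=> z; exact: FC.
- by move=> z w; exact: FL.
- move=> z zu zv; have zv' : `|rsubmx z - 0| <= V by rewrite subr0.
  by rewrite /F /cu /cv (clamp_rV_id zu) (clamp_rV_id zv').
Qed.

(** The time [T] is the same for all starting times, positions near [u0] and velocities bounded by
    [V]. This uniformity is what lets a geodesic be prolonged beyond the end of its domain. *)
Lemma geodesic_flow u0 : A u0 -> exists2 rho, 0 < rho &
  forall V, 0 <= V -> exists2 T, 0 < T & forall (t0 : R) u1 v1,
    `|u1 - u0| <= rho -> `|v1| <= V ->
    exists u : R -> 'rV[R]_m, [/\ u t0 = u1, derive1 u t0 = v1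
      & forall t, `|t - t0| < T -> A (u t) /\ chart_geodesic_at G u t].
Proof.
move=> Au0; have [rho [rho0 rhoA H]] := geodesic_field_truncation Au0.
exists (rho / 2); first by rewrite divr_gt0.
(* The field is truncated at speed [V + 1] and radius [rho]; the start is limited to [V] and
   [rho / 2], which leaves room to move. *)
move=> V V0; have [F [C [C0 FC FL FE]]] := H (V + 1) (addr_ge0 V0 ler01).
pose T1 := (2 * (C + 1))^-1.
have C1 : 0 < C + 1 by rewrite ltr_wpDl.
have T10 : 0 < T1 by rewrite invr_gt0 mulr_gt0.
have CT1 : C * T1 <= 2^-1.
  rewrite /T1 invfM mulrCA ger_pMr// ler_pdivrMr// mul1r lerDl//.
(* [T1] meets the contraction condition of [picard_solution]; the other two bounds keep the position
   within [rho / 2] and the velocity within [1] of their initial values, where the truncated field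
   is the true one. *)
pose T := Num.min T1 (Num.min (rho / 2 / (C + 1)) (1 / (C + 1))).
have T0 : 0 < T by rewrite !lt_min T10 !divr_gt0.
exists T => // t0 u1 v1 u1r v1V.
have [x [x0 dx]] := picard_solution FL FC C0 T10 CT1 (row_mx u1 v1).
pose y t := x (t - t0).
have y0 : y t0 = row_mx u1 v1 by rewrite /y subrr.
have dy (t : R) : `|t - t0| < T1 -> is_derive t 1 y (F (y t)).
  move=> tT; apply/is_derive_mxP => i j.
  have /is_derive_mxP/(_ i j) d1 := dx (t - t0) tT.
  have d2 : is_derive t 1 (fun t : R => t - t0) 1.
    apply: (is_derive_eq (is_deriveB (is_derive_id t (1 : R)) (is_derive_cst t0 t 1))).
    exact: subr0.
  have := @is_derive1_comp R (fun s => x s i j) (fun t => t - t0) t _ _ d1 d2.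
  by rewrite mulr1.
have yC t : `|t - t0| < T -> `|y t - y t0| <= rho / 2 /\ `|y t - y t0| <= 1.
  move=> tT.
  have tT1 : `|t - t0| < T1 by rewrite (lt_le_trans tT)// ge_min lexx.
  have mv : `|y t - y t0| <= C * `|t - t0|.
    apply: (@mean_value_rV _ _ y (fun t => F (y t))) => // s st; apply: dy.
    apply: le_lt_trans tT1; move: st; rewrite ler_norml.
    have := ler_norm (t - t0); have := ler_norm (t0 - t); rewrite distrC.
    by case: (leP t0 t) => ? ? ? /andP[? ?]; apply/andP; split; lra.
  have CT K : 0 < K -> T <= K / (C + 1) -> `|y t - y t0| <= K.
    move=> K0 TK; apply: le_trans mv _; apply: (@le_trans _ _ ((C + 1) * T)).
      by rewrite ler_pM// ?lerDl// ltW.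
    by rewrite mulrC -ler_pdivlMr.
  split; apply: CT => //; rewrite ?divr_gt0// /T !ge_min lexx ?orbT//.
pose u t := lsubmx (y t).
have box t : `|t - t0| < T -> `|u t - u0| <= rho /\ `|rsubmx (y t)| <= V + 1.
  move=> /yC[h1 h2]; split.
    rewrite -(subrKA u1) (le_trans (ler_normD _ _))// [leRHS]splitr lerD//.
    apply: le_trans h1; rewrite /u -[X in lsubmx _ - X](row_mxKl u1 v1) -y0.
    by rewrite -linearB norm_lsubmx_le.
  rewrite -(subrK v1 (rsubmx _)) (le_trans (ler_normD _ _))// addrC lerD//.
  apply: le_trans h2; rewrite -[X in rsubmx _ - X](row_mxKr u1 v1) -y0.
  by rewrite -linearB norm_rsubmx_le.
have FEt t : `|t - t0| < T -> F (y t) = geodesic_field G (y t).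
  by move=> /box[? ?]; exact: FE.
have TT1 t : `|t - t0| < T -> `|t - t0| < T1.
  by move=> tT; rewrite (lt_le_trans tT)// ge_min lexx.
have du (t : R) : `|t - t0| < T -> is_derive t 1 u (rsubmx (y t)).
  move=> tT; have := is_derive_lsubmx (dy t (TT1 t tT)).
  by rewrite FEt// /geodesic_field row_mxKl.
have du1 t : `|t - t0| < T -> derive1 u t = rsubmx (y t).
  by move=> /du[_ e]; apply: etrans (derive1E _ _) e.
exists u; split.
- by rewrite /u y0 row_mxKl.
- by rewrite du1 ?subrr ?normr0// y0 row_mxKr.
move=> t tT; split; first by apply: rhoA; case: (box t tT).
have ddu : is_derive t 1 (derive1 u) (geodesic_acceleration G (u t) (rsubmx (y t))).
  have near_t : \forall s \near t, rsubmx (y s) = derive1 u s.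
    have : \forall s \near t, `|s - t0| < T.
      have c : {for t, continuous (fun s : R => s - t0)}.
        by apply: cvgB; [exact: cvg_id|exact: cvg_cst].
      exact: (cvgr_norm_lt _ c).
    by apply: filterS => s sT; rewrite du1.
  apply: (near_eq_is_derive near_t).
  have := is_derive_rsubmx (dy t (TT1 t tT)).
  by rewrite FEt// /geodesic_field row_mxKr.
split; [by case: (du t tT)|by case: ddu|].
move=> k; case: ddu => _ e.
have -> : derive1 (derive1 u) t = geodesic_acceleration G (u t) (rsubmx (y t)).
  exact: etrans (derive1E (derive1 u) t) e.
by rewrite du1// mxE addNr.
Qed.

(** Near [t0] both curves, with their velocities, stay by continuity in the region where the
    truncated field is the geodesic field, so they solve the same Lipschitz equation. *)
Lemma chart_geodesic_unique (u w : R -> 'rV[R]_m) t0 : A (u t0) ->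
  u t0 = w t0 -> derive1 u t0 = derive1 w t0 ->
  (\forall t \near t0, chart_geodesic_at G u t) ->
  (\forall t \near t0, chart_geodesic_at G w t) ->
  \forall t \near t0, u t = w t.
Proof.
move=> Au uw duw gu gw.
have [rho [rho0 rhoA H]] := geodesic_field_truncation Au.
have V0 : 0 <= `|derive1 u t0| + 1 by rewrite addr_ge0.
have [F [C [C0 FC FL FE]]] := H _ V0.
have solves (z : R -> 'rV[R]_m) : u t0 = z t0 -> derive1 u t0 = derive1 z t0 ->
    (\forall t \near t0, chart_geodesic_at G z t) ->
    \forall t \near t0, is_derive (t : R) 1 (fun s => row_mx (z s) (derive1 z s))
      (F (row_mx (z t) (derive1 z t))).
  move=> uz duz gz.
  have [d1 d2 _] := nbhs_singleton gz.
  have c1 := derivable1_continuous d1.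
  have c2 := derivable1_continuous d2.
  have n1 : \forall t \near t0, `|u t0 - z t| <= rho.
    by rewrite uz; exact: (@cvgr_dist_le _ _ _ _ _ z _ c1).
  have n2 : \forall t \near t0, `|derive1 z t0 - derive1 z t| <= 1.
    exact: (@cvgr_dist_le _ _ _ _ _ (derive1 z) _ c2).
  near=> t.
  have g : chart_geodesic_at G z t by near: t.
  have b1 : `|u t0 - z t| <= rho by near: t.
  have b2 : `|derive1 z t0 - derive1 z t| <= 1 by near: t.
  rewrite FE ?row_mxKl ?row_mxKr; first exact: chart_geodesic_field.
    by rewrite distrC.
  apply: le_trans (ler_norm_distD (derive1 z t0) _) _; apply: lerD b2.
  by move: (congr1 Num.norm duz) => ->.
have /nbhs_ballP[e1 /= e10 B1] := solves u erefl erefl gu.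
have /nbhs_ballP[e2 /= e20 B2] := solves w uw duw gw.
pose e := Num.min e1 e2.
have e0 : 0 < e by rewrite lt_min e10.
have be t : t0 - e < t < t0 + e -> `|t0 - t| < e.
  by move=> /andP[? ?]; rewrite ltr_norml; apply/andP; split; lra.
have nb : \forall t \near t0, `|t0 - t| < e
  by exact: (@cvgr_dist_lt _ _ _ (nbhs t0) _ id t0 cvg_id e e0).
apply: filterS nb => t; rewrite ltr_norml => /andP[? ?].
have := @ode_unique R (m + m) F C FL (fun s => row_mx (u s) (derive1 u s))
  (fun s => row_mx (w s) (derive1 w s)) (t0 - e) (t0 + e) t0.
move=> /(_ _ _ _ _ t) h.
have /(congr1 lsubmx) : row_mx (u t) (derive1 u t) = row_mx (w t) (derive1 w t).
  apply: h.
  - move=> s /be se; apply: B1; rewrite -ball_normE/=.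
    by rewrite (lt_le_trans se)// ge_min lexx.
  - move=> s /be se; apply: B2; rewrite -ball_normE/=.
    by rewrite (lt_le_trans se)// ge_min lexx orbT.
  - by apply/andP; split; lra.
  - by rewrite uw duw.
  - by apply/andP; split; lra.
by rewrite !row_mxKl.
Unshelve. all: by end_near. Qed.

End geodesic_flow.

(** * Extension of geodesics *)

Lemma chart_geodesic_at_near (R : realType) m (G : 'rV[R]_m -> 'M[R]_m)
    (u w : R -> 'rV[R]_m) (t : R) : (\forall s \near t, u s = w s) ->
  chart_geodesic_at G u t -> chart_geodesic_at G w t.
Proof.
move=> uw [d1 d2 E].
have uw1 : \forall s \near t, derive1 u s = derive1 w s.
  have := near_join uw; apply: filterS => s us.
  apply: etrans (derive1E _ _) _; apply: etrans _ (esym (derive1E _ _)).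
  exact: near_eq_derive us.
have uw2 : derive1 (derive1 u) t = derive1 (derive1 w) t.
  apply: etrans (derive1E _ _) _; apply: etrans _ (esym (derive1E _ _)).
  exact: near_eq_derive uw1.
split; [exact: near_eq_derivable uw d1|exact: near_eq_derivable uw1 d2|].
move=> k; rewrite -(nbhs_singleton uw) -(nbhs_singleton uw1) -uw2; exact: E.
Qed.

Lemma mulmx_unit_eq0 (R : realType) m (x : 'rV[R]_m) (B : 'M[R]_m) :
  B \in unitmx -> x *m B = 0 -> x = 0.
Proof. by move=> Bu xB; rewrite -[x](mulmxK Bu) xB mul0mx. Qed.

(** * Positive definite matrices *)

Section positive_definite.
Variables (R : realType) (m : nat) (G : 'M[R]_m).
Hypotheses (Gsym : G^T = G) (Gpos : forall v, v != 0 -> 0 < qform G v).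

Lemma posdef_unitmx : G \in unitmx.
Proof.
rewrite -row_free_unit -kermx_eq0; apply/negP => /negP/rowV0Pn[v /sub_kermxP vG v0].
by have := Gpos v0; rewrite /qform vG mul0mx mxE ltxx.
Qed.

(** Cauchy-Schwarz for the inner product [G], applied to [v] and to the vector [w] that represents
    the i-th coordinate. It turns unit speed into a bound on coordinate velocities. *)
Lemma qform_entry_le (v : 'rV[R]_m) i : v 0 i ^+ 2 <= qform G v * invmx G i i.
Proof.
have qge0 w : 0 <= qform G w.
  have [->|/Gpos/ltW//] := eqVneq w 0.
  by rewrite /qform !mul0mx mxE.
pose w : 'rV[R]_m := delta_mx 0 i *m invmx G.
have wG : w *m G = delta_mx 0 i by rewrite mulmxKV// posdef_unitmx.
have wv : (w *m G *m v^T) 0 0 = v 0 i.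
  by rewrite wG -rowE !mxE.
have vw : (v *m G *m w^T) 0 0 = v 0 i.
  by rewrite -wv -[w *m G *m v^T]trmxK [in RHS]mxE !trmx_mul trmxK Gsym mulmxA.
have ww : qform G w = invmx G i i.
  rewrite /qform wG -rowE /w trmx_mul trmx_inv Gsym trmx_delta.
  by rewrite -colE !mxE.
have w0 : w != 0.
  apply/eqP => w0; have := wG; rewrite w0 mul0mx => /(congr1 (fun x : 'rV_m => x 0 i)).
  by rewrite !mxE !eqxx => /esym/eqP; rewrite oner_eq0.
have k0 : 0 < invmx G i i by rewrite -ww Gpos.
(* This multiple of [w] minimizes the quadratic function [s |-> qform G (v - s w)]. *)
have := qge0 (v - (v 0 i / invmx G i i) *: w).
set s := _ / _.
have -> : qform G (v - s *: w) = qform G v - 2 * s * v 0 i + s ^+ 2 * invmx G i i.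
  have entB (B C : 'M[R]_1) : (B - s *: C) 0 0 = B 0 0 - s * C 0 0.
    by rewrite mxE [X in _ + X]mxE [X in - X]mxE.
  have Bl (x : 'rV[R]_m) : ((v - s *: w) *m G *m x^T) 0 0 =
      (v *m G *m x^T) 0 0 - s * (w *m G *m x^T) 0 0.
    by rewrite -entB !mulmxBl -!scalemxAl.
  have Br (x : 'rV[R]_m) : (x *m G *m (v - s *: w)^T) 0 0 =
      (x *m G *m v^T) 0 0 - s * (x *m G *m w^T) 0 0.
    by rewrite -entB linearB linearZ/= mulmxBr -scalemxAr.
  rewrite {1}/qform Bl !Br vw wv -/(qform G v) -/(qform G w) ww; ring.
have -> : qform G v - 2 * s * v 0 i + s ^+ 2 * invmx G i i =
    qform G v - v 0 i ^+ 2 / invmx G i i.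
  by rewrite /s; field; rewrite gt_eqF.
by rewrite subr_ge0 ler_pdivrMr.
Qed.

End positive_definite.

(** Let [s] be the infimum of the counterexamples. The first hypothesis gives [P s] and the second
    gives [P] slightly beyond [s], a contradiction. At [s = t1] the premise of the first hypothesis
    is empty, so it contains the base case. *)
Lemma real_induction (R : realType) (P : R -> Prop) (t1 b : R) :
  (forall s, t1 <= s < b -> (forall t, t1 <= t < s -> P t) -> P s) ->
  (forall s, t1 <= s < b -> (forall t, t1 <= t <= s -> P t) ->
     \forall t \near s, s <= t -> P t) ->
  forall t, t1 <= t < b -> P t.
Proof.
move=> Pcl Pop t tb; apply: contrapT => nPt.
pose E := [set s | t1 <= s < b /\ ~ P s].
have Et : E t by [].
have lbE : lbound E t1 by move=> s [/andP[]].
have hasE : has_inf E by split; [exists t|exists t1].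
pose s := inf E.
have s1 : t1 <= s by apply: lb_le_inf lbE; exists t.
have st : s <= t by apply: ge_inf => //; exists t1.
have sb : t1 <= s < b by rewrite s1 (le_lt_trans st)//; case/andP: tb.
have Plt r : t1 <= r < s -> P r.
  move=> /andP[r1 rs]; apply: contrapT => nPr.
  have : s <= r.
    apply: ge_inf; first by exists t1.
    by split => //; rewrite r1 (lt_trans rs)//; case/andP: sb.
  by rewrite leNgt rs.
have Ps := Pcl s sb Plt.
have Ple r : t1 <= r <= s -> P r.
  move=> /andP[r1]; rewrite le_eqVlt => /predU1P[->//|rs].
  by apply: Plt; rewrite r1.
have /nbhs_ballP[e /= e0 Be] := Pop s sb Ple.
have [r [/andP[r1 rb] nPr] rse] := inf_adherent e0 hasE.
apply: nPr; have [rs|sr] := ltP r s; first by apply: Plt; rewrite r1.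
by apply: Be => //; rewrite /ball/= distrC ger0_norm ?subr_ge0// ltrBlDl.
Qed.

(** A two-sided derivative is also a limit from the left. In the continuation argument below,
    agreement is known only up to the current time. *)
Lemma derive1_eq_left (R : realType) (W : normedModType R) (f g : R -> W) (s t1 : R) :
  t1 < s -> derivable f s 1 -> derivable g s 1 ->
  (forall t, t1 < t <= s -> f t = g t) -> derive1 f s = derive1 g s.
Proof.
move=> ts df dg fg.
have [_ e] := is_deriveB (derivableP df) (derivableP dg).
apply: etrans (derive1E f s) _; apply: etrans _ (esym (derive1E g s)).
apply/eqP; rewrite -subr_eq0 -e; apply/eqP.
have dh := derivableB df dg.
rewrite /derive (cvg_at_leftE _ _ dh); apply: cvg_lim; first exact: norm_hausdorff.
apply: cvg_near_cst; near=> h.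
have h0 : h < 0 by near: h; exact: nbhs_left_lt.
have hs : t1 - s < h by near: h; apply: nbhs_left_gt; rewrite subr_lt0.
have fg0 r : t1 < r <= s -> (f - g) r = 0.
  by move=> /fg; rewrite !fctE => ->; rewrite subrr.
rewrite /= [h *: 1]mulr1 !fg0 ?subrr ?scaler0// ?ts ?lexx//.
by rewrite -ltrBlDr hs/= gerDr ltW.
Unshelve. all: by end_near. Qed.

Lemma time_interval_near (R : realType) (a b : \bar R) t :
  time_interval a b t -> \forall s \near t, time_interval a b s.
Proof.
move=> /andP[at_ tb].
have n1 : \forall s \near t, (a < s%:E)%E.
  have [r ar rt] : exists2 r, (a <= r%:E)%E & r < t.
    case: a at_ => [r|//|]; first by exists r.
    by move=> _; exists (t - 1); rewrite ?leNye// ltrBlDr ltrDl.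
  have : \forall s \near t, r < s by apply: open_nbhs_nbhs; split; [exact: open_gt|].
  by apply: filterS => s rs; rewrite (le_lt_trans ar)// lte_fin.
have n2 : \forall s \near t, (s%:E < b)%E.
  have [r rb tr] : exists2 r, (r%:E <= b)%E & t < r.
    case: b tb => [r|_|//]; first by exists r.
    by exists (t + 1); rewrite ?leey// ltrDl.
  have : \forall s \near t, s < r by apply: open_nbhs_nbhs; split; [exact: open_lt|].
  by apply: filterS => s sr; rewrite (lt_le_trans _ rb)// lte_fin.
by apply: filterS2 n1 n2 => s s1 s2; rewrite /time_interval/= s1.
Qed.

Section manifold.
Variables (R : realType) (m : nat) (M : topologicalType) (D : set M) (I : Type)
  (at_ : I -> chart R m M) (g : I -> M -> 'M[R]_m).
Hypotheses (hM : hausdorff_space M) (chD : forall a, is_chart D (at_ a))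
  (cov : forall x, D x -> exists a, cdom (at_ a) x)
  (tr : forall a b,
    smooth_on [set u | cimg (at_ a) u /\ cdom (at_ b) (cinv (at_ a) u)]
              (cmap (at_ b) \o cinv (at_ a)))
  (rg : riemannian_metric at_ g).

Definition chart_metric a u := g a (cinv (at_ a) u).

Lemma chart_metric_C2 a : Ck_on 2 (cimg (at_ a)) (chart_metric a).
Proof. by have [_ /(_ a 2%N)] := rg. Qed.

Lemma chart_metric_posdef a u : cimg (at_ a) u ->
  (chart_metric a u)^T = chart_metric a u /\
  forall v, v != 0 -> 0 < qform (chart_metric a u) v.
Proof.
move=> au; have [_ _ _ /(_ u au)[du _] _] := chD a.
by have [/(_ a _ du)] := rg.
Qed.

Lemma chart_metric_unitmx a u : cimg (at_ a) u -> chart_metric a u \in unitmx.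
Proof. by move=> /chart_metric_posdef[? ?]; exact: posdef_unitmx. Qed.

Lemma chart_open_img a : open (cimg (at_ a)).
Proof. by have [] := chD a. Qed.

Lemma chart_cmapK a x : cdom (at_ a) x -> cinv (at_ a) (cmap (at_ a) x) = x.
Proof. by move=> ax; have [_ _ /(_ x ax)[]] := chD a. Qed.

Lemma chart_cmap_img a x : cdom (at_ a) x -> cimg (at_ a) (cmap (at_ a) x).
Proof. by move=> ax; have [_ _ /(_ x ax)[]] := chD a. Qed.

Lemma chart_cinvK a u : cimg (at_ a) u -> cmap (at_ a) (cinv (at_ a) u) = u.
Proof. by move=> au; have [_ _ _ /(_ u au)[]] := chD a. Qed.

Lemma chart_cinv_dom a u : cimg (at_ a) u -> cdom (at_ a) (cinv (at_ a) u).
Proof. by move=> au; have [_ _ _ /(_ u au)[]] := chD a. Qed.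

Lemma chart_continuous_cinv a u : cimg (at_ a) u -> {for u, continuous (cinv (at_ a))}.
Proof. by move=> au; have [_ _ _ _ [_]] := chD a; apply; rewrite inE. Qed.

Lemma chart_continuous_cmap a x : cdom (at_ a) x -> {for x, continuous (cmap (at_ a))}.
Proof. by move=> ax; have [_ _ _ _ [+ _]] := chD a; apply; rewrite inE. Qed.

Lemma chart_near a (c : R -> M) (t : R) : cdom (at_ a) (c t) ->
  {for t, continuous c} -> \forall s \near t, cdom (at_ a) (c s).
Proof.
move=> ct cc; apply: cc; apply: open_nbhs_nbhs; split => //.
by have [[]] := chD a.
Qed.

(** Combines [qform_entry_le] with a local bound on the diagonal of the inverse metric. *)
Lemma chart_velocity_bound a u0 : cimg (at_ a) u0 -> exists rho C,
  [/\ 0 < rho, 0 <= C & forall u v, `|u - u0| < rho ->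
     cimg (at_ a) u -> qform (chart_metric a u) v = 1 -> `|v| <= C].
Proof.
move=> au0; have oA := chart_open_img (a := a).
have H := @nblip_inv_metric R m _ _ u0 oA au0 (chart_metric_C2 a)
  (@chart_metric_unitmx a).
have /(@nblip_forall R _ u0 'I_m) {}H i := H i i.
have [r [Hr r0]] := filter_ex (filterI H (nbhs_right_gt 0)).
have /choice[C HC] : forall i, exists C, 0 <= C /\ forall x, `|x - u0| < r ->
    `|invmx (chart_metric a x) i i| <= C.
  by move=> i; have [C [C0 HC _]] := Hr i; exists C; split.
have C0 : 0 <= \sum_i C i by apply: sumr_ge0 => i _; case: (HC i).
(* With [S] the sum, the squared entries are at most [S], and [S <= (S + 1)^2]; this avoids a square
   root. *)
exists r, (\sum_i C i + 1); split => //; first by rewrite addr_ge0.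
move=> u v ur au qv; apply: mx_norm_leP => [|i j]; first by rewrite addr_ge0.
have [Gs Gp] := chart_metric_posdef au.
rewrite ord1 -ler_sqr ?nnegrE ?addr_ge0// real_normK ?num_real//.
apply: le_trans (qform_entry_le Gs Gp v j) _; rewrite qv mul1r.
have [Cj /(_ u ur)/(le_trans (ler_norm _)) Hj] := HC j.
apply: le_trans Hj _.
have CC : C j <= \sum_i C i.
  by rewrite (bigD1 j)//= lerDl; apply: sumr_ge0 => k _; case: (HC k).
apply: (le_trans CC); rewrite expr2 mulrDl mul1r mulrDr mulr1.
by move: (\sum_i C i) C0 => S S0; nra.
Qed.

(** In both charts the equation says that the Euler-Lagrange covector vanishes, and the two
    covectors differ by an invertible factor. *)
Lemma geodesic_any_chart a e (c : R -> M) (t : R) :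
  {for t, continuous c} -> cdom (at_ a) (c t) -> cdom (at_ e) (c t) ->
  (\forall s \near t, chart_geodesic_at (chart_metric a) (cmap (at_ a) \o c) s) ->
  chart_geodesic_at (chart_metric e) (cmap (at_ e) \o c) t.
Proof.
move=> cc act ect ga.
set u := cmap (at_ a) \o c in ga *; set phi := cmap (at_ e) \o cinv (at_ a).
set A := [set u | cimg (at_ a) u /\ cdom (at_ e) (cinv (at_ a) u)].
have oA : open A.
  rewrite openE => v [av ev]; apply: filterI.
    by apply: open_nbhs_nbhs; split => //; exact: chart_open_img.
  apply: (chart_continuous_cinv av); apply: open_nbhs_nbhs; split => //.
  by have [[]] := chD e.
have phiA : Ck_on 2 A phi by exact: tr.
have uA : A (u t) by split; [exact: chart_cmap_img|rewrite /u /= chart_cmapK].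
have GE v : A v -> chart_metric a v =
    jac phi v *m chart_metric e (phi v) *m (jac phi v)^T.
  move=> Av; have [av ev] := Av; have adv := chart_cinv_dom av.
  have [_ _ /(_ a e _ adv ev)] := rg.
  rewrite /chart_jacobian chart_cinvK// /chart_metric /phi /= chart_cmapK//.
  by rewrite -(jacobianE oA phiA Av).
have [d1 d2 eq] := nbhs_singleton ga.
have du : \forall s \near t, derivable u s 1 by apply: filterS ga => s [].
have eimg : cimg (at_ e) (phi (u t)) by apply: chart_cmap_img; case: uA.
have [Gs Gp] := chart_metric_posdef eimg.
have dG' : differentiable (chart_metric e) (phi (u t)).
  exact: C1_on_differentiable (chart_open_img (a := e))
    (Ck_on_le (leqnSn 1) (chart_metric_C2 e)) eimg.
have [w1 w2 EL] := EL_form_transition_curve oA phiA GE uA du d2 dG' Gs.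
have Gau := chart_metric_unitmx uA.1.
have Geu := chart_metric_unitmx eimg.
have [Gas _] := chart_metric_posdef uA.1.
have /(christoffel_EL _ _ Gau Gas) eq0 := eq.
have near_t : \forall s \near t, (phi \o u) s = (cmap (at_ e) \o c) s.
  have := chart_near act cc; apply: filterS => s acs.
  by rewrite /phi /u /= chart_cmapK.
apply: (chart_geodesic_at_near near_t); split; [exact: w1|exact: w2|].
apply/(christoffel_EL _ _ Geu Gs).
(* The Jacobian is a factor of the invertible matrix [chart_metric a (u t)]. *)
have JU : (jac phi (u t))^T \in unitmx.
  move: Gau; rewrite (GE _ uA) unitmx_mul => /andP[_].
  by [].
exact: (mulmx_unit_eq0 JU (etrans (esym EL) eq0)).
Qed.

(* The curve has a cluster point in [K] as [t] tends to [b0]; in a chart there,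
   geodesics of unit speed starting nearby exist for a uniform time [T], and
   the one started at a time [t1 > b0 - T] prolongs [c]. *)
Lemma geodesic_extension (a : \bar R) (b0 t0 : R) (c : R -> M) (K : set M) :
  time_interval a b0%:E t0 ->
  geodesic_on D at_ g a b0%:E c -> unit_speed_on at_ g a b0%:E c ->
  compact K -> K `<=` D -> (forall t, t0 <= t < b0 -> K (c t)) ->
  exists2 b1, b0 < b1 & exists2 c', geodesic_on D at_ g a b1%:E c' &
    forall t, time_interval a b0%:E t -> c' t = c t.
Proof.
move=> /andP[at0]; rewrite lte_fin => tb0 geo usp cK KD cKt.
have [z [Kz zcl]] : K `&` cluster (c @ b0^'-) !=set0.
  have FK : \forall t \near b0^'-, K (c t).
    near=> t; apply: cKt; apply/andP; split.
      by near: t; exact: nbhs_left_ge.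
    by near: t; exact: nbhs_left_lt.
  exact: cK _ FK.
have [e ez] := cov (KD _ Kz).
have e_img := chart_cmap_img ez; set u0 := cmap (at_ e) z in e_img.
have [rho1 rho10 flow] := geodesic_flow (chart_open_img (a := e))
  (chart_metric_C2 e) (@chart_metric_unitmx e) e_img.
have [rho2 [C [rho20 C0 vel]]] := chart_velocity_bound e_img.
have [T T0 {}flow] := flow C C0.
have inI t : t0 <= t < b0 -> time_interval a b0%:E t.
  move=> /andP[t0t tb]; rewrite /time_interval /= lte_fin tb andbT.
  by rewrite (lt_le_trans at0)// lee_fin.
pose N := [set x | cdom (at_ e) x /\ `|cmap (at_ e) x - u0| < Num.min rho1 rho2].
have Nz : nbhs z N.
  apply: filterI.
    by apply: open_nbhs_nbhs; split => //; have [[]] := chD e.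
  have := chart_continuous_cmap ez.
  move=> /(@cvgr_dist_lt _ _ _ _ _ (cmap (at_ e))) H.
  have : 0 < Num.min rho1 rho2 by rewrite lt_min rho10.
  by move=> /H; apply: filterS => x; rewrite distrC.
pose F := [set x | exists t, [/\ t0 <= t, t < b0, b0 - T < t & x = c t]].
have FF : \forall t \near b0^'-, F (c t).
  have bT0 : b0 - T < b0 by rewrite ltrBlDr ltrDl.
  near=> t.
  have h1 : t0 <= t by near: t; exact: nbhs_left_ge.
  have h2 : t < b0 by near: t; exact: nbhs_left_lt.
  have h3 : b0 - T < t by near: t; exact: nbhs_left_gt.
  by exists t.
(* Since [z] is a cluster point, at some time [t1] later than [b0 - T] the curve lies in the box
   where the flow lasts for a time [T]. *)
have [_ [[t1 [t01 t1b Tt1 ->]] [et1]]] := zcl _ _ FF Nz.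
rewrite lt_min => /andP[ut1 ut1'].
have t1I : time_interval a b0%:E t1 by apply: inI; rewrite t01.
have [_ _ /(_ e et1) g1] := geo t1 t1I.
have v1C : `|derive1 (cmap (at_ e) \o c) t1| <= C.
  apply: (vel (cmap (at_ e) (c t1))) => //; first exact: chart_cmap_img.
  rewrite /chart_metric chart_cmapK//.
  exact: usp.
have [u [ut1E dut1E uflow]] := flow t1 _ _ (ltW ut1) v1C.
pose d t := cinv (at_ e) (u t).
have dD t : `|t - t1| < T -> [/\ cdom (at_ e) (d t), cmap (at_ e) (d t) = u t
    & {for t, continuous d}].
  move=> /uflow[iu [du _ _]]; split.
  - exact: chart_cinv_dom.
  - exact: chart_cinvK.
  - apply: (@continuous_comp _ _ _ u (cinv (at_ e)) t).
      exact: derivable1_continuous du.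
    exact: chart_continuous_cinv.
have nearT t : `|t - t1| < T -> \forall s \near t, `|s - t1| < T.
  move=> tT; have cs : {for t, continuous (fun s : R => s - t1)}.
    by apply: cvgB; [exact: cvg_id|exact: cvg_cst].
  exact: (cvgr_norm_lt _ cs).
have absT t : t1 <= t < t1 + T -> `|t - t1| < T.
  by move=> /andP[? ?]; rewrite ger0_norm ?subr_ge0// ltrBlDl.
have bT t : t1 <= t < b0 -> `|t - t1| < T.
  move=> /andP[t1t tb]; apply: absT; rewrite t1t (lt_trans tb)//.
  by rewrite -ltrBlDr.
(* Agreement of [c] and [d] by continuous induction: it passes to limits because [M] is Hausdorff,
   and continues a little further by local uniqueness. *)
have cd : forall t, t1 <= t < b0 -> c t = d t.
  apply: real_induction => s sb cds.
    have [s1|s1] := eqVneq s t1.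
      by rewrite s1 /d ut1E chart_cmapK.
    have ts : t1 < s by rewrite lt_neqAle eq_sym s1; case/andP: sb.
    apply: hM => A B cA dB.
    have sI : time_interval a b0%:E s.
      by apply: inI; case/andP: sb => ? ->; rewrite andbT (le_trans t01).
    have [_ cc _] := geo s sI; have [_ _ dc] := dD s (bT s sb).
    have nA : \forall t \near s, A (c t) by exact: cc.
    have nB : \forall t \near s, B (d t) by exact: dc.
    have nAB : \forall t \near s^'-, A (c t) /\ B (d t).
      by apply: cvg_at_left_filter (filterI nA nB).
    near s^'- => t.
    have [At Bt] : A (c t) /\ B (d t) by near: t.
    have tt : t1 <= t by near: t; exact: nbhs_left_ge.
    have ts' : t < s by near: t; exact: nbhs_left_lt.
    by exists (c t); split => //; rewrite cds// tt.
  have sT := bT s sb; have [eds dus _] := dD s sT.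
  have sI : time_interval a b0%:E s.
    by apply: inI; case/andP: sb => ? ->; rewrite andbT (le_trans t01).
  have cs : c s = d s by apply: cds; rewrite lexx andbT; case/andP: sb.
  have ecs : cdom (at_ e) (c s) by rewrite cs.
  pose w := cmap (at_ e) \o c.
  have wu t : t1 <= t <= s -> w t = u t.
    move=> ts; rewrite /w /= (cds t ts).
    have tT : `|t - t1| < T.
      by apply: bT; case/andP: ts => -> ts /=; case/andP: sb => _; exact: le_lt_trans.
    by have [_ ->] := dD t tT.
  have [_ cc /(_ e ecs) gs] := geo s sI.
  have nI : \forall t \near s, time_interval a b0%:E t by exact: time_interval_near.
  have gw : \forall t \near s, chart_geodesic_at (chart_metric e) w t.
    apply: filterS2 nI (chart_near ecs cc) => t tI ect.
    have [_ _ gt] := geo t tI; exact: (gt e ect).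
  have gu : \forall t \near s, chart_geodesic_at (chart_metric e) u t.
    by apply: filterS (nearT s sT) => t /uflow[].
  (* At [t1] the velocities agree by construction of [u]; later because the curves agree to the left
     of [s]. *)
  have dwu : derive1 w s = derive1 u s.
    have [s1|s1] := eqVneq s t1; first by rewrite s1.
    have ts : t1 < s by rewrite lt_neqAle eq_sym s1; case/andP: sb.
    apply: (derive1_eq_left ts).
    - by have [d1 _ _] := gs; exact: d1.
    - by have [_ [d1 _ _]] := uflow s sT; exact: d1.
    - by move=> t /andP[/ltW tt1 tt]; apply: wu; rewrite tt1.
  have wus : w s = u s by apply: wu; rewrite lexx andbT; case/andP: sb.
  have := chart_geodesic_unique (chart_open_img (a := e)) (chart_metric_C2 e)
    (@chart_metric_unitmx e) (chart_cmap_img ecs) wus dwu gw gu.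
  move=> nwu; apply: filterS2 nwu (chart_near ecs cc) => t wut ect _.
  by rewrite /d -wut /w /= chart_cmapK.
exists (t1 + T); first by rewrite -ltrBlDr.
exists (fun t => if t < b0 then c t else d t); last first.
  by move=> t; rewrite /time_interval /= lte_fin => /andP[_ ->].
move=> t /andP[at_t tT]; rewrite lte_fin in tT.
have [tb|bt] := ltP t b0.
  have tI : time_interval a b0%:E t by rewrite /time_interval /= at_t lte_fin.
  have near_t : \forall s \near t, c s = if s < b0 then c s else d s.
    have : \forall s \near t, s < b0 by apply: open_nbhs_nbhs; split; [exact: open_lt|].
    by apply: filterS => s ->.
  have [Dct cc gt] := geo t tI.
  split; first exact: Dct.
    by apply: cvg_trans (near_eq_cvg near_t) _; rewrite tb; exact: cc.
  move=> e' e't; apply: chart_geodesic_at_near (gt e' e't).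
  by apply: filterS near_t => s /= <-.
have tT' : `|t - t1| < T by apply: absT; rewrite tT andbT (le_trans _ bt)// ltW.
(* Because [c] and [d] agree on [[t1, b0)], the glued curve coincides with [d] even around [b0]. *)
have near_t : \forall s \near t, d s = if s < b0 then c s else d s.
  have : \forall s \near t, t1 < s.
    apply: open_nbhs_nbhs; split; [exact: open_gt|].
    exact: lt_le_trans t1b bt.
  apply: filterS => s ts; case: ltP => // sb.
  by rewrite cd// sb ltW.
have [edt dtu cdt] := dD t tT'.
split.
- by have [[_ sub] _ _ _ _] := chD e; exact: sub.
- by apply: cvg_trans (near_eq_cvg near_t) _; rewrite ltNge bt; exact: cdt.
- move=> e' e't; apply: (@chart_geodesic_at_near _ _ _ (cmap (at_ e') \o d)).
    by apply: filterS near_t => s /= <-.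
  apply: (geodesic_any_chart (a := e)) => //.
  apply: filterS (nearT t tT') => s sT.
  have near_s : \forall r \near s, u r = (cmap (at_ e) \o d) r.
    by apply: filterS (nearT s sT) => r /dD[_ /= ->].
  by apply: (chart_geodesic_at_near near_s); have [] := uflow s sT.
Unshelve. all: by end_near. Qed.

End manifold.

(** * Charts of the cylinder *)

Lemma hausdorff_prod (X Y : topologicalType) :
  hausdorff_space X -> hausdorff_space Y -> hausdorff_space (X * Y)%type.
Proof.
move=> hX hY [x1 y1] [x2 y2] cl; congr (_, _).
  apply: hX => A B Ax Bx.
  have nA : nbhs (x1, y1) (A `*` setT).
    by exists (A, setT) => //; split => //; exact: filterT.
  have nB : nbhs (x2, y2) (B `*` setT).
    by exists (B, setT) => //; split => //; exact: filterT.
  by have [[x y] [[/= ? _] [/= ? _]]] := cl _ _ nA nB; exists x.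
apply: hY => A B Ay By.
have nA : nbhs (x1, y1) (setT `*` A).
  by exists (setT, A) => //; split => //; exact: filterT.
have nB : nbhs (x2, y2) (setT `*` B).
  by exists (setT, B) => //; split => //; exact: filterT.
by have [[x y] [[/= _ ?] [/= _ ?]]] := cl _ _ nA nB; exists y.
Qed.

Lemma cvg_mx_entries (R : realType) (T : Type) (F : set_system T) {FF : Filter F}
    p q (M : T -> 'M[R]_(p, q)) (L : 'M[R]_(p, q)) :
  (forall i j, M x i j @[x --> F] --> L i j) -> M @ F --> L.
Proof.
move=> ML; apply/cvgrPdist_lt => e e0.
have H : \forall x \near F, forall ij : 'I_p * 'I_q, is_true (`|L ij.1 ij.2 - M x ij.1 ij.2| < e).
  apply: (@filter_forall _ _
    (fun ij x => is_true (`|L ij.1 ij.2 - M x ij.1 ij.2| < e)) _ FF) => -[i j].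
  by have /cvgrPdist_lt := ML i j; apply.
apply: filterS H => x H; apply: mx_norm_ltP => // i j.
by rewrite !mxE; exact: (H (i, j)).
Qed.

Section derive_linear.
Variables (R : realType) (V W U : normedModType R) (L : {linear V -> W}) (f : W -> U).

Lemma derivable_comp_linear v d : derivable f (L v) (L d) -> derivable (f \o L) v d.
Proof.
rewrite /derivable.
suff -> : (fun h : R => h^-1 *: ((f \o shift (L v)) (h *: L d) - f (L v))) =
  (fun h => h^-1 *: (((f \o L) \o shift v) (h *: d) - (f \o L) v)) by [].
by apply/funext => h; rewrite /= linearP.
Qed.

Lemma derive_comp_linear v d : 'D_d (f \o L) v = 'D_(L d) f (L v).
Proof.
rewrite /derive.
have -> : (fun h : R => h^-1 *: (((f \o L) \o shift v) (h *: d) - (f \o L) v)) =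
  (fun h : R => h^-1 *: ((f \o shift (L v)) (h *: L d) - f (L v))).
  by apply/funext => h; rewrite /= linearP.
by [].
Qed.

End derive_linear.

Lemma Ck_on_cst (R : realType) m (W : normedModType R) k (A : set 'rV[R]_m) (a : W) :
  Ck_on k A (fun=> a).
Proof.
have c w : {in A, continuous (fun _ : 'rV[R]_m => w : W)}.
  by move=> x _; exact: cst_continuous.
elim: k a => [|k IH] a; split=> //; try exact: c.
move=> i; split; first by move=> u _; exact: (derivable_cst a u (delta_mx 0 i)).
have -> : (fun u : 'rV[R]_m => 'D_(delta_mx 0 i) (fun=> a) u) = fun=> 0.
  by apply/funext => u; exact: (derive_cst a u).
exact: IH.
Qed.

(** Transition maps of the cylinder are the case [s = 1], [t = 0]. General [s] and [t] make the
    family stable under partial derivatives, so that the induction on [k] applies. *)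
Lemma Ck_on_row_mx (R : realType) n k (A : set 'rV[R]_(1 + n)) (B : set 'rV[R]_n)
    (psi : 'rV[R]_n -> 'rV[R]_n) (s t : R) :
  open A -> (forall v, A v -> B (rsubmx v)) -> Ck_on k B psi ->
  Ck_on k A (fun v => row_mx (s * lsubmx v 0 0 + t)%:M (psi (rsubmx v))).
Proof.
move=> oA AB.
have cont (s1 t1 : R) (p1 : 'rV[R]_n -> 'rV[R]_n) : {in B, continuous p1} ->
    {in A, continuous (fun v : 'rV[R]_(1 + n) =>
       row_mx (s1 * lsubmx v 0 0 + t1)%:M (p1 (rsubmx v)))}.
  move=> pc v; rewrite inE => Av.
  apply: (@cvg_mx_entries _ _ (nbhs v)) => i j; rewrite ord1 {i}.
  case: (split_ordP j) => j' ->.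
    have E (w : 'rV[R]_(1 + n)) :
        row_mx (s1 * lsubmx w 0 0 + t1)%:M (p1 (rsubmx w)) 0 (lshift n j') =
        s1 * w 0 (lshift n 0) + t1 by rewrite row_mxEl ord1 !mxE mulr1n.
    rewrite E (funext E); apply: cvgD; last exact: cvg_cst.
    by apply: cvgM; [exact: cvg_cst|exact: coord_continuous].
  have E (w : 'rV[R]_(1 + n)) :
        row_mx (s1 * lsubmx w 0 0 + t1)%:M (p1 (rsubmx w)) 0 (rshift 1 j') =
      p1 (rsubmx w) 0 j' by rewrite row_mxEr.
  rewrite E (funext E).
  have c1 : {for v, continuous (p1 \o rsubmx)}.
    apply: continuous_comp; first exact: continuous_rsubmx.
    by apply: pc; rewrite inE; exact: AB.
  exact: (@continuous_comp _ _ _ _ (fun N : 'rV[R]_n => N 0 j') v c1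
    (@coord_continuous R 1 n 0 j' _)).
elim: k psi s t => [|k IH] psi s t; first by move=> [pc _]; split => //; exact: cont.
move=> [pc pd]; split; first exact: cont.
move=> i.
pose li : R := lsubmx (delta_mx 0 i : 'rV[R]_(1 + n)) 0 0.
pose ri : 'rV[R]_n := rsubmx (delta_mx 0 i : 'rV[R]_(1 + n)).
have pri v : A v -> derivable psi (rsubmx v) ri.
  move=> Av; rewrite /ri; case: (split_ordP i) => j ->.
    have -> : rsubmx (delta_mx 0 (lshift n j) : 'rV[R]_(1 + n)) = 0.
      by apply/rowP => l; rewrite !mxE eq_rlshift andbF.
    exact: derivable0.
  have -> : rsubmx (delta_mx 0 (rshift 1 j) : 'rV[R]_(1 + n)) = delta_mx 0 j.
    by apply/rowP => l; rewrite !mxE eq_rshift.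
  by have [+ _] := pd j; apply; exact: AB.
have D v : A v -> is_derive v (delta_mx 0 i)
   (fun v => row_mx (s * lsubmx v 0 0 + t)%:M (psi (rsubmx v)))
   (row_mx (s * li)%:M ('D_ri psi (rsubmx v))).
  move=> Av; apply/is_derive_mxP => i' j; rewrite ord1 {i'}.
  case: (split_ordP j) => j' ->.
    have -> : (fun y : 'rV[R]_(1 + n) =>
        row_mx (s * lsubmx y 0 0 + t)%:M (psi (rsubmx y)) 0 (lshift n j')) =
      (fun y => s * y 0 (lshift n 0) + t).
      by apply/funext => y; rewrite row_mxEl ord1 !mxE mulr1n.
    rewrite row_mxEl ord1 !mxE mulr1n.
    pose c (x : 'rV[R]_(1 + n)) := x 0 (lshift n 0).
    have d1 : is_derive v (delta_mx 0 i) c (c (delta_mx 0 i)).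
      have dc : differentiable c v by exact: differentiable_coord.
      apply: DeriveDef; first exact: diff_derivable.
      apply/cvg_lim; first exact: norm_hausdorff.
      apply: cvg_near_cst; near=> h0.
      rewrite /c /= !mxE addrK /GRing.scale/= mulrA mulVf ?mul1r//.
      by near: h0; exact: nbhs_dnbhs_neq.
    have d2 := @is_deriveM R _ (fun=> s) c v (delta_mx 0 i) _ _
      (is_derive_cst s v (delta_mx 0 i)) d1.
    have d3 := is_deriveD d2 (is_derive_cst t v (delta_mx 0 i)).
    apply: (is_derive_eq d3).
    by rewrite /c /li !mxE /GRing.scale/= mulr0 !addr0.
  have -> : (fun y : 'rV[R]_(1 + n) =>
      row_mx (s * lsubmx y 0 0 + t)%:M (psi (rsubmx y)) 0 (rshift 1 j')) =
    (fun y => (psi \o rsubmx) y 0 j').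
    by apply/funext => y; rewrite row_mxEr.
  rewrite row_mxEr.
  have d1 : is_derive v (delta_mx 0 i) (psi \o rsubmx) ('D_ri psi (rsubmx v)).
    apply: DeriveDef; first exact: derivable_comp_linear (pri v Av).
    exact: derive_comp_linear.
  by have /is_derive_mxP := d1; apply.
split; first by move=> u /D[].
have {}D : {in A, (fun v => row_mx (s * li)%:M ('D_ri psi (rsubmx v))) =1
   (fun u => 'D_(delta_mx 0 i) (fun v => row_mx (s * lsubmx v 0 0 + t)%:M (psi (rsubmx v))) u)}.
  by move=> v; rewrite inE => /D[_ <-].
apply: (Ck_on_eq oA D).
(* A derivative in the radial direction is constant; one along a coordinate of [Y] is again of the
   given form, with [s = t = 0]. *)
rewrite /li /ri; case: (split_ordP i) => j ->.
  have -> : rsubmx (delta_mx 0 (lshift n j) : 'rV[R]_(1 + n)) = 0.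
    by apply/rowP => l; rewrite !mxE eq_rlshift andbF.
  apply: (Ck_on_eq oA _ (Ck_on_cst k A
    (row_mx (s * lsubmx (delta_mx 0 (lshift n j) : 'rV[R]_(1 + n)) 0 0)%:M 0))) => v _.
  by rewrite derive0.
have -> : rsubmx (delta_mx 0 (rshift 1 j) : 'rV[R]_(1 + n)) = delta_mx 0 j.
  by apply/rowP => l; rewrite !mxE eq_rshift.
have [_ pj] := pd j.
have := IH _ 0 0 pj; apply: Ck_on_eq => // v _.
by congr (row_mx _%:M _); rewrite !mxE eq_lrshift andbF mulr0 mul0r addr0.
Unshelve. all: by end_near. Qed.

Section cylinder.
Variables (R : realType) (n : nat) (Y : topologicalType) (I : Type)
  (atY : I -> chart R n Y) (r0 : R).
Hypothesis mY : smooth_manifold [set: Y] atY.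

Lemma cylinder_is_chart a : is_chart (@cylinder R Y r0) (cylinder_atlas atY r0 a).
Proof.
have [_ _ /(_ a)[[od _] oi cm ci [cc cci]] _ _] := mY.
have open0r : open [set` `]0, r0[%R] by exact: interval_open.
split => /=.
- split; last by move=> [r y] [].
  rewrite openE => -[r y] [/= r0r ay]; exists (`]0, r0[%classic, cdom (atY a)) => //.
  by split => /=; apply: open_nbhs_nbhs; split.
- rewrite openE => v [v0 av]; apply: filterI.
    have cl : {for v, continuous (fun v : 'rV[R]_(1 + n) => lsubmx v 0 0)}.
      exact: (@continuous_comp _ _ _ lsubmx (fun N : 'rV[R]_1 => N 0 0) v
        (@continuous_lsubmx _ _ _ _ _) (@coord_continuous R 1 1 0 0 _)).
    have N : \forall w \near v, [set` `]0, r0[%R] (lsubmx w 0 0).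
      by apply: cl; apply: open_nbhs_nbhs; split => //=; rewrite in_itv.
    by apply: filterS N => w /=; rewrite in_itv.
  by apply: continuous_rsubmx; apply: open_nbhs_nbhs; split.
- move=> [r y] [/= rr ay]; have [h1 h2] := cm y ay.
  by rewrite row_mxKl row_mxKr h2 mxE mulr1n.
- move=> v [v0 av]; have [h1 h2] := ci _ av; split; first by split => //=; rewrite in_itv.
  rewrite h2 -[RHS]hsubmxK; congr row_mx.
  by apply/matrixP => i j; rewrite !ord1 !mxE mulr1n.
- split.
    move=> [r y]; rewrite inE => -[/= rr ay].
    apply: (@cvg_mx_entries _ _ (nbhs (r, y))) => i j.
    rewrite ord1; case: (split_ordP j) => j' ->.
      have E (w : R * Y) : row_mx w.1%:M (cmap (atY a) w.2) 0 (lshift n j') = w.1.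
        by rewrite row_mxEl ord1 mxE mulr1n.
      by rewrite (funext E) E; exact: cvg_fst.
    have E (w : R * Y) : row_mx w.1%:M (cmap (atY a) w.2) 0 (rshift 1 j') = cmap (atY a) w.2 0 j'.
      by rewrite row_mxEr.
    rewrite (funext E) E.
    have c1 : {for (r, y), continuous (cmap (atY a) \o snd)}.
      apply: continuous_comp; first exact: cvg_snd.
      by apply: cc; rewrite inE.
    exact: (@continuous_comp _ _ _ _ (fun N : 'rV[R]_n => N 0 j') (r, y) c1
      (@coord_continuous R 1 n 0 j' _)).
  move=> v; rewrite inE => -[v0 av].
  have c1 : {for v, continuous (fun w : 'rV[R]_(1 + n) => lsubmx w 0 0)}.
    exact: (@continuous_comp _ _ _ lsubmx (fun N : 'rV[R]_1 => N 0 0) v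
        (@continuous_lsubmx _ _ _ _ _) (@coord_continuous R 1 1 0 0 _)).
  have c2 : {for v, continuous (cinv (atY a) \o rsubmx)}.
    apply: continuous_comp; first exact: continuous_rsubmx.
    by apply: cci; rewrite inE.
  exact: (cvg_pair c1 c2).
Qed.

Lemma cylinder_cover x : @cylinder R Y r0 x ->
  exists a, cdom (cylinder_atlas atY r0 a) x.
Proof.
move=> [x1 _]; have [_ _ _ /(_ x.2 Logic.I)[a ax] _] := mY.
by exists a; split.
Qed.

Lemma cylinder_transition a b :
  smooth_on [set u | cimg (cylinder_atlas atY r0 a) u /\
      cdom (cylinder_atlas atY r0 b) (cinv (cylinder_atlas atY r0 a) u)]
    (cmap (cylinder_atlas atY r0 b) \o cinv (cylinder_atlas atY r0 a)).
Proof.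
move=> k; set A := [set u | _].
have [_ _ chY _ /(_ a b k) psiC] := mY.
have oA : open A.
  have [_ oi _ _ [_ ci]] := cylinder_is_chart a.
  have [[od _] _ _ _ _] := cylinder_is_chart b.
  rewrite openE => v [av bv]; apply: filterI; first by apply: open_nbhs_nbhs; split.
  by apply: (ci v); rewrite ?inE//; apply: open_nbhs_nbhs; split.
set B := [set u | _] in psiC.
have AB v : A v -> B (rsubmx v) by move=> [[_ av] [_ bv]]; split.
have H := Ck_on_row_mx 1 0 oA AB psiC.
by apply: (Ck_on_eq oA _ H) => v _ /=; rewrite mul1r addr0.
Qed.

End cylinder.

(** * Convex profiles and one-dimensional comparison *)

(** This rule and the next ones are real-valued variants with ordinary products and lambda terms, so
    that [ring] can identify the derivatives. *)
Lemma is_derive_mulf (R : realType) (f g : R -> R) (t df dg : R) :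
  is_derive t 1 f df -> is_derive t 1 g dg ->
  is_derive t 1 (fun s => f s * g s) (df * g t + f t * dg).
Proof.
move=> d1 d2; apply: (is_derive_eq (is_deriveM d1 d2)).
by rewrite /GRing.scale/= addrC [df * _]mulrC.
Qed.

Lemma is_derive_subf (R : realType) (f g : R -> R) (t df dg : R) :
  is_derive t 1 f df -> is_derive t 1 g dg ->
  is_derive t 1 (fun s => f s - g s) (df - dg).
Proof. by move=> d1 d2; exact: is_deriveB. Qed.

Lemma is_derive_cstf (R : realType) (a t : R) : is_derive t 1 (fun=> a) (0 : R).
Proof. exact: is_derive_cst. Qed.

Lemma is_derive_idf (R : realType) (t : R) : is_derive t 1 (fun s => s) (1 : R).
Proof. exact: is_derive_id. Qed.

Section interior_derivative.
Variables (R : realType) (W : normedModType R) (A : set R) (F dF : R -> W) (r : R).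

Lemma C1_is_derive : nbhs r A -> C1_with_derivative A F dF -> is_derive r 1 F (dF r).
Proof.
move=> Ar [_ /(_ r (nbhs_singleton Ar)) H].
have C : h^-1 *: (F (h *: 1 + r) - F r) @[h --> 0^'] --> dF r.
  apply/cvgrPdist_lt => e e0.
  have /cvgrPdist_lt/(_ _ e0) := H.
  rewrite near_withinE => /nbhs_ballP[d1 /= d10 B1].
  have /nbhs_ballP[d2 /= d20 B2] := Ar.
  near=> h.
  have h0 : h != 0 by near: h; exact: nbhs_dnbhs_neq.
  have hd1 : `|h| < d1 by near: h; exact: dnbhs0_lt.
  have hd2 : `|h| < d2 by near: h; exact: dnbhs0_lt.
  have := B1 (h + r); rewrite addrK [h *: 1]mulr1; apply.
    by rewrite /ball/= opprD addrCA subrr addr0 normrN.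
  split; first by apply: B2; rewrite /ball/= opprD addrCA subrr addr0 normrN.
  by move=> /eqP; rewrite -subr_eq0 addrK; exact/negP.
apply: DeriveDef; first by apply/cvg_ex; exists (dF r).
by apply: cvg_lim C; exact: norm_hausdorff.
Unshelve. all: by end_near. Qed.

End interior_derivative.

Section convex_profile.
Variables (R : realType) (r0 : R) (f : R -> R).
Hypotheses (cf : convex_function (`[0, r0[%classic : set R^o) f).

Lemma convex_chord x y t : 0 <= x < r0 -> 0 <= y < r0 -> 0 <= t <= 1 ->
  f (t * x + (1 - t) * y) <= t * f x + (1 - t) * f y.
Proof.
move=> xr yr /andP[t0 t1].
have H := cf (Itv01 t0 t1); apply: (H x y); rewrite inE /= in_itv/=.
  exact: xr.
exact: yr.
Qed.

(** Slopes of adjacent chords increase, stated without denominators. The weight [t] in the proof is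
    the one for which [z = t x + (1 - t) y]. *)
Lemma convex_slope x z y : 0 <= x -> x < z -> z < y -> y < r0 ->
  (f z - f x) * (y - z) <= (f y - f z) * (z - x).
Proof.
move=> x0 xz zy yr.
have yx : 0 < y - x by rewrite subr_gt0 (lt_trans xz).
pose t := (y - z) / (y - x).
have t01 : 0 <= t <= 1.
  apply/andP; split; first by rewrite divr_ge0// ltW// subr_gt0.
  by rewrite ler_pdivrMr// mul1r lerD2l lerN2 ltW.
have := @convex_chord x y t; rewrite x0 yr (lt_trans xz (lt_trans zy yr)).
have y0 : 0 <= y by rewrite (le_trans x0)// ltW// (lt_trans xz).
rewrite y0 => /(_ isT isT t01).
have tE : t * (y - x) = y - z by rewrite /t mulfVK// gt_eqF.
have -> : t * x + (1 - t) * y = z.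
  have -> : t * x + (1 - t) * y = y - t * (y - x) by ring.
  by rewrite tE subKr.
move=> fz.
have : f z * (y - x) <= (t * f x + (1 - t) * f y) * (y - x) by rewrite ler_pM2r.
have -> : (t * f x + (1 - t) * f y) * (y - x) =
  (t * (y - x)) * f x + (y - x - t * (y - x)) * f y by ring.
rewrite tE; nra.
Qed.

Lemma derive_ge_slope (z d k : R) : is_derive z 1 f d ->
  (\forall y \near z^'+, k * (y - z) <= f y - f z) -> k <= d.
Proof.
move=> [df dE] H; rewrite leNgt; apply/negP => dk.
have C : h^-1 *: (f (h *: 1 + z) - f z) @[h --> 0^'] --> d by rewrite -dE; exact: df.
have kd : 0 < k - d by rewrite subr_gt0.
have /cvgrPdist_lt/(_ _ kd)/nbhs_ballP[e1 /= e10 B1] := C.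
move: H; rewrite /at_right near_withinE => /nbhs_ballP[e2 /= e20 B2].
pose h := Num.min e1 e2 / 2.
have m0 : 0 < Num.min e1 e2 by rewrite lt_min e10.
have h0 : 0 < h by rewrite divr_gt0.
have hm : h < Num.min e1 e2 by rewrite /h ltr_pdivrMr// ltr_pMr// ltr1n.
have := B1 h; rewrite /ball/= sub0r normrN gtr0_norm//.
have he1 : h < e1 by rewrite (lt_le_trans hm)// ge_min lexx.
have he2 : h < e2 by rewrite (lt_le_trans hm)// ge_min lexx orbT.
move=> /(_ he1 (lt0r_neq0 h0)).
have := B2 (h + z); rewrite /ball/= opprD addrCA subrr addr0 normrN gtr0_norm//.
rewrite ltrDr h0 addrK => /(_ he2 isT).
rewrite [h *: 1]mulr1 /GRing.scale/= => H1 H2.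
have : k <= h^-1 * (f (h + z) - f z) by rewrite ler_pdivlMl// mulrC.
by move: H2; rewrite ltr_norml => /andP[? ?] ?; lra.
Qed.

(** By convexity the difference quotients to the right of [z] do not exceed the slope of the chord
    to [y], hence neither does their limit. *)
Lemma derive_le_slope (z y d : R) : 0 <= z -> z < y -> y < r0 ->
  is_derive z 1 f d -> d * (y - z) <= f y - f z.
Proof.
move=> z0 zy yr dfz; rewrite -ler_pdivlMr ?subr_gt0//.
have zy0 : 0 < y - z by rewrite subr_gt0.
rewrite leNgt; apply/negP => dk.
have C : h^-1 *: (f (h *: 1 + z) - f z) @[h --> 0^'] --> d.
  by case: dfz => df <-; exact: df.
have kd : 0 < d - (f y - f z) / (y - z) by rewrite subr_gt0.
have /cvgrPdist_lt/(_ _ kd)/nbhs_ballP[e1 /= e10 B1] := C.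
pose h := Num.min e1 (y - z) / 2.
have m0 : 0 < Num.min e1 (y - z) by rewrite lt_min e10.
have h0 : 0 < h by rewrite divr_gt0.
have hm : h < Num.min e1 (y - z) by rewrite /h ltr_pdivrMr// ltr_pMr// ltr1n.
have he1 : h < e1 by rewrite (lt_le_trans hm)// ge_min lexx.
have he2 : h < y - z by rewrite (lt_le_trans hm)// ge_min lexx orbT.
have := B1 h; rewrite /ball/= sub0r normrN gtr0_norm//.
move=> /(_ he1 (lt0r_neq0 h0)); rewrite [h *: 1]mulr1 /GRing.scale/= => H2.
have zh : z < h + z by rewrite ltrDr.
have hy : h + z < y by rewrite -ltrBrDr.
have S := convex_slope z0 zh hy yr.
have : h^-1 * (f (h + z) - f z) <= (f y - f z) / (y - z).
  rewrite ler_pdivlMr// -mulrA ler_pdivrMl//.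
  move: S; rewrite addrK; nra.
by move: H2; rewrite ltr_norml => /andP[? ?] ?; lra.
Qed.

(** Both derivatives are compared with the slope of the chord from [z] to [y]. *)
Lemma convex_derive_le (z y d e : R) : 0 <= z -> z < y -> y < r0 ->
  is_derive z 1 f d -> is_derive y 1 f e -> d <= e.
Proof.
move=> z0 zy yr dz dy.
have zy0 : 0 < y - z by rewrite subr_gt0.
apply: (@derive_ge_slope y) => //; near=> w.
have yw : y < w by near: w; exact: nbhs_right_gt.
have wr : w < r0 by near: w; exact: nbhs_right_lt.
have H1 := derive_le_slope z0 zy yr dz.
have H2 := convex_slope z0 zy yw wr.
have wy0 : 0 < w - y by rewrite subr_gt0.
rewrite -(ler_pM2r zy0); apply: le_trans H2.
by rewrite mulrAC ler_pM2r.
Unshelve. all: by end_near. Qed.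

(** The chord from the origin to [z] has slope [f z / z], and the chords starting to the right from
    [z] are at least as steep. *)
Lemma convex_derive_ge_ratio (z d : R) : f 0 = 0 -> 0 < z -> z < r0 ->
  is_derive z 1 f d -> f z <= z * d.
Proof.
move=> f0 z0 zr dz; rewrite mulrC -ler_pdivrMr//.
apply: (@derive_ge_slope z) => //; near=> w.
have zw : z < w by near: w; exact: nbhs_right_gt.
have wr : w < r0 by near: w; exact: nbhs_right_lt.
have := convex_slope (lexx 0) z0 zw wr; rewrite f0 !subr0.
by rewrite mulrAC ler_pdivrMr.
Unshelve. all: by end_near. Qed.

Lemma convex_increasing z y : f 0 = 0 -> 0 < z -> z < y -> y < r0 -> 0 < f z ->
  f z < f y.
Proof.
move=> f0 z0 zy yr fz.
have := convex_slope (lexx 0) z0 zy yr; rewrite f0 !subr0 => S.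
rewrite -subr_gt0 -(pmulr_lgt0 _ z0); apply: lt_le_trans S.
by rewrite mulr_gt0// subr_gt0.
Qed.

End convex_profile.

(** * Radial bounds after the lowest point *)

Section radial_estimates.
Variables (R : realType) (r0 c d : R) (r r1 r2 : R -> R) (T : R).
Hypotheses (c0 : 0 <= c) (rc : r0 * c < 1) (d0 : 0 < d) (T0 : 0 <= T).
Hypotheses (dr : forall t, 0 <= t <= T -> is_derive t 1 r (r1 t))
  (dr1 : forall t, 0 <= t <= T -> is_derive t 1 r1 (r2 t))
  (rI : forall t, 0 <= t <= T -> 0 < r t < r0)
  (r_0 : r 0 = d) (r1_0 : r1 0 = 0)
  (r1_le : forall t, 0 <= t <= T -> r1 t ^+ 2 <= 1)
  (r2_ge : forall t, 0 <= t <= T -> (1 - c * r t) * (1 - r1 t ^+ 2) <= r t * r2 t).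

Let k := 1 - r0 * c.

Let k0 : 0 < k. Proof. by rewrite subr_gt0. Qed.

Let k_le t : 0 <= t <= T -> k <= 1 - c * r t.
Proof.
move=> /rI/andP[rt rr]; rewrite /k lerD2l lerN2 mulrC.
by rewrite ler_wpM2r// ltW.
Qed.

Let w_ge0 t : 0 <= t <= T -> 0 <= 1 - r1 t ^+ 2.
Proof. by move=> /r1_le; rewrite subr_ge0. Qed.

Let r2_ge0 t : 0 <= t <= T -> 0 <= r2 t.
Proof.
move=> tT; have /andP[rt _] := rI tT.
rewrite -(pmulr_rge0 _ rt); apply: le_trans (r2_ge tT).
by rewrite mulr_ge0 ?w_ge0// (le_trans (ltW k0))// k_le.
Qed.

Let sub_itv s t : 0 <= s <= t -> 0 <= t <= T -> 0 <= s <= T.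
Proof. by move=> /andP[-> st] /andP[_]; exact: le_trans. Qed.

(** The hypothesis [r2_ge] makes [r''] nonnegative because [1 - c r >= k > 0], which rests on
    [rc]. *)
Lemma radial_velocity_ge0 t : 0 <= t <= T -> 0 <= r1 t.
Proof.
move=> tT; have /andP[t0 _] := tT; rewrite -r1_0.
apply: (derive_ge0_le t0) => s st; [exact/dr1/(sub_itv st)|exact/r2_ge0/(sub_itv st)].
Qed.

Lemma radial_upper t : 0 <= t <= T -> r t <= d + t.
Proof.
move=> tT; have /andP[t0 _] := tT.
suff H : 0 - r 0 <= t - r t by move: H; rewrite r_0; lra.
apply: (@derive_ge0_le R (fun s => s - r s) (fun s => 1 - r1 s) 0 t t0) => s st.
  by apply: is_derive_subf; apply: dr; exact: sub_itv st tT.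
have sT := sub_itv st tT; have := r1_le sT; have := radial_velocity_ge0 sT.
rewrite subr_ge0; nra.
Qed.

(** The derivative of [r r'] is [r'^2 + r r''], at least [r'^2 + k (1 - r'^2)], hence at least [k]
    because [k <= 1]. *)
Let rr1_ge t : 0 <= t <= T -> k * t <= r t * r1 t.
Proof.
move=> tT; have /andP[t0 _] := tT.
have := @derive_ge0_le R (fun s => r s * r1 s - k * s)
  (fun s => (r s * r2 s + r1 s * r1 s) - k) 0 t t0.
rewrite r1_0 !mulr0 subrr subr_ge0; apply => s st; have sT := sub_itv st tT.
  apply: is_derive_subf; last exact: is_derive_mull.
  by apply: (is_derive_eq (is_derive_mulf (dr sT) (dr1 sT))); ring.
have H1 := r2_ge sT; have H2 := k_le sT; have H3 := w_ge0 sT.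
have H4 := ler_wpM2r H3 H2.
have k1 : k <= 1 by rewrite /k gerBl mulr_ge0// ltW//; have /andP[a b] := rI sT; exact: lt_trans b.
have H5 : k * r1 s ^+ 2 <= r1 s ^+ 2 by rewrite ler_piMl ?sqr_ge0.
rewrite -expr2 subr_ge0; nra.
Qed.

Lemma radial_sqr_lower t : 0 <= t <= T -> k * t ^+ 2 <= r t ^+ 2.
Proof.
move=> tT; have /andP[t0 _] := tT.
have H := @derive_ge0_le R (fun s => r s * r s - k * (s * s))
  (fun s => (r s * r1 s + r s * r1 s) - k * (s * 1 + s * 1)) 0 t t0.
apply: (@le_trans _ _ (r t ^+ 2 - d ^+ 2)); last by rewrite gerBl sqr_ge0.
rewrite lerBrDr -lerBrDl !expr2 -r_0.
have -> : r 0 * r 0 = r 0 * r 0 - k * (0 * 0) by rewrite !mulr0 subr0.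
apply: H => s st; have sT := sub_itv st tT.
  have ds := is_derive_idf s.
  have dk := is_derive_mulf (is_derive_cstf k s) (is_derive_mulf ds ds).
  by apply: (is_derive_eq (is_derive_subf (is_derive_mulf (dr sT) (dr sT)) dk)); ring.
have := rr1_ge sT; rewrite mulr1 mulrDr; lra.
Qed.

(* The logarithmic derivative of [r (1 - c r)] is at most [r' (1/r - c)], which
   [r2_ge] compensates. *)
Lemma radial_transversal_decay t : 0 <= t <= T ->
  (r t * (1 - c * r t)) ^+ 2 * (1 - r1 t ^+ 2) <= d ^+ 2.
Proof.
move=> tT; have /andP[t0 _] := tT.
pose q s := r s * (1 - c * r s).
pose dq s := r1 s * (1 - 2 * c * r s).
have H := @derive_ge0_le R (fun s => - (q s * q s * (1 - r1 s * r1 s)))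
  (fun s => - (q s * q s * - (2 * r1 s * r2 s) + (1 - r1 s * r1 s) * (2 * q s * dq s))) 0 t t0.
have E : - (q 0 * q 0 * (1 - r1 0 * r1 0)) <= - (q t * q t * (1 - r1 t * r1 t)).
  apply: H => s st; have sT := sub_itv st tT.
    apply: is_deriveN.
    have d1 := dr sT; have d2 := dr1 sT.
    have dcr : is_derive s 1 (fun s => 1 - c * r s) (- (c * r1 s)).
      have e1 := is_derive_mulf (is_derive_cstf c s) d1.
      have e2 := is_derive_subf (is_derive_cstf 1 s) e1.
      apply: (is_derive_eq e2); ring.
    have ddq : is_derive s 1 q (dq s).
      apply: (is_derive_eq (is_derive_mulf d1 dcr)); rewrite /dq; ring.
    have e3 : is_derive s 1 (fun s => 1 - r1 s * r1 s) (- (2 * r1 s * r2 s)).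
      have e2 := is_derive_subf (is_derive_cstf 1 s) (is_derive_mulf d2 d2).
      apply: (is_derive_eq e2); ring.
    have e4 := is_derive_mulf (is_derive_mulf ddq ddq) e3.
    apply: (is_derive_eq e4); ring.
  have /andP[rs _] := rI sT.
  have H1 := r2_ge sT; have H2 := k_le sT; have H3 := w_ge0 sT.
  have v0 := radial_velocity_ge0 sT.
  have p0 : 0 < 1 - c * r s by apply: lt_le_trans H2.
  rewrite oppr_ge0.
  (* With [w = 1 - r'^2], [r2_ge] bounds the last factor by [(1 - 2 c r) w - (1 - c r)^2 w = - (c
     r)^2 w], and the factors in front are nonnegative. *)
  have -> : q s * q s * - (2 * r1 s * r2 s) + (1 - r1 s * r1 s) * (2 * q s * dq s) =
    2 * q s * r1 s * ((1 - 2 * c * r s) * (1 - r1 s ^+ 2) - (1 - c * r s) * (r s * r2 s)).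
    by rewrite /dq /q; ring.
  have q0 : 0 <= q s by rewrite mulr_ge0// ltW.
  apply: mulr_ge0_le0; first exact: mulr_ge0 (mulr_ge0 _ q0) v0.
  have H4 := ler_wpM2l (ltW p0) H1.
  have H5 : 0 <= (c * r s) ^+ 2 * (1 - r1 s ^+ 2) by rewrite mulr_ge0// sqr_ge0.
  nra.
rewrite lerN2 in E; rewrite !expr2; apply: (le_trans E).
(* At time 0 the quantity is [(d (1 - c d))^2], and [0 <= 1 - c d <= 1]. *)
rewrite r1_0 mulr0 subr0 mulr1 /q r_0.
have zT : 0 <= (0 : R) <= T by rewrite lexx.
have /andP[_ dr0] := rI zT; rewrite r_0 in dr0.
have p1 : 0 <= 1 - c * d.
  by have := k_le zT; rewrite r_0; apply: le_trans; exact: ltW.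
have p2 : 1 - c * d <= 1 by rewrite gerBl mulr_ge0// ltW.
have h1 : d * (1 - c * d) <= d by rewrite ler_piMr// ltW.
by rewrite ler_pM// mulr_ge0// ltW.
Qed.

(* For [t >= sqrt d] the two preceding estimates give [1 - r'^2 <= d / k^3]. *)
Lemma radial_lower : d / k ^+ 3 <= 1 ->
  (T - Num.sqrt d) * (1 - d / k ^+ 3) <= r T.
Proof.
move=> dk.
have TT : 0 <= T <= T by rewrite T0 lexx.
(* Before the time [sqrt d] the claimed lower bound is not positive. *)
have [sT|Ts] := leP (Num.sqrt d) T; last first.
  have /andP[/ltW rT _] := rI TT; apply: le_trans rT.
  by rewrite mulr_le0_ge0 ?subr_ge0// subr_le0 ltW.
have s0 : 0 <= Num.sqrt d by exact: sqrtr_ge0.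
have H := @derive_ge0_le R (fun t => r t - (1 - d / k ^+ 3) * t)
  (fun t => r1 t - (1 - d / k ^+ 3)) (Num.sqrt d) T sT.
have E : r (Num.sqrt d) - (1 - d / k ^+ 3) * Num.sqrt d <= r T - (1 - d / k ^+ 3) * T.
  apply: H => t /andP[st tT].
    apply: is_derive_subf; last exact: is_derive_mull.
    by apply: dr; rewrite tT (le_trans s0).
  have tI : 0 <= t <= T by rewrite tT (le_trans s0).
  have k30 : 0 < k ^+ 3 by rewrite exprn_gt0.
  have /andP[rt _] := rI tI.
  have t2 : d <= t ^+ 2 by rewrite -(sqr_sqrtr (ltW d0)) ler_sqr// nnegrE// (le_trans s0).
  have H1 := radial_sqr_lower tI; have H2 := radial_transversal_decay tI.
  have H3 := w_ge0 tI; have H4 := k_le tI; have v0 := radial_velocity_ge0 tI.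
  have v1 : r1 t <= 1 by rewrite -(@expr_le1 _ 2)// r1_le.
  have H5 : k ^+ 2 <= (1 - c * r t) ^+ 2 by rewrite ler_sqr ?nnegrE ?(ltW k0)// (le_trans (ltW k0)).
  have H6 : k * d <= r t ^+ 2 by apply: le_trans H1; rewrite ler_wpM2l// ltW.
  (* One factor [k] comes from [r^2 >= k t^2 >= k d], the other two from [(1 - c r)^2 >= k^2]. *)
  have H7 : k ^+ 3 * d <= (r t * (1 - c * r t)) ^+ 2.
    rewrite exprMn exprSr -mulrA mulrC; apply: ler_pM => //; rewrite ?mulr_ge0 ?sqr_ge0 ?ltW//.
  have H8 : k ^+ 3 * d * (1 - r1 t ^+ 2) <= d ^+ 2.
    by apply: le_trans H2; rewrite ler_wpM2r.
  have H9 : 1 - r1 t ^+ 2 <= d / k ^+ 3.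
    rewrite ler_pdivlMr// -(ler_pM2l d0); move: H8; rewrite expr2; nra.
  (* Since [0 <= r' <= 1], the lower bound on [r'^2] is one on [r'], and no square root is
     needed. *)
  have H10 : r1 t ^+ 2 <= r1 t by rewrite expr2 ler_piMr.
  by move: (d / k ^+ 3) H9 => z ?; lra.
have sI : 0 <= Num.sqrt d <= T by rewrite s0.
have /andP[rs _] := rI sI.
move: (d / k ^+ 3) E => z E; lra.
Qed.

End radial_estimates.

Lemma continuous_near_gt0 (R : realType) (f : R -> R) (x : R) :
  {for x, continuous f} -> 0 < f x -> \forall y \near x, 0 < f y.
Proof.
move=> cf fx; apply: (cf [set z | 0 < z]).
by apply: open_nbhs_nbhs; split => //; exact: open_gt.
Qed.

(** * Comparison for warped products *)

Section warped_comparison.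
Variables (R : realType) (r0 : R) (f df : R -> R) (r r1 r2 s s1 s2 : R -> R) (T : R).
Hypotheses (f_pos : forall x, 0 < x < r0 -> 0 < f x)
  (f_der : forall x : R, 0 < x < r0 -> is_derive x 1 f (df x))
  (df_pos : forall x, 0 < x < r0 -> 0 <= df x)
  (df_nd : forall x y, 0 < x -> x <= y -> y < r0 -> df x <= df y)
  (f_incr : forall x y, 0 < x -> x < y -> y < r0 -> f x < f y).
Let solution (r r1 r2 : R -> R) := forall t, 0 <= t <= T ->
  [/\ is_derive t 1 r (r1 t), is_derive t 1 r1 (r2 t), 0 < r t < r0
    & f (r t) * r2 t = df (r t) * (1 - r1 t ^+ 2)].
Hypotheses (solr : solution r r1 r2) (sols : solution s s1 s2)
  (r1_0 : r1 0 = 0) (s1_0 : s1 0 = 0) (rs0 : r 0 < s 0) (T0 : 0 <= T)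
  (r1_le : forall t, 0 <= t <= T -> r1 t ^+ 2 <= 1).

Let derive_f_comp u u1 u2 t : solution u u1 u2 -> 0 <= t <= T ->
  is_derive t 1 (fun t => f (u t)) (df (u t) * u1 t).
Proof.
move=> sol tT; have [d1 _ uI _] := sol t tT.
exact: (@is_derive1_comp R f u t _ _ (f_der uI) d1).
Qed.

(** The derivative is [2 f u'] times [f' (1 - u'^2) - f u''], which the equation makes zero;
    constancy is read off from monotonicity in both directions. *)
Let clairaut u u1 u2 t : solution u u1 u2 -> u1 0 = 0 -> 0 <= t <= T ->
  f (u t) ^+ 2 * (1 - u1 t ^+ 2) = f (u 0) ^+ 2.
Proof.
move=> sol u10 tT; have /andP[t0 tT'] := tT.
have D x : 0 <= x <= T -> is_derive x 1
    (fun x => f (u x) * f (u x) * (1 - u1 x * u1 x)) 0.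
  move=> xT; have [d1 d2 uI E] := sol x xT.
  have dfu := derive_f_comp sol xT.
  have e2 := is_derive_subf (is_derive_cstf 1 x) (is_derive_mulf d2 d2).
  have e3 := is_derive_mulf (is_derive_mulf dfu dfu) e2.
  apply: (is_derive_eq e3).
  transitivity (2 * f (u x) * u1 x * (df (u x) * (1 - u1 x ^+ 2) - f (u x) * u2 x)).
    ring.
  by rewrite E subrr mulr0.
have xT x : 0 <= x <= t -> 0 <= x <= T by move=> /andP[-> xt] /=; exact: le_trans xt tT'.
have H1 := @derive_ge0_le R _ (fun=> 0) 0 t t0 (fun x xt => D x (xT x xt)) (fun _ _ => lexx _).
have H2 := @derive_ge0_le R (fun x => - (f (u x) * f (u x) * (1 - u1 x * u1 x))) (fun=> - 0) 0 t t0.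
rewrite u10 mulr0 subr0 mulr1 -!expr2 in H1.
apply/le_anti; rewrite H1 andbT -lerN2 -[X in - X <= _]mulr1.
have := H2; rewrite u10 mulr0 subr0 -!expr2; apply.
  by move=> x xt; apply: is_deriveN; exact: D (xT x xt).
by move=> x _; rewrite oppr0.
Qed.

Let velocity_ge0 u u1 u2 t : solution u u1 u2 -> u1 0 = 0 ->
  (forall t, 0 <= t <= T -> u1 t ^+ 2 <= 1) -> 0 <= t <= T -> 0 <= u1 t.
Proof.
move=> sol u10 u1le /andP[t0 tT]; rewrite -u10.
have xT x : 0 <= x <= t -> 0 <= x <= T by move=> /andP[-> xt] /=; exact: le_trans xt tT.
apply: (@derive_ge0_le R u1 u2 0 t t0) => x /xT xt.
  by have [] := sol x xt.
have [_ d2 uI E] := sol x xt.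
by rewrite -(pmulr_rge0 _ (f_pos uI)) E mulr_ge0 ?df_pos// subr_ge0 u1le.
Qed.

(** Continuous induction on the strict inequality: it persists a little by continuity, and a first
    meeting time is excluded by the two identities. *)
Lemma warped_comparison t : 0 <= t <= T -> r t < s t.
Proof.
have contD u u1 u2 x : solution u u1 u2 -> 0 <= x <= T -> {for x, continuous u}.
  by move=> sol /sol[[d1 _] _ _ _]; exact: derivable1_continuous.
have near_lt x : 0 <= x <= T -> r x < s x -> \forall y \near x, r y < s y.
  move=> xT rsx.
  have cx : {for x, continuous (fun y => s y - r y)}.
    by apply: cvgB; [exact: contD sols xT|exact: contD solr xT].
  have sx : 0 < s x - r x by rewrite subr_gt0.
  by apply: filterS (continuous_near_gt0 cx sx) => y; rewrite subr_gt0.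
have lim_le x : 0 < x -> 0 <= x <= T -> (forall y, 0 <= y < x -> r y < s y) -> r x <= s x.
  move=> x0 xT lt; rewrite leNgt; apply/negP => sr.
  have cx : {for x, continuous (fun y => r y - s y)}.
    by apply: cvgB; [exact: contD solr xT|exact: contD sols xT].
  have rx : 0 < r x - s x by rewrite subr_gt0.
  have N := continuous_near_gt0 cx rx.
  near x^'- => y.
  have y0 : 0 <= y by near: y; exact: nbhs_left_ge.
  have yx : y < x by near: y; exact: nbhs_left_lt.
  have : r y < s y by apply: lt; rewrite y0.
  have : 0 < r y - s y by near: y; exact: cvg_at_left_filter N.
  by rewrite subr_gt0 => /lt_trans h /h; rewrite ltxx.
(* [real_induction] works on half-open intervals; the guard [t <= T] lets it reach the endpoint
   [T]. *)
suff H : forall t, 0 <= t < T + 1 -> (t <= T -> r t < s t).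
  by move=> /andP[t0 tT]; apply: H => //; rewrite t0 ltr_pwDr.
apply: (@real_induction R (fun t => t <= T -> r t < s t)) => x /andP[x0 xT1].
  move=> lt xT; have [->//|xn0] := eqVneq x 0.
  have xp : 0 < x by rewrite lt_neqAle eq_sym xn0.
  have xI : 0 <= x <= T by rewrite x0.
  have lt' y : 0 <= y < x -> r y < s y.
    by move=> yx; apply: lt => //; case/andP: yx => _ /ltW/le_trans; apply.
  have le := lim_le x xp xI lt'.
  rewrite lt_neqAle le andbT; apply/eqP => rsx.
  have le' y : 0 <= y <= x -> r y <= s y.
    by move=> /andP[y0]; rewrite le_eqVlt => /predU1P[->//|yx]; apply/ltW/lt'; rewrite y0.
  have yT y : 0 <= y <= x -> 0 <= y <= T by move=> /andP[-> yx] /=; exact: le_trans yx xT.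
  have momD u u1 u2 y : solution u u1 u2 -> 0 <= y <= T ->
      is_derive y 1 (fun y => f (u y) * u1 y) (df (u y)).
    move=> sol yI; have [d1 d2 uI E] := sol y yI.
    apply: (is_derive_eq (is_derive_mulf (derive_f_comp sol yI) d2)).
    by rewrite E; ring.
  (* Up to the meeting time [r <= s], so the derivative [df (s y) - df (r y)] is nonnegative. *)
  have mom := @derive_ge0_le R (fun y => f (s y) * s1 y - f (r y) * r1 y)
    (fun y => df (s y) - df (r y)) 0 x x0.
  rewrite s1_0 r1_0 !mulr0 subrr subr_ge0 in mom.
  have {}mom : f (r x) * r1 x <= f (s x) * s1 x.
    apply: mom => y yx; have yI := yT y yx.
      by apply: is_derive_subf; [exact: momD sols yI|exact: momD solr yI].
    rewrite subr_ge0; have [_ _ /andP[ry _] _] := solr yI; have [_ _ /andP[_ sy] _] := sols yI.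
    by apply: df_nd => //; exact: le'.
  have [_ _ rI _] := solr xI; have fp := f_pos rI.
  rewrite -rsx ler_pM2l// in mom.
  have c1 := clairaut solr r1_0 xI; have c2 := clairaut sols s1_0 xI.
  rewrite -rsx in c2.
  have z0 : 0 <= (0 : R) <= T by rewrite lexx.
  have [_ _ /andP[r00 rr0] _] := solr z0; have [_ _ /andP[s00 sr0] _] := sols z0.
  have f0 : f (r 0) ^+ 2 < f (s 0) ^+ 2.
    by rewrite ltr_sqr ?nnegrE ?ltW ?f_pos ?r00 ?s00//; exact: f_incr.
  have v0 := velocity_ge0 solr r1_0 r1_le xI.
  (* At equal heights, the smaller Clairaut constant of [r] forces [s1^2 < r1^2], against this
     inequality. *)
  have : r1 x ^+ 2 <= s1 x ^+ 2 by rewrite ler_sqr ?nnegrE// (le_trans v0).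
  move: f0; rewrite -c1 -c2 ltr_pM2l ?exprn_gt0// ltrD2l ltrN2.
  by move=> /lt_le_trans h /h; rewrite ltxx.
move=> le; have [xT|xT] := leP x T; last first.
  have : \forall y \near x, T < y by apply: open_nbhs_nbhs; split; [exact: open_gt|].
  by apply: filterS => y Ty _ yT; have := lt_le_trans Ty yT; rewrite ltxx.
have xI : 0 <= x <= T by rewrite x0.
have := near_lt x xI (le x _ xT); rewrite x0 lexx => /(_ isT).
by apply: filterS => y.
Unshelve. all: by end_near. Qed.

End warped_comparison.

(** * The radial component of a geodesic *)

Lemma derive1_entry (R : realType) p q (w : R -> 'M[R]_(p, q)) (t : R) i j :
  derivable w t 1 -> is_derive t 1 (fun s => w s i j) (derive1 w t i j).
Proof.
move=> dw; have /is_derive_mxP/(_ i j) := derivableP dw.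
by rewrite -derive1E.
Qed.

Lemma qform_block (R : realType) n (x : R) (B : 'M[R]_n) (v : 'rV[R]_(1 + n)) :
  qform (block_mx x%:M 0 0 B) v = x * v 0 (lshift n 0) ^+ 2 + qform B (rsubmx v).
Proof.
rewrite /qform -{1 2}[v]hsubmxK mul_row_block tr_row_mx mul_row_col mxE.
rewrite !mulmx0 addr0 add0r; congr (_ + _).
by rewrite mul_mx_scalar -scalemxAl !mxE big_ord1 !mxE expr2.
Qed.

Section radial_equation.
Variables (R : realType) (n : nat) (Y : topologicalType) (I : Type)
  (atY : I -> chart R n Y) (r0 : R) (f : R -> R) (h : R -> I -> Y -> 'M[R]_n).
Hypothesis gw : generalized_warped_product atY r0 f h.

Let mY : smooth_manifold [set: Y] atY. Proof. by have [[[]]] := gw. Qed.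

Let rg : riemannian_metric (cylinder_atlas atY r0) (warped_metric f h).
Proof. by have [] := gw. Qed.

Lemma warping_is_derive x : 0 < x < r0 -> is_derive x 1 f (derive1 f x).
Proof.
move=> xr; have [_ [_ [df C1]] _ _ _] := gw.
have nx : nbhs x (`]0, r0[%classic : set R).
  by apply: open_nbhs_nbhs; split; [exact: interval_open|rewrite /= in_itv].
have D := C1_is_derive nx C1.
by have [d1 _] := D; rewrite derive1E; exact: derivableP.
Qed.

Lemma fiber_metric_is_derive x e y : 0 < x < r0 -> cdom (atY e) y ->
  is_derive x 1 (fun s => h s e y) (derive1 (fun s => h s e y) x).
Proof.
move=> xr ey; have [_ _ [_ /(_ e y ey)[dh C1]] _ _] := gw.
have nx : nbhs x (`[0, r0[%classic : set R).
  have : nbhs x (`]0, r0[%classic : set R).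
    by apply: open_nbhs_nbhs; split; [exact: interval_open|rewrite /= in_itv].
  by apply: filterS => s /=; rewrite !in_itv/= => /andP[/ltW -> ->].
have [d1 _] := C1_is_derive nx C1.
by rewrite derive1E; exact: derivableP.
Qed.

(** Along a radial line the point of [Y] is fixed, so the metric reduces to the curve of matrices
    [psi], and the C1 dependence of [f] and [h] on [r] suffices. *)
Lemma radial_derive_metric e (u : 'rV[R]_(1 + n)) (v : 'rV[R]_(1 + n))
  (G := chart_metric (cylinder_atlas atY r0) (warped_metric f h) e)
  (x := lsubmx u 0 0) (y := cinv (atY e) (rsubmx u)) :
  0 < x < r0 -> cdom (atY e) y ->
  qform ('D_(delta_mx 0 (lshift n 0)) G u) v =
    2 * (f x * derive1 f x) * qform (h x e y) (rsubmx v)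
    + f x ^+ 2 * qform (derive1 (fun s => h s e y) x) (rsubmx v).
Proof.
move=> xr ey.
pose psi s : 'M[R]_(1 + n) := block_mx 1%:M 0 0 (f s ^+ 2 *: h s e y).
pose dpsi : 'M[R]_n := (2 * (f x * derive1 f x)) *: h x e y
  + f x ^+ 2 *: derive1 (fun s => h s e y) x.
have dh := fiber_metric_is_derive xr ey.
have df := warping_is_derive xr.
have D : is_derive x 1 psi (block_mx 0%:M 0 0 dpsi).
  apply/is_derive_mxP => i j; case: (split_ordP i) => i' ->;
    case: (split_ordP j) => j' ->.
  - have -> : (fun s => psi s (lshift n i') (lshift n j')) = (fun=> (1%:M : 'M[R]_1) i' j').
      by apply/funext => s; rewrite block_mxEul.
    have z : (0%:M : 'M[R]_1) i' j' = 0 by rewrite mxE mul0rn.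
    by rewrite block_mxEul z; exact: is_derive_cst.
  - have -> : (fun s => psi s (lshift n i') (rshift 1 j')) = (fun=> 0).
      by apply/funext => s; rewrite block_mxEur mxE.
    by rewrite block_mxEur mxE; exact: is_derive_cst.
  - have -> : (fun s => psi s (rshift 1 i') (lshift n j')) = (fun=> 0).
      by apply/funext => s; rewrite block_mxEdl mxE.
    by rewrite block_mxEdl mxE; exact: is_derive_cst.
  - have -> : (fun s => psi s (rshift 1 i') (rshift 1 j')) =
      (fun s => f s * f s * h s e y i' j').
      by apply/funext => s; rewrite block_mxEdr mxE expr2.
    have /is_derive_mxP/(_ i' j') dhij := dh.
    rewrite block_mxEdr /dpsi.
    apply: (is_derive_eq (is_derive_mulf (is_derive_mulf df df) dhij)).
    rewrite [RHS]mxE [X in _ = X + _]mxE [X in _ = _ + X]mxE expr2; ring.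
have -> : 'D_(delta_mx 0 (lshift n 0)) G u = 'D_1 psi x.
  rewrite /derive.
  suff -> : (fun s : R => s^-1 *: ((G \o shift u) (s *: delta_mx 0 (lshift n 0)) - G u)) =
    (fun s => s^-1 *: ((psi \o shift x) (s *: 1) - psi x)) by [].
  apply/funext => s; rewrite /= [s *: 1]mulr1 /G /chart_metric /warped_metric /=.
  have -> : rsubmx (s *: delta_mx 0 (lshift n 0) + u) = rsubmx u.
    by apply/rowP => j; rewrite !mxE eq_rlshift andbF mulr0 add0r.
  have -> : lsubmx (s *: delta_mx 0 (lshift n 0) + u) 0 0 = s + x.
    by rewrite /x !mxE !eqxx mulr1.
  by [].
have [_ ->] := D; rewrite qform_block mul0r add0r /dpsi.
by rewrite /qform mulmxDr mulmxDl -!scalemxAr -!scalemxAl !mxE.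
Qed.

Variables (a b : \bar R) (c : R -> R * Y).
Hypotheses
  (geo : geodesic_on (@cylinder R Y r0) (cylinder_atlas atY r0) (warped_metric f h) a b c)
  (usp : unit_speed_on (cylinder_atlas atY r0) (warped_metric f h) a b c).

(** This is the radial entry of the Euler-Lagrange covector together with unit speed. Here [v] is
    the velocity of the [Y] component in the chart [e], which may vary with [t]. *)
Lemma radial_equation t : time_interval a b t ->
  [/\ 0 < (c t).1 < r0, is_derive t 1 (fun s => (c s).1) (derive1 (fun s => (c s).1) t),
    is_derive t 1 (derive1 (fun s => (c s).1)) (derive1 (derive1 (fun s => (c s).1)) t)
  & exists e v, [/\ cdom (atY e) (c t).2,
     derive1 (fun s => (c s).1) t ^+ 2 + f (c t).1 ^+ 2 * qform (h (c t).1 e (c t).2) v = 1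
   & derive1 (derive1 (fun s => (c s).1)) t =
      f (c t).1 * derive1 f (c t).1 * qform (h (c t).1 e (c t).2) v +
      2^-1 * (f (c t).1 ^+ 2 * qform (derive1 (fun s => h s e (c t).2) (c t).1) v)]].
Proof.
move=> tI; have [Dct cc gt] := geo tI.
have [e et] := cylinder_cover mY Dct.
have chD := @cylinder_is_chart _ _ _ _ _ r0 mY.
set G := chart_metric (cylinder_atlas atY r0) (warped_metric f h) e.
pose u := cmap (cylinder_atlas atY r0 e) \o c.
have [d1 d2 E] := gt e et; rewrite -/u in d1 d2 E.
have du : \forall s \near t, derivable u s 1.
  apply: filterS2 (time_interval_near tI) (chart_near chD et cc) => s sI es.
  by have [_ _ /(_ e es)[d0 _ _]] := geo sI; exact: d0.
have rE : (fun s => (c s).1) = (fun s => u s 0 (lshift n 0)).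
  by apply/funext => s; rewrite /u /= row_mxEl mxE mulr1n.
have xr : 0 < (c t).1 < r0 by have [+ _] := Dct; rewrite /= in_itv.
have ey : cdom (atY e) (c t).2 by have [_ +] := et.
have near_r : \forall s \near t, derive1 u s 0 (lshift n 0) = derive1 (fun s => (c s).1) s.
  apply: filterS du => s ds; rewrite rE.
  have [_ e1] := derive1_entry 0 (lshift n 0) ds.
  exact: (etrans (esym e1) (esym (derive1E _ _))).
have dr : is_derive t 1 (fun s => (c s).1) (derive1 (fun s => (c s).1) t).
  by rewrite -(nbhs_singleton near_r) rE; exact: derive1_entry.
have ddr' : is_derive t 1 (derive1 (fun s => (c s).1))
    (derive1 (derive1 u) t 0 (lshift n 0)).
  by apply: (near_eq_is_derive near_r); exact: derive1_entry.
have r2E : derive1 (derive1 (fun s => (c s).1)) t = derive1 (derive1 u) t 0 (lshift n 0).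
  by have [_ e2] := ddr'; exact: etrans (derive1E _ _) e2.
have uimg : cimg (cylinder_atlas atY r0 e) (u t) by exact: (chart_cmap_img chD et).
have uK : cinv (cylinder_atlas atY r0 e) (u t) = c t by exact: (chart_cmapK chD et).
have xE : lsubmx (u t) 0 0 = (c t).1 by rewrite -[in RHS]uK.
have yE : cinv (atY e) (rsubmx (u t)) = (c t).2 by rewrite -[in RHS]uK.
have Gt : G (u t) = block_mx 1%:M 0 0 (f (c t).1 ^+ 2 *: h (c t).1 e (c t).2).
  by rewrite /G /chart_metric uK.
split; [exact: xr|exact: dr|by rewrite r2E|].
exists e, (rsubmx (derive1 u t)); split; [exact: ey| |].
  have := usp tI et; rewrite /warped_metric qform_block mul1r.
  move=> <-; congr (_ ^+ 2 + _); first by rewrite (nbhs_singleton near_r).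
  by rewrite /qform -scalemxAr -scalemxAl [RHS]mxE.
have [Gs Gp] := chart_metric_posdef chD rg uimg.
have GU := posdef_unitmx Gp.
have /(christoffel_EL _ _ GU Gs) EL := E.
have dG : differentiable G (u t).
  apply: (C1_on_differentiable (chart_open_img chD (a := e))) uimg.
  exact: Ck_on_le (leqnSn 1) (chart_metric_C2 rg e).
have := congr1 (fun x : 'rV_(1 + n) => x 0 (lshift n 0)) EL.
rewrite /EL_form.
set v := derive1 u t; set acc := derive1 (derive1 u) t.
have -> : (\sum_i v 0 i *: (v *m 'D_(delta_mx 0 i) G (u t)) : 'rV_(1 + n)) =
   \sum_i v 0 i *: (v *m 'D_(delta_mx 0 i) G (u t)) by [].
set S : 'rV_(1 + n) := \sum_i _.
(* The radial column of the metric is constant, so its derivatives vanish. *)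
have S0 : S 0 (lshift n 0) = 0.
  rewrite /S summxE big1// => i _; rewrite mxE [X in _ * X]mxE big1 ?mulr0// => j _.
  have -> : 'D_(delta_mx 0 i) G (u t) j (lshift n 0) = 0; last by rewrite mulr0.
  rewrite derive_mx; last exact: diff_derivable.
  rewrite mxE; case: (split_ordP j) => j' ->.
    have -> : (fun w => G w (lshift n j') (lshift n 0)) = (fun=> (1%:M : 'M[R]_1) j' 0).
      by apply/funext => w; rewrite /G /chart_metric /warped_metric block_mxEul.
    exact: derive_cst.
  have -> : (fun w => G w (rshift 1 j') (lshift n 0)) = (fun=> 0).
    by apply/funext => w; rewrite /G /chart_metric /warped_metric block_mxEdl mxE.
  exact: derive_cst.
have aG : (acc *m G (u t)) 0 (lshift n 0) = acc 0 (lshift n 0).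
  rewrite Gt -{1}[acc]hsubmxK mul_row_block row_mxEl mulmx1 mulmx0 addr0.
  by rewrite mxE.
have qD := radial_derive_metric (e := e) (u := u t) v.
rewrite xE yE in qD; have {}qD := qD xr ey.
rewrite mxE [X in X + _]mxE aG S0 addr0 [X in _ + X]mxE [X in - X]mxE [X in _ - _ * X]mxE.
rewrite [X in _ - _ * X = _]qD [RHS]mxE r2E -/acc => /eqP.
by rewrite subr_eq0 => /eqP ->; field.
Qed.

End radial_equation.

(** * Time reversal *)

Section reversal.
Variables (R : realType).

Lemma is_derive_opp_arg m (u : R -> 'rV[R]_m) (t : R) d :
  is_derive (- t) 1 u d -> is_derive t 1 (fun s => u (- s)) (- d).
Proof.
move=> /is_derive_mxP H; apply/is_derive_mxP => i j; rewrite mxE.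
have d1 : is_derive t 1 (fun s : R => - s) (- 1).
  exact: is_deriveN (is_derive_idf t).
have := @is_derive1_comp R (fun s => u s i j) (fun s => - s) t _ _ (H i j) d1.
by rewrite mulrN1.
Qed.

Lemma near_opp (P : set R) t : (\forall s \near - t, P s) -> \forall s \near t, P (- s).
Proof. by move=> H; apply: (@oppr_continuous R R t). Qed.

Lemma derivable1_is_derive m (u : R -> 'rV[R]_m) (t : R) :
  derivable u t 1 -> is_derive t 1 u (derive1 u t).
Proof. by rewrite derive1E; exact: derivableP. Qed.

Lemma derive1_opp_arg m (u : R -> 'rV[R]_m) (t : R) :
  derivable u (- t) 1 -> derive1 (fun s => u (- s)) t = - derive1 u (- t).
Proof.
move=> /derivableP/is_derive_opp_arg[_ e].
exact: etrans (derive1E _ _) (etrans e (congr1 -%R (esym (derive1E u (- t))))).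
Qed.

(** Reversal leaves the second derivative unchanged and flips the sign of the velocity, in which the
    other term is quadratic. *)
Lemma chart_geodesic_at_opp m (G : 'rV[R]_m -> 'M[R]_m) (u : R -> 'rV[R]_m) t :
  (\forall s \near - t, derivable u s 1) -> chart_geodesic_at G u (- t) ->
  chart_geodesic_at G (fun s => u (- s)) t.
Proof.
move=> /near_opp du [d1 d2 E].
have n1 : \forall s \near t, - derive1 u (- s) = derive1 (fun s => u (- s)) s.
  by apply: filterS du => s ds; rewrite derive1_opp_arg.
have [dd1 _] := is_derive_opp_arg (derivableP d1).
have D2 : is_derive t 1 (derive1 (fun s => u (- s))) (derive1 (derive1 u) (- t)).
  have h1 := is_derive_opp_arg (derivable1_is_derive d2).
  have h2 : is_derive t 1 (fun s => - derive1 u (- s)) (- - derive1 (derive1 u) (- t)).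
    exact: is_deriveN h1.
  by rewrite opprK in h2; exact: (near_eq_is_derive n1 h2).
have [dd2 e2] := D2.
have {}e2 := etrans (derive1E _ _) e2.
split; [exact: dd1|exact: dd2|] => k.
rewrite e2 -(nbhs_singleton n1) -[RHS](E k); congr (_ + _).
by apply: eq_bigr => i _; apply: eq_bigr => j _; rewrite !mxE mulrN mulrN mulNr opprK.
Qed.

Variables (m : nat) (M : topologicalType) (D : set M) (I : Type)
  (at_ : I -> chart R m M) (g : I -> M -> 'M[R]_m).
Hypothesis chD : forall a, is_chart D (at_ a).

Lemma time_interval_opp (a b : \bar R) t :
  time_interval (- b)%E (- a)%E t <-> time_interval a b (- t).
Proof. by rewrite /time_interval /= EFinN lteNr lteNl andbC. Qed.

Lemma geodesic_derivable_near a b c t e : geodesic_on D at_ g a b c ->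
  time_interval a b t -> cdom (at_ e) (c t) ->
  \forall s \near t, derivable (cmap (at_ e) \o c) s 1.
Proof.
move=> geo tI et; have [_ cc _] := geo t tI.
apply: filterS2 (time_interval_near tI) (chart_near chD et cc) => s sI es.
by have [_ _ /(_ e es)[d0 _ _]] := geo s sI; exact: d0.
Qed.

Lemma geodesic_on_opp a b c : geodesic_on D at_ g a b c ->
  geodesic_on D at_ g (- b)%E (- a)%E (fun t => c (- t)).
Proof.
move=> geo t /time_interval_opp tI; have [Dc cc gt] := geo _ tI; split; [exact: Dc| |].
  apply: (@continuous_comp _ _ _ (fun s : R => - s) c t); last exact: cc.
  exact: oppr_continuous.
move=> e et.
apply: (@chart_geodesic_at_opp _ _ (cmap (at_ e) \o c)); last exact: gt.
exact: geodesic_derivable_near geo tI et.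
Qed.

Lemma unit_speed_on_opp a b c : geodesic_on D at_ g a b c ->
  unit_speed_on at_ g a b c ->
  unit_speed_on at_ g (- b)%E (- a)%E (fun t => c (- t)).
Proof.
move=> geo usp t /time_interval_opp tI e et.
have d := nbhs_singleton (geodesic_derivable_near geo tI et).
have -> : derive1 (cmap (at_ e) \o (fun t => c (- t))) t =
  - derive1 (cmap (at_ e) \o c) (- t) by exact: derive1_opp_arg d.
by rewrite -(usp _ tI e et) /qform linearN/= mulNmx mulmxN mulNmx opprK.
Qed.

Lemma maximal_geodesic_opp a b c : maximal_geodesic D at_ g a b c ->
  maximal_geodesic D at_ g (- b)%E (- a)%E (fun t => c (- t)).
Proof.
move=> [geo mx]; split; first exact: geodesic_on_opp.
move=> a' b' c' a'b ab' geo' cc'.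
have := mx (- b')%E (- a')%E (fun t => c' (- t)).
rewrite leeNl leeNr => /(_ ab' a'b (geodesic_on_opp geo')) [].
  move=> t tI; rewrite cc' ?opprK//.
  by apply/time_interval_opp; rewrite opprK.
by move=> <- <-; rewrite !oppeK.
Qed.

End reversal.

(** * Geodesics near the singularity *)

(** Here [F = f(r)], [F' = f'(r)], and [q], [q'] are the values of [h_r] and its [r]-derivative on
    the [Y] velocity. Unit speed gives [1 - r'^2 = F^2 q]; convexity bounds the first term of
    [x r''] below by it, and the bound on [q'] costs at most [k x] times it. *)
Lemma acceleration_ineq (R : realType) (q q' F F' r1 r2 x k : R) :
  r1 ^+ 2 + F ^+ 2 * q = 1 -> r2 = F * F' * q + 2^-1 * (F ^+ 2 * q') ->
  0 <= q -> - (2 * k) * q <= q' -> 0 < F -> 0 < x -> F <= x * F' ->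
  r1 ^+ 2 <= 1 /\ (1 - k * x) * (1 - r1 ^+ 2) <= x * r2.
Proof.
move=> E1 -> q0 q'1 F0 x0 sl.
have W : 1 - r1 ^+ 2 = F ^+ 2 * q by rewrite -E1 addrAC subrr add0r.
have F2q : 0 <= F ^+ 2 * q by rewrite mulr_ge0// sqr_ge0.
split; first by rewrite -subr_ge0 W.
rewrite W.
have h1 : F ^+ 2 * q <= x * F' * (F * q).
  by rewrite expr2 -mulrA ler_wpM2r// mulr_ge0// ltW.
have h2 : - (2 * k) * q * (x * F ^+ 2) <= q' * (x * F ^+ 2).
  by rewrite ler_wpM2r// mulr_ge0// ?sqr_ge0// ltW.
have -> : x * (F * F' * q + 2^-1 * (F ^+ 2 * q')) =
  x * F' * (F * q) + 2^-1 * (q' * (x * F ^+ 2)) by ring.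
have -> : (1 - k * x) * (F ^+ 2 * q) = F ^+ 2 * q + 2^-1 * (- (2 * k) * q * (x * F ^+ 2)).
  by field.
by rewrite lerD// ler_wpM2l// invr_ge0.
Qed.

Section cusp_geodesics.
Variables (R : realType) (n : nat) (Y : topologicalType) (I : Type)
  (atY : I -> chart R n Y) (r0 : R) (f : R -> R) (h : R -> I -> Y -> 'M[R]_n).
Hypotheses (gw : generalized_warped_product atY r0 f h) (f_0 : f 0 = 0)
  (cf : convex_function (`[0, r0[%classic : set R^o) f).

Let f_pos x : 0 < x < r0 -> 0 < f x.
Proof. by have [_ [+ _] _ _ _] := gw; apply. Qed.

Let D := @cylinder R Y r0.
Let atC := cylinder_atlas atY r0.
Let g := warped_metric f h.

Let fiber_qform_ge0 x e y v : 0 < x < r0 -> cdom (atY e) y -> 0 <= qform (h x e y) v.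
Proof.
move=> /andP[x0 xr] ey; have [_ _ [/(_ x) + _] _ _] := gw.
rewrite (ltW x0) xr => /(_ isT)[/(_ e y ey)[_ hp] _ _].
have [->|/hp/ltW//] := eqVneq v 0.
by rewrite /qform !mul0mx mxE.
Qed.

Lemma derive1_radial_lowest (a b : \bar R) (c : R -> R * Y) :
  geodesic_on D atC g a b c -> unit_speed_on atC g a b c ->
  time_interval a b 0 ->
  (forall t, time_interval a b t -> (c 0).1 <= (c t).1) ->
  derive1 (fun s => (c s).1) 0 = 0.
Proof.
move=> geo usp I0 low.
have /nbhs_ballP[e /= e0 Be] := time_interval_near I0.
have inI t : t \in `]- e, e[%R -> time_interval a b t.
  by rewrite in_itv/= => te; apply: Be; rewrite /ball/= sub0r normrN ltr_norml.
have [_ d0] : is_derive (0 : R) 1 (fun s => (c s).1) (0 : R).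
  apply: (@derive1_at_min _ _ (- e) e).
  - by rewrite (@le_trans _ _ 0)// ?oppr_le0 ltW.
  - by move=> t /inI tI; have [_ [] ] := radial_equation gw geo usp tI.
  - by rewrite in_itv/= oppr_lt0 e0.
  - by move=> t /inI; exact: low.
exact: etrans (derive1E _ _) d0.
Qed.

Lemma radial_acceleration_ge (k : R) (a b : \bar R) (c : R -> R * Y) t :
  derivative_bound atY r0 h k ->
  geodesic_on D atC g a b c -> unit_speed_on atC g a b c -> time_interval a b t ->
  derive1 (fun s => (c s).1) t ^+ 2 <= 1 /\
  (1 - k * (c t).1) * (1 - derive1 (fun s => (c s).1) t ^+ 2) <=
    (c t).1 * derive1 (derive1 (fun s => (c s).1)) t.
Proof.
move=> db geo usp tI.
have [xr _ _ [e [v [ey E1 E2]]]] := radial_equation gw geo usp tI.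
have q0 := fiber_qform_ge0 v xr ey.
have /andP[q'1 _] := db _ e _ v xr ey.
have fx := f_pos xr; have /andP[x0 xr0] := xr.
have fslope := convex_derive_ge_ratio cf f_0 x0 xr0 (warping_is_derive gw xr).
exact: acceleration_ineq E1 E2 q0 q'1 fx x0 fslope.
Qed.

Lemma radial_acceleration_warped (a b : \bar R) (c : R -> R * Y) t :
  (forall r s a y, 0 <= r < r0 -> 0 <= s < r0 -> cdom (atY a) y -> h r a y = h s a y) ->
  geodesic_on D atC g a b c -> unit_speed_on atC g a b c -> time_interval a b t ->
  f (c t).1 * derive1 (derive1 (fun s => (c s).1)) t =
    derive1 f (c t).1 * (1 - derive1 (fun s => (c s).1) t ^+ 2).
Proof.
move=> hc geo usp tI.
have [xr _ _ [e [v [ey E1 E2]]]] := radial_equation gw geo usp tI.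
(* [hc] gives constancy on [[0, r0)] only, so the derivative is computed from a neighbourhood inside
   the open interval. *)
have h0 : derive1 (fun s => h s e (c t).2) (c t).1 = 0.
  have nh : \forall s \near (c t).1, h s e (c t).2 = h (c t).1 e (c t).2.
    have : \forall s \near (c t).1, s \in `]0, r0[%R.
      by apply: open_nbhs_nbhs; split; [exact: interval_open|rewrite /= in_itv].
    apply: filterS => s; rewrite in_itv/= => /andP[s0 sr]; apply: hc => //.
      by rewrite (ltW s0).
    by case/andP: xr => /ltW -> ->.
  exact: etrans (derive1E (fun s => h s e (c t).2) (c t).1)
    (etrans (near_eq_derive (f := fun s => h s e (c t).2)
       (g := fun=> h (c t).1 e (c t).2) 1 nh) (derive_cst _ _ _)).
move: E1 E2; rewrite h0.
have -> : qform (0 : 'M[R]_n) v = 0 by rewrite /qform mulmx0 mul0mx mxE.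
rewrite !mulr0 addr0 => E1 ->; rewrite -{}E1 addrAC subrr add0r; ring.
Qed.

(** If the domain ended at some [b < r0 - d], then [d <= r <= d + t] would keep the curve on
    [[0, b)] inside the compact set [[d, d + b] x Y] of the cylinder, and an extension would
    contradict maximality. *)
Lemma geodesic_forward_bounds (k : R) (a b : \bar R) (c : R -> R * Y)
    (d := (c 0).1) (l := d / (1 - r0 * k) ^+ 3) :
  0 <= k -> derivative_bound atY r0 h k -> r0 * k < 1 ->
  maximal_geodesic D atC g a b c -> unit_speed_on atC g a b c ->
  time_interval a b 0 ->
  (forall t, time_interval a b t -> (c 0).1 <= (c t).1) -> l <= 1 ->
  ((r0 - d)%:E <= b)%E /\
  forall t, 0 <= t -> time_interval a b t ->
    (t - Num.sqrt d) * (1 - l) <= (c t).1 <= d + t.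
Proof.
move=> k0 db rk mx usp I0 low l1; have [geo mxE] := mx.
have [a0 b0] := andP I0.
have inI s t : 0 <= s <= t -> time_interval a b t -> time_interval a b s.
  move=> /andP[s0 st] /andP[_ tb]; rewrite /time_interval /=.
  by rewrite (lt_le_trans a0) ?lee_fin//= (le_lt_trans _ tb)// lee_fin.
have RE t tI := radial_equation gw geo usp (t := t) tI.
have d0 : 0 < d by have [/andP[]] := RE 0 I0.
have r1_0 := derive1_radial_lowest geo usp I0 low.
have up t : 0 <= t -> time_interval a b t -> (c t).1 <= d + t.
  move=> t0 tI; have sI s : 0 <= s <= t -> time_interval a b s by move=> /inI; apply.
  have tt : 0 <= t <= t by rewrite t0 lexx.
  apply: (radial_upper (r := fun s => (c s).1) k0 rk _ _ _ _ r1_0 _ _ tt) => // s /sI {}sI.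
  - by have [] := RE s sI.
  - by have [_ _ d2 _] := RE s sI; exact: d2.
  - by have [] := RE s sI.
  - by have [] := radial_acceleration_ge db geo usp sI.
  - by have [] := radial_acceleration_ge db geo usp sI.
have lo t : 0 <= t -> time_interval a b t -> (t - Num.sqrt d) * (1 - l) <= (c t).1.
  move=> t0 tI; have sI s : 0 <= s <= t -> time_interval a b s by move=> /inI; apply.
  apply: (radial_lower (r := fun s => (c s).1) k0 rk d0 t0 _ _ _ _ r1_0) => // s /sI {}sI.
  - by have [] := RE s sI.
  - by have [_ _ d2 _] := RE s sI; exact: d2.
  - by have [] := RE s sI.
  - by have [] := radial_acceleration_ge db geo usp sI.
  - by have [] := radial_acceleration_ge db geo usp sI.
split; last by move=> t t0 tI; rewrite lo// up.
rewrite leNgt; apply/negP => bd.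
(* An infinite [b] is impossible: [+oo] is not below [r0 - d], and [-oo] is not above 0. *)
case: b => [b| |] in bd b0 I0 mx geo mxE usp low inI RE up lo *;
  [|by move: bd; rewrite ltNge leey|by move: b0; rewrite ltNge leNye].
have mY : smooth_manifold [set: Y] atY by have [[[]]] := gw.
have hR : hausdorff_space (R * Y)%type.
  by apply: hausdorff_prod; [exact: Rhausdorff|have [[]] := mY].
have rg : riemannian_metric atC g by have [] := gw.
have cY : compact [set: Y] by have [[[]]] := gw.
pose K : set (R * Y) := `[d, d + b]%classic `*` [set: Y].
have cK : compact K by apply: compact_setX => //; exact: segment_compact.
move: bd b0; rewrite !lte_fin => bd b0.
have KD : K `<=` D.
  move=> [x y] [/= + _]; rewrite in_itv/= => /andP[dx xb]; split => //=.
  rewrite in_itv/= (lt_le_trans d0)//= (le_lt_trans xb)//.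
  by rewrite addrC -ltrBrDr.
have cKt t : 0 <= t < b -> K (c t).
  move=> /andP[t0 tb]; have tI : time_interval a b%:E t.
    by rewrite /time_interval/= lte_fin tb andbT (lt_le_trans a0)// lee_fin.
  split => //=; rewrite in_itv/= low//= (le_trans (up t t0 tI))//.
  by rewrite lerD2l ltW.
have [b1 bb1 [c' geo' cc']] := geodesic_extension hR (cylinder_is_chart r0 mY)
  (cylinder_cover mY) (cylinder_transition r0 mY) rg I0 geo usp cK KD cKt.
have [_ [e]] := mxE a b1%:E c' (lexx _) (ltW bb1) geo' cc'.
by rewrite e ltxx in bb1.
Qed.

(** The forward bounds for the curve and its reversal, completed by outer bounds on the domain: the
    lower bound on [r] cannot reach [r0]. *)
Lemma geodesic_bounds (k : R) (a b : \bar R) (c : R -> R * Y)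
    (d := (c 0).1) (l := d / (1 - r0 * k) ^+ 3) :
  0 <= k -> derivative_bound atY r0 h k -> r0 * k < 1 ->
  maximal_geodesic D atC g a b c -> unit_speed_on atC g a b c ->
  time_interval a b 0 ->
  (forall t, time_interval a b t -> (c 0).1 <= (c t).1) -> l < 1 ->
  [/\ (a <= (- (r0 - d))%:E)%E, ((r0 - d)%:E <= b)%E,
      ((- (Num.sqrt d + r0 / (1 - l)))%:E <= a)%E,
      (b <= (Num.sqrt d + r0 / (1 - l))%:E)%E
    & forall t, time_interval a b t ->
        (`|t| - Num.sqrt d) * (1 - l) <= (c t).1 <= d + `|t|].
Proof.
move=> k0 db rk mx usp I0 low l1; have [geo _] := mx.
have [F1 F2] := geodesic_forward_bounds k0 db rk mx usp I0 low (ltW l1).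
have I0' : time_interval (- b)%E (- a)%E 0 by apply/time_interval_opp; rewrite oppr0.
have low' t : time_interval (- b)%E (- a)%E t -> (c (- 0)).1 <= (c (- t)).1.
  by move=> /time_interval_opp; rewrite oppr0; exact: low.
have mY : smooth_manifold [set: Y] atY by have [[[]]] := gw.
have chD := cylinder_is_chart r0 mY.
have := geodesic_forward_bounds k0 db rk (maximal_geodesic_opp chD mx)
  (unit_speed_on_opp chD geo usp) I0' low'.
rewrite oppr0 => /(_ (ltW l1))[B1 B2].
have bounds t : time_interval a b t ->
    (`|t| - Num.sqrt d) * (1 - l) <= (c t).1 <= d + `|t|.
  move=> tI; have [t0|t0] := leP 0 t.
    by rewrite ger0_norm//; apply: F2.
  rewrite ltr0_norm//; have := B2 (- t); rewrite opprK; apply.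
    by rewrite oppr_ge0 ltW.
  by apply/time_interval_opp; rewrite opprK.
have rlt t : time_interval a b t -> (c t).1 < r0.
  by move=> tI; have [/andP[]] := radial_equation gw geo usp tI.
have l10 : 0 < 1 - l by rewrite subr_gt0.
(* The time at which the lower bound on the radial coordinate equals [r0]. *)
set T := Num.sqrt d + r0 / (1 - l) in F1 *.
have r00 : 0 < r0 by have [[_]] := gw.
have T0 : 0 < T by rewrite ltr_wpDl ?sqrtr_ge0// divr_gt0.
have nT t : `|t| = T -> ~ time_interval a b t.
  move=> tT tI; have /andP[+ _] := bounds t tI; have := rlt t tI.
  by rewrite tT /T addrAC subrr add0r divfK ?gt_eqF// leNgt => ->.
have [a0 b0] := andP I0.
split => //.
- by rewrite EFinN -leeNr.
- rewrite leNgt; apply/negP => aT; apply: (nT (- T)).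
    by rewrite normrN gtr0_norm.
  by rewrite /time_interval/= aT/= (lt_trans _ b0)// lte_fin oppr_lt0.
- rewrite leNgt; apply/negP => Tb; apply: (nT T); first by rewrite gtr0_norm.
  by rewrite /time_interval/= Tb andbT (lt_trans a0)// lte_fin.
Qed.

Lemma geodesic_comparison (a b a' b' : \bar R) (c c' : R -> R * Y) t :
  (forall r s a y, 0 <= r < r0 -> 0 <= s < r0 -> cdom (atY a) y -> h r a y = h s a y) ->
  geodesic_on D atC g a b c -> unit_speed_on atC g a b c ->
  time_interval a b 0 ->
  (forall t, time_interval a b t -> (c 0).1 <= (c t).1) ->
  geodesic_on D atC g a' b' c' -> unit_speed_on atC g a' b' c' ->
  time_interval a' b' 0 ->
  (forall t, time_interval a' b' t -> (c' 0).1 <= (c' t).1) ->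
  (c 0).1 < (c' 0).1 -> 0 <= t -> time_interval a b t -> time_interval a' b' t ->
  (c t).1 < (c' t).1.
Proof.
move=> hc geo usp I0 low geo' usp' I0' low' cc' t0 tI tI'.
have [k k0 db] : exists2 k, 0 <= k & derivative_bound atY r0 h k by have [] := gw.
have inI a1 b1 s : time_interval a1 b1 0 -> time_interval a1 b1 t -> 0 <= s <= t ->
    time_interval a1 b1 s.
  move=> /andP[a0 _] /andP[_ tb] /andP[s0 st]; rewrite /time_interval /=.
  by rewrite (lt_le_trans a0) ?lee_fin//= (le_lt_trans _ tb)// lee_fin.
have sol a1 b1 c1 : geodesic_on D atC g a1 b1 c1 -> unit_speed_on atC g a1 b1 c1 ->
    time_interval a1 b1 0 -> time_interval a1 b1 t -> forall s, 0 <= s <= t ->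
    [/\ is_derive s 1 (fun s => (c1 s).1) (derive1 (fun s => (c1 s).1) s),
      is_derive s 1 (derive1 (fun s => (c1 s).1)) (derive1 (derive1 (fun s => (c1 s).1)) s),
      0 < (c1 s).1 < r0
    & f (c1 s).1 * derive1 (derive1 (fun s => (c1 s).1)) s =
      derive1 f (c1 s).1 * (1 - derive1 (fun s => (c1 s).1) s ^+ 2)].
  move=> g1 u1 J0 Jt s st; have sI := inI a1 b1 s J0 Jt st.
  have [h1 h2 h3 _] := radial_equation gw g1 u1 sI.
  have h4 := radial_acceleration_warped hc g1 u1 sI.
  by split; [exact: h2|exact: h3|exact: h1|exact: h4].
have tt : 0 <= t <= t by rewrite t0 lexx.
apply: (@warped_comparison R r0 f (derive1 f) _ _ _ _ _ _ t _ _ _ _ _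
  (sol _ _ _ geo usp I0 tI) (sol _ _ _ geo' usp' I0' tI') _ _ cc' _ _ _ tt) => //.
- exact: warping_is_derive gw.
- move=> x xr; have /andP[x0 xr0] := xr.
  have := convex_derive_ge_ratio cf f_0 x0 xr0 (warping_is_derive gw xr).
  by move=> /(lt_le_trans (f_pos xr)); rewrite pmulr_rgt0// => /ltW.
- move=> x y x0; rewrite le_eqVlt => /predU1P[-> _|xy yr]; first exact: lexx.
  apply: (convex_derive_le cf (ltW x0) xy yr).
    by apply: (warping_is_derive gw); rewrite x0 (lt_trans xy).
  by apply: (warping_is_derive gw); rewrite yr (lt_trans x0).
- move=> x y x0 xy yr; apply: (convex_increasing cf f_0 x0 xy yr).
  by apply: f_pos; rewrite x0 (lt_trans xy).
- exact: derive1_radial_lowest geo usp I0 low.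
- exact: derive1_radial_lowest geo' usp' I0' low'.
- by move=> s st; have [] := radial_acceleration_ge db geo usp (inI _ _ s I0 tI st).
Qed.

End cusp_geodesics.

(** * Limits as the lowest point tends to the singularity *)

Lemma continuous_right_limit (R : realType) (u : R -> R) (l : R) :
  {for 0, continuous u} -> u 0 = l -> (u d)%:E @[d --> (0 : R)^'+] --> l%:E.
Proof.
move=> cu <-; apply: cvg_EFin; first exact: nearW.
exact: cvg_at_right_filter cu.
Qed.

Theorem theoremB (R : realType) (n : nat)
    (X : metricType R) (p : X) (K : Type)
    (atX : K -> chart R (1 + n) X) (gX : K -> X -> 'M[R]_(1 + n))
    (Y : topologicalType) (I : Type) (atY : I -> chart R n Y)
    (r0 : R) (f : R -> R) (h : R -> I -> Y -> 'M[R]_n)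
    (U : set X) (beta : R * Y -> X) (c : R) :
  isolated_singularity p atX gX atY r0 f h U beta ->
  0 <= c -> derivative_bound atY r0 h c -> r0 * c < 1 ->
  let geodesic :=
    maximal_geodesic (@cylinder R Y r0) (cylinder_atlas atY r0)
      (warped_metric f h) in
  let unit_speed := unit_speed_on (cylinder_atlas atY r0) (warped_metric f h) in
  let lowest_at_0 (a b : \bar R) (gam : R -> R * Y) :=
    time_interval a b 0 /\
    forall t, time_interval a b t -> (gam 0).1 <= (gam t).1 in
  (forall (a b : R -> \bar R) (gam : R -> R -> R * Y),
    (forall d, 0 < d < r0 ->
      [/\ geodesic (a d) (b d) (gam d), unit_speed (a d) (b d) (gam d),
          lowest_at_0 (a d) (b d) (gam d) & (gam d 0).1 = d]) ->
    [/\ a d @[d --> 0^'+] --> (- r0)%:E,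
        b d @[d --> 0^'+] --> r0%:E
      & forall t, - r0 < t < r0 -> (gam d t).1 @[d --> 0^'+] --> `|t|])
  /\
  ((forall r s a y, 0 <= r < r0 -> 0 <= s < r0 -> cdom (atY a) y ->
      h r a y = h s a y) ->
   forall (a b a' b' : \bar R) (gam gam' : R -> R * Y),
     geodesic a b gam -> unit_speed a b gam -> lowest_at_0 a b gam ->
     geodesic a' b' gam' -> unit_speed a' b' gam' -> lowest_at_0 a' b' gam' ->
     (gam 0).1 < (gam' 0).1 ->
     forall t, time_interval a b t -> time_interval a' b' t ->
       (gam t).1 < (gam' t).1).
Proof.
move=> [_ gw [f0 cf _] _ _] c0 db rc geodesic unit_speed lowest_at_0.
have mY : smooth_manifold [set: Y] atY by have [[[]]] := gw.
have r00 : 0 < r0 by have [[]] := gw.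
split; last first.
  move=> hc a b a' b' g g' geo us [I0 low] geo' us' [I0' low'] gg' t tI tI'.
  have [t0|t0] := leP 0 t.
    exact: (geodesic_comparison gw f0 cf hc geo.1 us I0 low geo'.1 us' I0' low').
  (* For [t < 0], the reversed geodesics are compared at time [- t]. *)
  have chD := cylinder_is_chart r0 mY.
  have opp0 a1 b1 : time_interval a1 b1 0 -> time_interval (- b1)%E (- a1)%E (0 : R).
    by move=> J0; apply/time_interval_opp; rewrite oppr0.
  have oppt a1 b1 : time_interval a1 b1 t -> time_interval (- b1)%E (- a1)%E (- t).
    by move=> Jt; apply/time_interval_opp; rewrite opprK.
  have lowN a1 b1 (g1 : R -> R * Y) :
      (forall s, time_interval a1 b1 s -> (g1 0).1 <= (g1 s).1) ->
      forall s, time_interval (- b1)%E (- a1)%E s -> (g1 (- 0)).1 <= (g1 (- s)).1.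
    by move=> lo s /time_interval_opp; rewrite oppr0; exact: lo.
  have := geodesic_comparison (t := - t) gw f0 cf hc
    (geodesic_on_opp chD geo.1) (unit_speed_on_opp chD geo.1 us) (opp0 _ _ I0) (lowN _ _ _ low)
    (geodesic_on_opp chD geo'.1) (unit_speed_on_opp chD geo'.1 us') (opp0 _ _ I0')
    (lowN _ _ _ low').
  rewrite oppr0 opprK; apply => //; [by rewrite oppr_ge0 ltW|exact: oppt|exact: oppt].
move=> a b g fam.
(* With these, [d * C] is the quantity [l] of [geodesic_bounds], and [T d] its outer bound on the
   endpoints. *)
pose C := ((1 - r0 * c) ^+ 3)^-1.
pose T d := Num.sqrt d + r0 / (1 - d * C).
have lim1 : (1 - d * C) @[d --> (0 : R)] --> (1 : R).
  rewrite -[X in _ --> X](subr0 1) -[X in _ - X](mul0r C).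
  by apply: cvgB; [exact: cvg_cst|apply: cvgMr_tmp; exact: cvg_id].
have cT : {for 0, continuous T}.
  apply: cvgD; first exact: sqrt_continuous.
  apply: cvgMl_tmp; rewrite mul0r subr0.
  by apply: cvgV lim1; exact: oner_neq0.
have T0 : T 0 = r0 by rewrite /T sqrtr0 mul0r subr0 divr1 add0r.
have small : \forall d \near (0 : R)^'+, 0 < d < r0 /\ d * C < 1.
  near=> d; split.
    by apply/andP; split; near: d; [exact: nbhs_right_gt|exact: nbhs_right_lt].
  rewrite -subr_gt0; near: d.
  exact: (cvgr_gt _ (cvg_at_right_filter lim1) _ ltr01).
have bnd d : 0 < d < r0 -> d * C < 1 ->
    [/\ (a d <= (- (r0 - d))%:E)%E, ((r0 - d)%:E <= b d)%E,
        ((- T d)%:E <= a d)%E, (b d <= (T d)%:E)%E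
      & forall t, time_interval (a d) (b d) t ->
        (`|t| - Num.sqrt d) * (1 - d * C) <= (g d t).1 <= d + `|t|].
  move=> /fam[geo us [I0 low] gd] dC.
  have := geodesic_bounds gw f0 cf c0 db rc geo us I0 low.
  by rewrite gd; apply.
have lim_r : {for (0 : R), continuous (fun d => r0 - d)}.
  by apply: cvgB; [exact: cvg_cst|exact: cvg_id].
split.
- apply: (@squeeze_cvge _ _ _ _ (fun d => (- T d)%:E) _ (fun d => (- (r0 - d))%:E)).
  + by apply: filterS small => d [dr dC]; have [-> _ -> _ _] := bnd d dr dC.
  + by apply: continuous_right_limit; [exact: cvgN|rewrite T0].
  + by apply: continuous_right_limit; [exact: cvgN|rewrite subr0].
- apply: (@squeeze_cvge _ _ _ _ (fun d => (r0 - d)%:E) _ (fun d => (T d)%:E)).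
  + by apply: filterS small => d [dr dC]; have [_ -> _ -> _] := bnd d dr dC.
  + by apply: continuous_right_limit => //; rewrite subr0.
  + exact: continuous_right_limit.
- move=> t; rewrite -ltr_norml => tr.
  apply: (@squeeze_cvgr _ _ _ _ (fun d => (`|t| - Num.sqrt d) * (1 - d * C))
    (fun d => d + `|t|)).
  (* Once [d] is below [r0] minus the absolute value of [t], the time [t] belongs to the domain of
     the geodesic. *)
  + have : \forall d \near (0 : R)^'+, d < r0 - `|t|.
      by apply: nbhs_right_lt; rewrite subr_gt0.
    apply: filterS2 small => d [dr dC] dt; have [ad bd _ _] := bnd d dr dC; apply.
    have /ltr_normlP[t1 t2] : `|t| < r0 - d by rewrite ltrBrDr addrC -ltrBrDr.
    rewrite /time_interval/= (le_lt_trans ad) ?lte_fin 1?ltrNl//=.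
    by rewrite (lt_le_trans _ bd)// lte_fin.
  + rewrite -[X in _ --> X]mulr1; apply: cvgM; last exact: cvg_at_right_filter lim1.
    rewrite -[X in _ --> X]subr0 -[X in _ - X](@sqrtr0 R); apply: cvgB; first exact: cvg_cst.
    by apply: cvg_at_right_filter; exact: sqrt_continuous.
  + rewrite -[X in _ --> X]add0r; apply: cvgD; last exact: cvg_cst.
    by apply: cvg_at_right_filter; exact: cvg_id.
Unshelve. all: by end_near.
Qed.
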